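(* Let $0<\beta<1$ and $t>0$. The density $g_\beta(x,t)$ of the inverse $\beta$-stable subordinator $E_\beta(t)$ is given in terms of the $H$-function by $$g_\beta(x,t)=\frac{1}{t^{\beta}}\,\mathrm{H}^{1,0}_{1,1}\left[\frac{x}{t^{\beta}}\,\middle|\,\begin{matrix}(1-\beta,\beta)\\(0,1)\end{matrix}\right],\qquad x>0.$$
   Context: Stable subordinator: for $0<\beta<1$, $D_\beta(t)$, $t\ge 0$, is the one-dimensional Lévy process with non-decreasing sample paths, zero drift and Lévy measure $\frac{\beta}{\Gamma(1-\beta)x^{1+\beta}}\mathbb{I}_{(0,\infty)}(x)\,dx$; equivalently $\mathbb{E}(e^{-sD_\beta(t)})=e^{-ts^\beta}$ for $s>0$. The inverse $\beta$-stable subordinator is $E_\beta(t)=\inf\{x>0:D_\beta(x)>t\}$; for $t>0$, $g_\beta(\cdot,t)$ denotes the (continuous) probability density of $E_\beta(t)$ on $(0,\infty)$. Fox $H$-function: for integers $0\le m\le q$, $0\le n\le p$, complex numbers $a_k,b_l$, reals $A_k,B_l>0$ and $z>0$, $$\mathrm{H}^{m,n}_{p,q}\left[z\,\middle|\,\begin{matrix}(a_k,A_k)_{1,p}\\(b_l,B_l)_{1,q}\end{matrix}\right]=\frac{1}{2\pi i}\int_{c-i\infty}^{c+i\infty}\chi(s)z^{-s}\,ds,\qquad \chi(s)=\frac{\prod_{k=1}^{n}\Gamma(1-a_k-A_ks)\prod_{l=1}^{m}\Gamma(b_l+B_ls)}{\prod_{k=n+1}^{p}\Gamma(a_k+A_ks)\prod_{l=m+1}^{q}\Gamma(1-b_l-B_ls)},$$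 where $z^{-s}=e^{-s\ln z}$, empty products equal $1$, and $c$ is a real number such that the singularities of $\Gamma(b_l+B_ls)$, $1\le l\le m$, lie entirely to the left of the path of integration and those of $\Gamma(1-a_k-A_ks)$, $1\le k\le n$, lie entirely to the right. The upper row lists the pairs $(a_k,A_k)$ in order, the lower row the pairs $(b_l,B_l)$ in order. *)

(* Defs.v *)
From HB Require Import structures.
From mathcomp Require Import all_boot all_order all_algebra.
From mathcomp Require Import all_classical all_reals all_analysis.
From mathcomp Require Import complex.

Set Implicit Arguments.
Unset Strict Implicit.
Unset Printing Implicit Defensive.

Import Order.TTheory GRing.Theory Num.Theory.
Import numFieldNormedType.Exports.

Local Open Scope classical_set_scope.
Local Open Scope ring_scope.
Local Open Scope complex_scope.

(* Processes are indexed by R; only times t >= 0 matter. *)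

Section Processes.
Context {d : measure_display} {T : measurableType d} {R : realType}.
Variable P : probability T R.
Implicit Types (D : R -> {RV P >-> R}).

Definition independent_increments D : Prop :=
  forall (n : nat) (t : nat -> R) (B : nat -> set R),
    0 <= t 0%N -> (forall i, t i <= t i.+1) ->
    (forall i, measurable (B i)) ->
    P [set w | forall i, (i < n)%N -> B i (D (t i.+1) w - D (t i) w)] =
    (\prod_(i < n) fine (P [set w | B i (D (t i.+1) w - D (t i) w)]))%:E.

Definition stationary_increments D : Prop :=
  forall (s t : R) (B : set R), 0 <= s -> 0 <= t -> measurable B ->
    P [set w | B (D (s + t) w - D s w)] = P [set w | B (D t w)].

Definition cadlag_paths D : Prop :=
  forall w : T,
    (forall t : R, 0 <= t -> (D u w : R) @[u --> t^'+] --> (D t w : R)) /\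
    (forall t : R, 0 < t -> cvg ((D u w : R) @[u --> t^'-])).

Definition levy_process D : Prop :=
  [/\ {ae P, forall w, D 0 w = 0},
      independent_increments D,
      stationary_increments D
    & cadlag_paths D].

Definition nondecreasing_paths D : Prop :=
  forall (w : T) (s t : R), 0 <= s -> s <= t -> D s w <= D t w.

(* Lévy-Khintchine formula of a subordinator with drift b and Lévy measure
   f(x) dx on (0, +oo):
   E exp(-s D(t)) = exp(-t (b s + \int_0^oo (1 - exp(-s x)) f(x) dx)). *)
Definition has_drift_levy_density D (b : R) (f : R -> R) : Prop :=
  forall s t : R, 0 < s -> 0 <= t ->
    ('E_P[fun w => expR (- (s * D t w))] =
    expeR (- (t%:E * ((b * s)%:E +
      \int[lebesgue_measure]_(x in `]0%R, +oo[)
        ((1 - expR (- (s * x))) * f x)%:E))))%E.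

(* Euler's integral, meant for a > 0. *)
Definition Gamma (a : R) : R :=
  \int[lebesgue_measure]_(x in `]0, +oo[) (x `^ (a - 1) * expR (- x)).

Definition stable_levy_density (beta x : R) : R :=
  beta / (Gamma (1 - beta) * x `^ (1 + beta)).

Definition stable_subordinator (beta : R) D : Prop :=
  [/\ levy_process D,
      nondecreasing_paths D
    & has_drift_levy_density D 0 (stable_levy_density beta)].

(* Extended real, so that the infimum of the empty set is +oo. *)
Definition inverse_subordinator D (t : R) (w : T) : \bar R :=
  ereal_inf [set x%:E | x in [set x : R | 0 < x /\ t < D x w]].

(* The values of g outside (0, +oo) are irrelevant; taking A = setT shows that
   the law of X is carried by (0, +oo). *)
Definition density_on_pos (X : T -> \bar R) (g : R -> R) : Prop :=
  [/\ measurable_fun (`]0, +oo[ : set R) g,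
      (forall x, 0 < x -> 0 <= g x)
    & forall A : set R, measurable A ->
        P (X @^-1` (EFin @` A)) =
        (\int[lebesgue_measure]_(x in A `&` `]0%R, +oo[) (g x)%:E)%E].

End Processes.

Section ComplexIntegral.
Context {R : realType}.

Definition cexp (z : R[i]) : R[i] :=
  (expR (complex.Re z))%:C * (cos (complex.Im z) +i* sin (complex.Im z)).

(* z ^ w for real z > 0. *)
Definition cpow (z : R) (w : R[i]) : R[i] := cexp (w * (ln z)%:C).

Definition Cintegrable (A : set R) (f : R -> R[i]) : Prop :=
  lebesgue_measure.-integrable A (EFin \o (fun x => complex.Re (f x))) /\
  lebesgue_measure.-integrable A (EFin \o (fun x => complex.Im (f x))).

Definition Cintegral (A : set R) (f : R -> R[i]) : R[i] :=
  (\int[lebesgue_measure]_(x in A) complex.Re (f x)) +i*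
  (\int[lebesgue_measure]_(x in A) complex.Im (f x)).

(* Euler's integral, meant for Re z > 0. *)
Definition cGamma_integral (z : R[i]) : R[i] :=
  Cintegral `]0, +oo[ (fun x => cpow x (z - 1) * (expR (- x))%:C).

(* Number of unit shifts that bring z into the half-plane Re > 0. *)
Definition cGamma_shift (z : R[i]) : nat :=
  if 0 < complex.Re z then 0%N else (Num.truncn (- complex.Re z)).+1.

(* Analytic continuation by the functional equation.  At the poles 0, -1, ...
   the denominator vanishes, so that cGamma z = 0 and (cGamma z)^-1 = 0, the
   latter being the value of the entire function 1 / Gamma. *)
Definition cGamma (z : R[i]) : R[i] :=
  cGamma_integral (z + (cGamma_shift z)%:R) /
  \prod_(k < cGamma_shift z) (z + k%:R).

Definition cGamma_pole (z : R[i]) : Prop := exists k : nat, z = - k%:R.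

End ComplexIntegral.

(* Fox H-function: [up] lists the pairs (a_k, A_k) and [lo] the pairs
   (b_l, B_l). *)

Section FoxH.
Context {R : realType}.
Variables (m n : nat) (p q : nat).
Variables (up : p.-tuple (R[i] * R)) (lo : q.-tuple (R[i] * R)).

Definition foxH_chi (s : R[i]) : R[i] :=
  ((\prod_(a <- take n up) cGamma (1 - a.1 - a.2%:C * s)) *
   (\prod_(b <- take m lo) cGamma (b.1 + b.2%:C * s))) /
  ((\prod_(a <- drop n up) cGamma (a.1 + a.2%:C * s)) *
   (\prod_(b <- drop m lo) cGamma (1 - b.1 - b.2%:C * s))).

Definition foxH_integrand (z : R) (s : R[i]) : R[i] :=
  foxH_chi s * cpow z (- s).

(* The line Re s = c separates the two families of poles. *)
Definition foxH_contour (c : R) : Prop :=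
  (forall (b : R[i] * R) (s : R[i]), b \in take m lo ->
     cGamma_pole (b.1 + b.2%:C * s) -> complex.Re s < c) /\
  (forall (a : R[i] * R) (s : R[i]), a \in take n up ->
     cGamma_pole (1 - a.1 - a.2%:C * s) -> c < complex.Re s).

(* (2 pi i)^-1 times the integral along s = c + i u, with ds = i du. *)
Definition foxH_line_integral (c z : R) : R[i] :=
  (2 * pi%:C * (0 +i* 1))^-1 *
  Cintegral setT (fun u : R => foxH_integrand z (c +i* u) * (0 +i* 1)).

(* h is the value at z of the H-function: an admissible line exists and, along
   every admissible line, the integral converges absolutely and equals h. *)
Definition is_foxH (z : R) (h : R[i]) : Prop :=
  [/\ (m <= q)%N /\ (n <= p)%N,
      (forall a, a \in (up : seq _) -> 0 < a.2) /\
      (forall b, b \in (lo : seq _) -> 0 < b.2),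
      0 < z,
      exists c : R, foxH_contour c
    & forall c : R, foxH_contour c ->
        Cintegrable setT (fun u : R => foxH_integrand z (c +i* u)) /\
        foxH_line_integral c z = h].

End FoxH.

(* Main.v *)
(* Let X = D(1) - D(0) and Y = (t / X)^beta.  By self-similarity Y has the law
   of E_beta(t), that is, density g.  Integrating r^(q-1) E[X exp(-r X)]
   = r^(q-1) beta r^(beta-1) exp(-r^beta) over r > 0, with q = 1 - beta + beta s,
   in two ways gives
     Gamma(1 - beta + beta s) E[X^(beta(1-s))] = Gamma(s),  Re s > 0,
   so that chi(s) = E[X^(beta(1-s))] and, for z = x / t^beta and s = c + iu,
     chi(s) z^(-s) = t^beta E[Y^(-1) (Y/x)^c exp(iu ln(Y/x))].
   This is integrable in u: shifting Gamma(s) upwards by N + 2 steps and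
   Gamma(1 - beta + beta s) by N steps, with N large, leaves a factor |s|^(-2).
   Damping by exp(-e|u|) and applying Fubini turns the integral over u > 0 of
   the real part into the integral of h(y) = (y/x)^c g(y) against the Poisson
   kernel e / (e^2 + ln(y/x)^2) dy / y, which tends to pi h(x) = pi g(x). *)

Require Import Defs.
From HB Require Import structures.
From mathcomp Require Import all_boot all_order all_algebra.
From mathcomp Require Import all_classical all_reals all_analysis.
From mathcomp Require Import complex measurable_realfun zify ring lra.

Set Implicit Arguments.
Unset Strict Implicit.
Unset Printing Implicit Defensive.

Import Order.TTheory GRing.Theory Num.Theory.
Import numFieldNormedType.Exports.

Local Open Scope classical_set_scope.
Local Open Scope ring_scope.
Local Open Scope complex_scope.

(** * Integration on the positive half-line *)

Section HalfLine.
Context {R : realType}.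
Notation mu := (@lebesgue_measure R).
Implicit Types (f F G : R -> R) (a b l : R).

(** The factor X in E[X exp(-r X)] is there to reach every admissible line. The same computation
    with E[exp(-r X)] yields only moments of negative order, that is Re s > 1, whereas every c > 0
    is admissible. Each c is then treated directly, so the common value on all lines comes out of
    the computation and not from moving a contour. Solving for chi means dividing by Gamma(w), w = 1
    - beta + beta s, so Gamma must have no zero with positive real part: the functional equation
    pushes a zero to the right, where a concentration estimate excludes it. The decay of chi is
    obtained without asymptotics of Gamma. A moment is bounded on each vertical line, and the shifts
    turn boundedness at s + N + 2 into decay at s once Gamma(w + beta (N + 2)) is compared with
    Gamma(w + N). As beta < 1, the gap N - beta (N + 2) is positive for large N, and a Beta integral
    gives the comparison. Since D(0) = 0 holds only almost surely, X is taken to be an increment,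
    which is non-negative everywhere. *)

Definition pos_itv n : set R := `[(n.+2%:R)^-1, n.+2%:R]%classic.

(** The shift by 2 keeps the endpoints strictly apart already for n = 0, as the fundamental theorem
    of calculus on a segment requires. *)
Lemma pos_itv_bnd n : 0 < (n.+2%:R)^-1 :> R /\ (n.+2%:R)^-1 < n.+2%:R :> R.
Proof.
split; first by rewrite invr_gt0.
by rewrite (@lt_trans _ _ 1)// ?invf_lt1 ?ltr1n.
Qed.

Lemma nondecreasing_pos_itv : nondecreasing_seq pos_itv.
Proof.
move=> m n mn; rewrite subsetEset => x; rewrite /pos_itv/= !in_itv/= => /andP[h1 h2].
rewrite (le_trans _ h1) ?(le_trans h2)// ?ler_nat//.
by rewrite lef_pV2 ?posrE// ler_nat.
Qed.

Lemma bigcup_pos_itv : \bigcup_n pos_itv n = `]0, +oo[%classic.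
Proof.
apply/seteqP; split=> x /=.
  by move=> [n _]; rewrite /pos_itv/= !in_itv/= andbT => /andP[+ _]; apply: lt_le_trans; exact: (pos_itv_bnd n).1.
rewrite in_itv/= andbT => x0.
exists (Num.truncn (x + x^-1)) => //; rewrite /pos_itv/= in_itv/=.
have xV : 0 < x^-1 by rewrite invr_gt0.
have h : x + x^-1 <= (Num.truncn (x + x^-1)).+2%:R.
  have := truncnS_gt (x + x^-1) => /ltW/le_trans; apply.
  by rewrite ler_nat.
apply/andP; split; last by apply: le_trans h; lra.
rewrite -[leRHS]invrK lef_pV2 ?posrE//.
by apply: le_trans h; lra.
Qed.

Lemma integral_FTC_pos_itv f F n : (forall x : R, 0 < x -> is_derive x 1 F (f x)) ->
  {in `]0, +oo[, continuous f} ->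
  (\int[mu]_(x in pos_itv n) (f x)%:E = (F n.+2%:R)%:E - (F (n.+2%:R)^-1)%:E)%E.
Proof.
move=> dF cf; have [n0 nn] := pos_itv_bnd n.
have cF x : 0 < x -> {for x, continuous F}.
  move=> x0; apply: differentiable_continuous; apply/derivable1_diffP.
  by case: (dF x x0).
apply: continuous_FTC2 => //.
- apply/continuous_within_itvP => //; split.
  + by move=> x; rewrite in_itv/= => /andP[x1 _]; apply: cf; rewrite in_itv/= andbT (lt_trans n0).
  + by apply: cvg_at_right_filter; apply: cf; rewrite in_itv/= andbT.
  + by apply: cvg_at_left_filter; apply: cf; rewrite in_itv/= andbT.
- split.
  + by move=> x; rewrite in_itv/= => /andP[x1 _]; case: (dF x (lt_trans n0 x1)).
  + by apply: cvg_at_right_filter; exact: cF.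
  + by apply: cvg_at_left_filter; exact: cF.
- move=> x; rewrite in_itv/= => /andP[x1 _]; rewrite derive1E.
  by case: (dF x (lt_trans n0 x1)).
Qed.

Lemma cvg_pos_itv_ends F l0 l1 : F x @[x --> 0^'+] --> l0 -> F x @[x --> +oo] --> l1 ->
  ((F n.+2%:R)%:E - (F (n.+2%:R)^-1)%:E)%E @[n --> \oo] --> (l1 - l0)%:E.
Proof.
move=> F0 F1; apply: cvg_EFin; first by near=> n.
apply: cvgB.
  apply: (cvg_comp (fun n : nat => (n.+2%:R : R)) F) F1.
  have := @cvgr_idn R; move/cvgryPge => h; apply/cvgryPge => A.
  by have := h A; apply: filterS => n /le_trans; apply; rewrite ler_nat; lia.
move/cvg_at_rightP : F0; apply; split=> [n|]; first by rewrite invr_gt0.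
by have := @cvg_harmonic R; rewrite -cvg_shiftS.
Unshelve. all: by end_near. Qed.

(** Monotone convergence along [pos_itv] passes from segments to the half-line. For a non-negative
    integrand the two limits of the primitive already give integrability ([ge0_integrable_FTC0y]);
    signed integrands go through dominated convergence ([Rintegral_FTC0y]). *)
Lemma ge0_integral_FTC0y f F l0 l1 : (forall x : R, 0 < x -> 0 <= f x) ->
  (forall x : R, 0 < x -> is_derive x 1 F (f x)) ->
  {in `]0, +oo[, continuous f} ->
  F x @[x --> 0^'+] --> l0 -> F x @[x --> +oo] --> l1 ->
  (\int[mu]_(x in `]0%R, +oo[) (f x)%:E = (l1 - l0)%:E)%E.
Proof.
move=> f0 dF cf F0 F1.
have mf : measurable_fun (`]0, +oo[%classic : set R) f.
  by apply: open_continuous_measurable_fun => // x; rewrite inE => /cf.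
have hsub n : pos_itv n `<=` `]0, +oo[%classic by rewrite -bigcup_pos_itv; exact: bigcup_sup.
have H : (\int[mu]_(x in pos_itv n) (f x)%:E @[n --> \oo] --> \int[mu]_(x in \bigcup_n pos_itv n) (f x)%:E)%E.
  apply: ge0_nondecreasing_set_cvg_integral => //; first exact: nondecreasing_pos_itv.
  - by move=> n; exact: measurable_itv.
  - by move=> n; apply/measurable_EFinP; apply: measurable_funS mf => //; exact: hsub.
  - by move=> n x /hsub /=; rewrite in_itv/= andbT lee_fin; exact: f0.
rewrite bigcup_pos_itv in H; apply: (cvg_unique _ H) => //.
- have := cvg_pos_itv_ends F0 F1; apply: cvg_trans; apply: near_eq_cvg.
  by near=> n; rewrite /= (integral_FTC_pos_itv n dF cf).
Unshelve. all: by end_near. Qed.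

Lemma cvg_integral_pos_itv f : mu.-integrable `]0, +oo[ (EFin \o f) ->
  (\int[mu]_(x in pos_itv n) (f x)%:E @[n --> \oo] --> \int[mu]_(x in `]0%R, +oo[) (f x)%:E)%E.
Proof.
move=> fi; have hsub n : pos_itv n `<=` `]0, +oo[%classic by rewrite -bigcup_pos_itv; exact: bigcup_sup.
have mpos_itv n : measurable (pos_itv n) by exact: measurable_itv.
have mf := measurable_int _ fi.
suff : (\int[mu]_(x in `]0%R, +oo[) ((EFin \o f) \_ (pos_itv n)) x @[n --> \oo] --> \int[mu]_(x in `]0%R, +oo[) (EFin \o f) x)%E.
  by under eq_fun do rewrite -integral_mkcondr (setIidr (@hsub _)).
apply: (and3_rec (fun _ _ h => h) (dominated_convergence _ _ _ _ (integrable_abse fi) _)) => //.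
- move=> n; apply/(measurable_restrict (EFin \o f) (mpos_itv n)) => //.
  by apply: measurable_funS mf.
- apply: aeW => x x0; have [m _ hm] : (\bigcup_n pos_itv n) x by rewrite bigcup_pos_itv.
  apply: (@cvg_trans _ ((cst (f x)%:E : nat -> _) @ \oo)); last exact: cvg_cst.
  apply: near_eq_cvg; near=> n.
  rewrite patchE mem_set//; have : (m <= n)%N by near: n; exists m.
  by move=> /nondecreasing_pos_itv; rewrite subsetEset; apply.
- apply: aeW => x n _; rewrite patchE; case: ifPn => // _.
  by rewrite (_ : point = 0%E :> \bar R)// abse0 abse_ge0.
Unshelve. all: by end_near. Qed.

Lemma Rintegral_FTC0y f F l0 l1 :
  (forall x : R, 0 < x -> is_derive x 1 F (f x)) ->
  {in `]0, +oo[, continuous f} -> mu.-integrable `]0, +oo[ (EFin \o f) ->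
  F x @[x --> 0^'+] --> l0 -> F x @[x --> +oo] --> l1 ->
  \int[mu]_(x in `]0, +oo[) f x = l1 - l0.
Proof.
move=> dF cf fi F0 F1; rewrite /Rintegral.
rewrite (_ : l1 - l0 = fine (l1 - l0)%:E)//; congr fine.
apply: (cvg_unique _ (cvg_integral_pos_itv fi)) => //.
- have := cvg_pos_itv_ends F0 F1; apply: cvg_trans; apply: near_eq_cvg.
  by near=> n; rewrite /= (integral_FTC_pos_itv n dF cf).
Unshelve. all: by end_near. Qed.

Lemma ge0_integrable_FTC0y f F l0 l1 : (forall x : R, 0 < x -> 0 <= f x) ->
  (forall x : R, 0 < x -> is_derive x 1 F (f x)) ->
  {in `]0, +oo[, continuous f} ->
  F x @[x --> 0^'+] --> l0 -> F x @[x --> +oo] --> l1 ->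
  mu.-integrable `]0, +oo[ (EFin \o f).
Proof.
move=> f0 dF cf F0 F1; apply/integrableP; split.
  apply/measurable_EFinP.
  by apply: open_continuous_measurable_fun => // x; rewrite inE => /cf.
under eq_integral => x.
  rewrite inE/= in_itv/= andbT => x0; rewrite ger0_norm ?f0//; over.
by rewrite (ge0_integral_FTC0y f0 dF cf F0 F1) ltry.
Qed.

(** The image segments [K n] exhaust (0, +oo) because F is onto, so both sides are limits of equal
    integrals over segments. *)
Lemma ge0_integral_subst0y F F' G :
  (forall x : R, 0 < x -> 0 < F x) ->
  (forall x y : R, 0 < x -> x < y -> F x < F y) ->
  (forall y : R, 0 < y -> exists2 x, 0 < x & F x = y) ->
  (forall x : R, 0 < x -> is_derive x 1 F (F' x)) ->
  {in `]0, +oo[, continuous F'} ->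
  (forall x : R, 0 < x -> 0 <= G x) ->
  {in `]0, +oo[, continuous G} ->
  (\int[mu]_(x in `]0%R, +oo[) (G x)%:E =
   \int[mu]_(x in `]0%R, +oo[) (G (F x) * F' x)%:E)%E.
Proof.
move=> F0 Fi Fs dF cF' G0 cG.
have cF x : 0 < x -> {for x, continuous F}.
  move=> x0; apply: differentiable_continuous; apply/derivable1_diffP.
  by case: (dF x x0).
have F'E (x : R) : 0 < x -> F^`()%classic x = F' x by move=> x0; rewrite derive1E; case: (dF x x0).
have F'0 x : 0 < x -> 0 <= F' x.
  move=> x0; rewrite -F'E//; apply: (@incr_derive1_ge0_itvy _ _ false 0).
  - by move=> y; rewrite inE/= in_itv/= andbT => y0; case: (dF y y0).
  - by move=> y z; rewrite !in_itv/= !andbT => y0 z0; exact: Fi.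
  - by rewrite in_itv/= andbT.
have cdF (x : R) : 0 < x -> F^`()%classic y @[y --> x] --> F^`()%classic x.
  move=> x0; rewrite F'E//; apply: (@cvg_trans _ (F' y @[y --> x])).
    apply: near_eq_cvg; near=> y; rewrite F'E//; near: y; exact: lt_nbhsr.
  by apply: cF'; rewrite in_itv/= andbT.
have hsub n : pos_itv n `<=` `]0, +oo[%classic by rewrite -bigcup_pos_itv; exact: bigcup_sup.
pose K n : set R := `[F (n.+2%:R)^-1, F n.+2%:R]%classic.
have Ksub n : K n `<=` `]0, +oo[%classic.
  move=> x; rewrite /K/= !in_itv/= andbT => /andP[+ _]; apply: lt_le_trans.
  by apply: F0; exact: (pos_itv_bnd n).1.
have mG : measurable_fun (`]0, +oo[%classic : set R) G.
  by apply: open_continuous_measurable_fun => // x; rewrite inE => /cG.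
have cGF : {in `]0, +oo[, continuous (fun x => G (F x) * F' x)}.
  move=> x; rewrite in_itv/= andbT => x0; apply: cvgM; last by apply: cF'; rewrite in_itv/= andbT.
  apply: continuous_comp; first exact: cF.
  by apply: cG; rewrite in_itv/= andbT F0.
have mGF : measurable_fun (`]0, +oo[%classic : set R) (fun x => G (F x) * F' x).
  by apply: open_continuous_measurable_fun => // x; rewrite inE => /cGF.
have Fle x y : 0 < x -> x <= y -> F x <= F y.
  by move=> x0; rewrite le_eqVlt => /predU1P[->//|xy]; apply/ltW/Fi.
have ndK : nondecreasing_seq K.
  move=> m n mn; rewrite !subsetEset => x; rewrite /K/= !in_itv/= => /andP[h1 h2].
  have hm := pos_itv_bnd m; have hn := pos_itv_bnd n; rewrite (le_trans _ h1) ?(le_trans h2)//; apply: Fle => //.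
  - by rewrite ler_nat.
  - by rewrite lef_pV2 ?posrE// ler_nat.
have UK : \bigcup_n K n = `]0, +oo[%classic.
  apply/seteqP; split; first by move=> x [n _ /Ksub].
  move=> y; rewrite /= in_itv/= andbT => /Fs[x x0 <-].
  have [n _ hx] : (\bigcup_n pos_itv n) x by rewrite bigcup_pos_itv /= in_itv/= andbT.
  exists n => //; move: hx; rewrite /pos_itv/K/= !in_itv/= => /andP[h1 h2].
  by rewrite !Fle// (pos_itv_bnd n).1.
have H1 : (\int[mu]_(x in K n) (G x)%:E @[n --> \oo] --> \int[mu]_(x in \bigcup_n K n) (G x)%:E)%E.
  apply: ge0_nondecreasing_set_cvg_integral => //.
  - by move=> n; exact: measurable_itv.
  - by move=> n; apply/measurable_EFinP; apply: measurable_funS mG => //; exact: Ksub.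
  - by move=> n x /Ksub /=; rewrite in_itv/= andbT lee_fin; exact: G0.
have H2 : (\int[mu]_(x in pos_itv n) (G (F x) * F' x)%:E @[n --> \oo] -->
   \int[mu]_(x in \bigcup_n pos_itv n) (G (F x) * F' x)%:E)%E.
  apply: ge0_nondecreasing_set_cvg_integral => //; first exact: nondecreasing_pos_itv.
  - by move=> n; exact: measurable_itv.
  - by move=> n; apply/measurable_EFinP; apply: measurable_funS mGF => //; exact: hsub.
  - move=> n x /hsub /=; rewrite in_itv/= andbT lee_fin => x0.
    by rewrite mulr_ge0 ?F'0// G0// F0.
rewrite UK in H1; rewrite bigcup_pos_itv in H2.
apply: (cvg_unique _ H1) => //; apply: cvg_trans H2; apply: near_eq_cvg; near=> n.
have [n0 nn] := pos_itv_bnd n.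
rewrite /K integration_by_substitution_increasing ?(ltW nn)//.
- apply: eq_integral => x; rewrite inE /pos_itv/= in_itv/= => /andP[h1 h2].
  by rewrite /= !fctE F'E// (lt_le_trans n0).
- by move=> x y; rewrite !in_itv/= => /andP[h1 h2] _; apply: Fi; exact: lt_le_trans h1.
- by move=> x; rewrite in_itv/= => /andP[h1 h2]; apply: cdF; exact: lt_trans h1.
- by apply/cvg_ex; eexists; apply: cvg_at_right_filter; exact: cdF.
- by apply/cvg_ex; eexists; apply: cvg_at_left_filter; exact: cdF.
- split.
  + by move=> x; rewrite in_itv/= => /andP[x1 _]; case: (dF x (lt_trans n0 x1)).
  + by apply: cvg_at_right_filter; exact: cF.
  + by apply: cvg_at_left_filter; apply: cF.
- apply/continuous_within_itvP; first exact: Fi.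
  have Fn0 := F0 _ n0; split.
  + by move=> x; rewrite in_itv/= => /andP[x1 _]; apply: cG; rewrite in_itv/= andbT (lt_trans Fn0).
  + by apply: cvg_at_right_filter; apply: cG; rewrite in_itv/= andbT.
  + by apply: cvg_at_left_filter; apply: cG; rewrite in_itv/= andbT F0.
Unshelve. all: by end_near. Qed.

Section Subst.
Variables (F F' G : R -> R).
Hypotheses (F0 : forall x : R, 0 < x -> 0 < F x)
  (Fi : forall x y : R, 0 < x -> x < y -> F x < F y)
  (Fs : forall y : R, 0 < y -> exists2 x : R, 0 < x & F x = y)
  (dF : forall x : R, 0 < x -> is_derive x 1 F (F' x))
  (F'0 : forall x : R, 0 < x -> 0 <= F' x)
  (cF' : {in `]0, +oo[, continuous F'})
  (cG : {in `]0, +oo[, continuous G}).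

(** Positive and negative parts are substituted separately: since F' is non-negative, multiplication
    by it commutes with taking them. *)
Lemma integral_subst0y :
  (\int[mu]_(x in `]0%R, +oo[) (G x)%:E =
   \int[mu]_(x in `]0%R, +oo[) (G (F x) * F' x)%:E)%E.
Proof.
rewrite integralE [RHS]integralE; congr (_ - _)%E.
- under eq_integral do rewrite funeposE -EFin_max.
  rewrite (@ge0_integral_subst0y F F' (fun x => Num.max (G x) 0))//.
  + apply: eq_integral => x; rewrite inE/= in_itv/= andbT => x0.
    by rewrite funeposE -EFin_max maxr_pMl ?mul0r// F'0.
  + by move=> x x0; rewrite le_max lexx orbT.
  + by move=> x x0; apply: (@continuous_max _ R G (cst 0)); [exact: cG|exact: cvg_cst].
- under eq_integral do rewrite funenegE -EFinN -EFin_max.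
  rewrite (@ge0_integral_subst0y F F' (fun x => Num.max (- G x) 0))//.
  + apply: eq_integral => x; rewrite inE/= in_itv/= andbT => x0.
    by rewrite funenegE -EFinN -EFin_max maxr_pMl ?mul0r ?mulNr// F'0.
  + by move=> x x0; rewrite le_max lexx orbT.
  + move=> x x0; apply: (@continuous_max _ R (- G) (cst 0)); last exact: cvg_cst.
    by apply: cvgN; exact: cG.
Qed.

End Subst.

Section PowSubst.
Variables (c b : R).
Hypotheses (c0 : 0 < c) (b0 : 0 < b).

Lemma is_derive_powR (x : R) p : 0 < x -> is_derive x 1 (fun y : R => y `^ p) (p * x `^ (p - 1)).
Proof.
move=> x0; apply: DeriveDef; first by apply: derivable_powR; rewrite in_itv/= andbT.
by rewrite -derive1E powR_derive1// in_itv/= andbT.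
Qed.

Lemma continuous_powR (x : R) p : 0 < x -> {for x, continuous (fun y : R => y `^ p)}.
Proof.
move=> x0; apply: differentiable_continuous; apply/derivable1_diffP.
by case: (is_derive_powR p x0).
Qed.

Lemma integral_powsubst0y G : {in `]0, +oo[, continuous G} ->
  (\int[mu]_(x in `]0%R, +oo[) (G x)%:E =
   \int[mu]_(x in `]0%R, +oo[) (G (c * x `^ b) * (c * (b * x `^ (b - 1))))%:E)%E.
Proof.
move=> cG; apply: (@integral_subst0y (fun x => c * x `^ b) (fun x => c * (b * x `^ (b - 1)))) => //.
- by move=> x x0; rewrite mulr_gt0// powR_gt0.
- by move=> x y x0 xy; rewrite ltr_pM2l// gt0_ltr_powR// nnegrE ltW// (lt_trans x0).
- move=> y y0; exists ((y / c) `^ b^-1); first by rewrite powR_gt0// divr_gt0.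
  by rewrite -powRrM mulVf ?gt_eqF// powRr1 ?divr_ge0 ?ltW// mulrC divfK// gt_eqF.
- move=> x x0; have h := is_derive_powR b x0.
  by apply: is_deriveZ.
- by move=> x x0; rewrite !mulr_ge0 ?powR_ge0// ltW.
- move=> x; rewrite in_itv/= andbT => x0.
  apply: cvgM; first exact: cvg_cst.
  by apply: cvgM; [exact: cvg_cst|exact: continuous_powR].
Qed.

Lemma integrable_powsubst0y G : {in `]0, +oo[, continuous G} ->
  mu.-integrable `]0, +oo[ (EFin \o G) ->
  mu.-integrable `]0, +oo[ (fun x => (G (c * x `^ b) * (c * (b * x `^ (b - 1))))%:E).
Proof.
move=> cG /integrableP[mG iG]; apply/integrableP; split.
  apply/measurable_EFinP; apply: open_continuous_measurable_fun => // x.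
  rewrite inE/= in_itv/= andbT => x0.
  apply: cvgM.
    apply: (@continuous_comp _ _ _ (fun x => c * x `^ b) G).
      by apply: cvgM; [exact: cvg_cst|exact: continuous_powR].
    by apply: cG; rewrite in_itv/= andbT mulr_gt0// powR_gt0.
  apply: cvgM; first exact: cvg_cst.
  by apply: cvgM; [exact: cvg_cst|exact: continuous_powR].
move: iG; rewrite /= (@integral_powsubst0y (fun x => `|G x|)); last first.
  by move=> x x0; apply: cvg_norm; exact: cG.
congr (_ < _)%E; apply: eq_integral => x; rewrite inE/= in_itv/= andbT => x0.
by rewrite normrM; congr (_ * _)%:E; rewrite ger0_norm// !mulr_ge0 ?powR_ge0// ltW.
Qed.

End PowSubst.

(** * Convergence of Euler's integral *)

Section GammaIntegrable.
Variable a : R.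
Hypothesis a0 : 0 < a.

(** Raise 1 + x <= b (1 + x / b) <= b e^(x/b) to the power b. *)
Lemma powR1D_le_expR (x b : R) : 0 <= x -> 1 <= b -> (1 + x) `^ b <= b `^ b * expR x.
Proof.
move=> x0 b1; have b0 : 0 < b by exact: lt_le_trans b1.
have h : 1 + x <= b * expR (x / b).
  apply: (@le_trans _ _ (b * (1 + x / b))); last first.
    by rewrite ler_pM2l// expR_ge1Dx.
  by rewrite mulrDr mulr1 mulrC divfK ?gt_eqF// lerD2r.
apply: (@le_trans _ _ ((b * expR (x / b)) `^ b)).
  apply: ge0_ler_powR => //; rewrite ?nnegrE ?ltW// ?mulr_gt0 ?expR_gt0//; lra.
by rewrite powRM ?(ltW b0) ?expR_ge0// -expRM divfK// gt_eqF.
Qed.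

(** The comparison function f is the derivative of (x / (1 + x))^a, that is a x^(a-1) / (1 +
    x)^(a+1); it is integrable because its primitive runs from 0 to 1. The exponential is absorbed
    by [powR1D_le_expR] with b = a + 1. *)
Lemma integrable_Gamma : mu.-integrable `]0, +oo[ (fun x => (x `^ (a - 1) * expR (- x))%:E).
Proof.
pose b := a + 1.
have b1 : 1 <= b by rewrite lerDr ltW.
pose u (x : R) := 1 - (1 + x)^-1.
have uE (x : R) : 0 < x -> u x = x / (1 + x).
  by move=> x0; rewrite /u; field; lra.
have u0 (x : R) : 0 < x -> 0 < u x by move=> x0; rewrite uE// divr_gt0//; lra.
have du (x : R) : 0 < x -> is_derive x 1 u ((1 + x) ^- 2).
  move=> x0; have x1 : 1 + x != 0 by lra.
  have h1 : is_derive x (1 : R) (cst 1 + id : R -> R) (0 + 1) by exact: is_deriveD.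
  have h2 := @is_deriveV _ _ _ _ _ x1 h1.
  have h3 : is_derive x (1 : R) (cst (1:R)) (0:R) by exact: is_derive_cst.
  apply: (is_derive_eq (is_deriveB h3 h2)).
  transitivity (0 - - (1 + x) ^- 2 * (0 + 1)); [by []|ring].
pose f (x : R) := a * (u x) `^ (a - 1) * (1 + x) ^- 2.
have cu (x : R) : 0 < x -> {for x, continuous u}.
  move=> x0; apply: differentiable_continuous; apply/derivable1_diffP.
  by case: (du x x0).
have fi : mu.-integrable `]0, +oo[ (EFin \o f).
  apply: (@ge0_integrable_FTC0y f (fun x => (u x) `^ a) 0 1).
  - by move=> x x0; rewrite /f !mulr_ge0 ?powR_ge0 ?invr_ge0 ?sqr_ge0// ltW.
  - move=> x x0; have := du x x0 => h1; have h2 := is_derive_powR a (u0 _ x0).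
    have := is_derive1_comp h2 h1; by [].
  - move=> x; rewrite in_itv/= andbT => x0.
    apply: cvgM; first apply: cvgM; first exact: cvg_cst.
      apply: (@continuous_comp _ _ _ u (fun y => y `^ (a - 1))); first exact: cu.
      by apply: continuous_powR; exact: u0.
    apply: cvgV; first by rewrite expf_neq0//; lra.
    apply: (@continuous_comp _ _ _ (fun x : R => 1 + x) (fun x => x ^+ 2)).
      by apply: cvgD; [exact: cvg_cst|exact: cvg_id].
    exact: exprn_continuous.
  - apply: (squeeze_cvgr _ (cvg_cst (0 : R)) (powR_cvg0 a0)).
    + near=> x; have x0 : 0 < x by near: x; exact: nbhs_right_gt.
      rewrite powR_ge0/=; apply: ge0_ler_powR; rewrite ?nnegrE ?(ltW a0) ?(ltW x0) ?(ltW (u0 _ x0))//.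
      rewrite uE// ler_pdivrMr ?ler_peMr ?(ltW x0)//; lra.
  - have -> : (1 : R) = 1 `^ a by rewrite powR1.
    apply: (cvg_comp u (fun x => x `^ a)); last exact: continuous_powR.
    have -> : (1 : R) = 1 - 0 by rewrite subr0.
    apply: cvgB; first exact: cvg_cst.
    apply/gtr0_cvgV0; first by near=> x; rewrite addr_gt0.
    by apply: cvg_addrl; exact: cvg_id.
apply: (le_integrable _ _ _ (integrableZl _ (b `^ b / a) fi)) => //.
- apply/measurable_EFinP; apply: open_continuous_measurable_fun => // x.
  rewrite inE/= in_itv/= andbT => x0.
  apply: cvgM; first exact: continuous_powR.
  apply: (@continuous_comp _ _ _ (fun x : R => - x) expR); first by apply: cvgN; exact: cvg_id.
  exact: continuous_expR.
- move=> x; rewrite /= in_itv/= andbT => x0.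
  rewrite lee_fin ger0_norm ?mulr_ge0 ?powR_ge0 ?expR_ge0//; apply: le_trans (ler_norm _).
  rewrite /f uE// powRM ?(ltW x0) ?invr_ge0 ?addr_ge0 ?(ltW x0)//.
  have y0 : 0 < 1 + x by rewrite addr_gt0.
  have -> : (1 + x)^-1 `^ (a - 1) = ((1 + x) `^ (a - 1))^-1.
    by rewrite -powR_inv1 ?(ltW y0)// -powRrM mulN1r powRN.
  have hb : (1 + x) `^ b = (1 + x) `^ (a - 1) * (1 + x) ^+ 2.
    rewrite -powR_mulrn ?(ltW y0)// -powRD; last by rewrite (gt_eqF y0) implybT.
    by congr powR; rewrite /b; ring.
  have Y0 : (1 + x) `^ (a - 1) != 0 by rewrite gt_eqF// powR_gt0.
  have -> : b `^ b / a * (a * (x `^ (a - 1) / (1 + x) `^ (a - 1)) / (1 + x) ^+ 2) =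
    x `^ (a - 1) * (b `^ b / (1 + x) `^ b).
    by rewrite hb; field; rewrite Y0/= !gt_eqF.
  rewrite ler_pM2l ?powR_gt0// expRN ler_pdivlMr ?powR_gt0// mulrC ler_pdivrMr ?expR_gt0//.
  by apply: powR1D_le_expR => //; exact: ltW.
Unshelve. all: by end_near. Qed.

End GammaIntegrable.

End HalfLine.

(** * Complex powers and complex-valued integrals *)

Section Cpow.
Context {R : realType}.
Implicit Types (x y : R) (v w z : R[i]).
Notation Re := complex.Re.
Notation Im := complex.Im.
Notation normc := ComplexField.Normc.normc.

Lemma cexpD v w : cexp (v + w) = cexp v * cexp w.
Proof.
case: v w => [a b] [c d]; rewrite /cexp; simpc => /=.
rewrite expRD cosD sinD; congr (_ +i* _); ring.
Qed.

Lemma cexp0 : cexp (0 : R[i]) = 1.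
Proof. by rewrite /cexp/= expR0 cos0 sin0; simpc. Qed.

Lemma normc_cexp v : normc (cexp v) = expR (Re v).
Proof.
case: v => [a b]; rewrite /cexp; simpc => /=.
rewrite !exprMn -mulrDr cos2Dsin2 mulr1 sqrtr_sqr ger0_norm ?expR_ge0//.
Qed.

Lemma normc_sqrt z : normc z = Num.sqrt (Re z ^+ 2 + Im z ^+ 2).
Proof. by case: z. Qed.

Lemma normc_ge0 z : 0 <= normc z.
Proof. by rewrite normc_sqrt sqrtr_ge0. Qed.

Lemma normc_gt0 z : (0 < normc z) = (z != 0).
Proof.
rewrite lt_neqAle normc_ge0 andbT eq_sym; congr (~~ _).
apply/eqP/eqP => [|->]; first exact: ComplexField.Normc.eq0_normc.
exact: ComplexField.Normc.normc0.
Qed.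

Lemma normr_Re_le z : `|Re z| <= normc z.
Proof.
rewrite normc_sqrt -sqrtr_sqr ler_sqrt ?lerDl ?sqr_ge0//.
by rewrite addr_ge0 ?sqr_ge0.
Qed.

Lemma normr_Im_le z : `|Im z| <= normc z.
Proof.
rewrite normc_sqrt -sqrtr_sqr ler_sqrt ?lerDr ?sqr_ge0//.
by rewrite addr_ge0 ?sqr_ge0.
Qed.

Lemma normc_le z : normc z <= `|Re z| + `|Im z|.
Proof.
rewrite normc_sqrt -[leRHS]ger0_norm ?addr_ge0// -sqrtr_sqr ler_sqrt ?sqr_ge0//.
by rewrite sqrrD !real_normK ?num_real// lerD2r lerDl mulrn_wge0// mulr_ge0.
Qed.

Lemma cexp_neq0 v : cexp v != 0.
Proof. by rewrite -normc_gt0 normc_cexp expR_gt0. Qed.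

Lemma cpowD x v w : cpow x (v + w) = cpow x v * cpow x w.
Proof. by rewrite /cpow mulrDl cexpD. Qed.

Lemma cpow0 x : cpow x 0 = 1.
Proof. by rewrite /cpow mul0r cexp0. Qed.

Lemma cpow_neq0 x w : cpow x w != 0.
Proof. exact: cexp_neq0. Qed.

Lemma cpowN x w : cpow x (- w) = (cpow x w)^-1.
Proof.
apply: (mulfI (cpow_neq0 x w)).
by rewrite -cpowD subrr cpow0 mulfV// cpow_neq0.
Qed.

Lemma cpowM x y w : 0 < x -> 0 < y -> cpow (x * y) w = cpow x w * cpow y w.
Proof.
by move=> x0 y0; rewrite /cpow lnM ?posrE// -cexpD -mulrDr rmorphD.
Qed.

Lemma cpow_powR x (b : R) w : cpow (x `^ b) w = cpow x (b%:C * w).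
Proof. by rewrite /cpow ln_powR rmorphM mulrA (mulrC w). Qed.

Lemma Re_cpow x w : 0 < x -> Re (cpow x w) = x `^ (Re w) * cos (Im w * ln x).
Proof.
move=> x0; case: w => [a b]; rewrite /cpow/cexp/powR gt_eqF//; simpc => /=.
by rewrite ?mulr0 ?mul0r ?subr0 ?add0r.
Qed.

Lemma Im_cpow x w : 0 < x -> Im (cpow x w) = x `^ (Re w) * sin (Im w * ln x).
Proof.
move=> x0; case: w => [a b]; rewrite /cpow/cexp/powR gt_eqF//; simpc => /=.
by rewrite ?mulr0 ?mul0r ?subr0 ?add0r.
Qed.

Lemma cpow_real x (r : R) : 0 < x -> cpow x r%:C = (x `^ r)%:C.
Proof.
move=> x0; apply/eqP; rewrite eq_complex Re_cpow// Im_cpow//=.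
by rewrite mul0r cos0 sin0 mulr0 mulr1 !eqxx.
Qed.

Lemma normc_cpow x w : 0 < x -> normc (cpow x w) = x `^ (Re w).
Proof.
move=> x0; rewrite /cpow normc_cexp /powR gt_eqF//.
by case: w => [a b]; simpc.
Qed.

Lemma normc_real (r : R) : normc r%:C = `|r|.
Proof. by rewrite normc_sqrt/= expr0n/= addr0 sqrtr_sqr. Qed.

Lemma normcZ (r : R) z : normc (r%:C * z) = `|r| * normc z.
Proof. by rewrite ComplexField.Normc.normcM normc_real. Qed.

Lemma ReZ (r : R) z : Re (r%:C * z) = r * Re z.
Proof. by case: z => a b; simpc. Qed.

Lemma ImZ (r : R) z : Im (r%:C * z) = r * Im z.
Proof. by case: z => a b; simpc. Qed.

Lemma cplx_ReM z w : Re (z * w) = Re z * Re w - Im z * Im w.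
Proof. by case: z w => [a b] [c d]. Qed.

Lemma cplx_ImM z w : Im (z * w) = Re z * Im w + Im z * Re w.
Proof. by case: z w => [a b] [c d]. Qed.

(** Written with [expR (Re w * ln x)] instead of a real power, the formula holds for every real x,
    also x <= 0; this gives measurability on the whole line. *)
Lemma measurable_Re_cpow w : measurable_fun setT (fun x : R => Re (cpow x w)).
Proof.
rewrite (_ : (fun _ => _) = (fun x => expR (Re w * ln x) * cos (Im w * ln x))).
  apply: measurable_funM.
    by apply: measurableT_comp => //; apply: measurable_funM => //; exact: measurable_ln.
  apply: (measurableT_comp (continuous_measurable_fun (@continuous_cos R))).
  by apply: measurable_funM => //; exact: measurable_ln.
apply/funext => x; case: w => [a b]; rewrite /cpow/cexp; simpc => /=.
by rewrite ?mulr0 ?mul0r ?subr0 ?add0r.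
Qed.

Lemma measurable_Im_cpow w : measurable_fun setT (fun x : R => Im (cpow x w)).
Proof.
rewrite (_ : (fun _ => _) = (fun x => expR (Re w * ln x) * sin (Im w * ln x))).
  apply: measurable_funM.
    by apply: measurableT_comp => //; apply: measurable_funM => //; exact: measurable_ln.
  apply: (measurableT_comp (continuous_measurable_fun (@continuous_sin R))).
  by apply: measurable_funM => //; exact: measurable_ln.
apply/funext => x; case: w => [a b]; rewrite /cpow/cexp; simpc => /=.
by rewrite ?mulr0 ?mul0r ?subr0 ?add0r.
Qed.

Lemma continuous_Re_cpow w : {in `]0, +oo[, continuous (fun x : R => Re (cpow x w))}.
Proof.
rewrite (_ : (fun _ => _) = (fun x => expR (Re w * ln x) * cos (Im w * ln x))).
  move=> x; rewrite in_itv/= andbT => x0.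
  have cl := continuous_ln x0.
  apply: cvgM.
    apply: (@continuous_comp _ _ _ (fun x => Re w * ln x) expR); last exact: continuous_expR.
    by apply: cvgM => //; exact: cvg_cst.
  apply: (@continuous_comp _ _ _ (fun x => Im w * ln x) cos); last exact: continuous_cos.
  by apply: cvgM => //; exact: cvg_cst.
apply/funext => x; case: w => [a b]; rewrite /cpow/cexp; simpc => /=.
by rewrite ?mulr0 ?mul0r ?subr0 ?add0r.
Qed.

Lemma continuous_Im_cpow w : {in `]0, +oo[, continuous (fun x : R => Im (cpow x w))}.
Proof.
rewrite (_ : (fun _ => _) = (fun x => expR (Re w * ln x) * sin (Im w * ln x))).
  move=> x; rewrite in_itv/= andbT => x0.
  have cl := continuous_ln x0.
  apply: cvgM.
    apply: (@continuous_comp _ _ _ (fun x => Re w * ln x) expR); last exact: continuous_expR.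
    by apply: cvgM => //; exact: cvg_cst.
  apply: (@continuous_comp _ _ _ (fun x => Im w * ln x) sin); last exact: continuous_sin.
  by apply: cvgM => //; exact: cvg_cst.
apply/funext => x; case: w => [a b]; rewrite /cpow/cexp; simpc => /=.
by rewrite ?mulr0 ?mul0r ?subr0 ?add0r.
Qed.

End Cpow.

(** * Complex-valued integrals over a general measure *)

Section Cint.
Context d (T : measurableType d) (R : realType).
Variable mu : {measure set T -> \bar R}.
Implicit Types (A : set T) (f g : T -> R[i]).
Notation Re := complex.Re.
Notation Im := complex.Im.
Notation normc := ComplexField.Normc.normc.

(** [Cintegral] over an arbitrary measure, so that expectations and Lebesgue integrals are handled
    alike; for Lebesgue measure it is convertible to [Cintegral]. *)
Definition Cint A f : R[i] :=
  (\int[mu]_(x in A) Re (f x)) +i* (\int[mu]_(x in A) Im (f x)).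

Definition Cintble A f : Prop :=
  mu.-integrable A (EFin \o (fun x => Re (f x))) /\
  mu.-integrable A (EFin \o (fun x => Im (f x))).

Lemma eq_Cint A f g : (forall x, A x -> f x = g x) -> Cint A f = Cint A g.
Proof.
by move=> fg; congr (_ +i* _); apply: eq_Rintegral => x /set_mem/fg ->.
Qed.

Lemma eq_Cintble A f g : measurable A -> (forall x, A x -> f x = g x) -> Cintble A f -> Cintble A g.
Proof.
move=> mA fg [h1 h2]; split; [move: h1|move: h2]; apply: eq_integrable => //;
  by move=> x /set_mem/fg /= ->.
Qed.

Lemma CintZ A f (z : R[i]) : measurable A -> Cintble A f ->
  Cint A (fun x => z * f x) = z * Cint A f.
Proof.
move=> mA [f1 f2]; case: z => a b; rewrite /Cint.
have h (c : R) : mu.-integrable A (EFin \o (fun x => c * Re (f x))).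
  by have := integrableZl mA c f1.
have h' (c : R) : mu.-integrable A (EFin \o (fun x => c * Im (f x))).
  by have := integrableZl mA c f2.
simpc; congr (_ +i* _).
- under eq_Rintegral do rewrite cplx_ReM/=.
  by rewrite RintegralB// !RintegralZl.
- under eq_Rintegral do rewrite cplx_ImM/=.
  by rewrite RintegralD// !RintegralZl.
Qed.

Lemma CintbleZ A f (z : R[i]) : measurable A -> Cintble A f ->
  Cintble A (fun x => z * f x).
Proof.
move=> mA [f1 f2]; case: z => a b.
have h (c : R) : mu.-integrable A (EFin \o (fun x => c * Re (f x))).
  by have := integrableZl mA c f1.
have h' (c : R) : mu.-integrable A (EFin \o (fun x => c * Im (f x))).
  by have := integrableZl mA c f2.
split.
- have := integrableB mA (h a) (h' b).
  by apply: eq_integrable => // x _; rewrite /= cplx_ReM/= EFinB.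
- have := integrableD mA (h' a) (h b).
  by apply: eq_integrable => // x _; rewrite /= cplx_ImM/= EFinD.
Qed.

Lemma Cintble_le A f (g : T -> R) : measurable A ->
  measurable_fun A (fun x => Re (f x)) -> measurable_fun A (fun x => Im (f x)) ->
  mu.-integrable A (EFin \o g) -> (forall x, A x -> normc (f x) <= g x) ->
  Cintble A f.
Proof.
move=> mA m1 m2 ig fg; split; apply: le_integrable ig => //.
- exact/measurable_EFinP.
- move=> x Ax; rewrite /= lee_fin; apply: le_trans (ler_norm _).
  exact: le_trans (normr_Re_le _) (fg _ Ax).
- exact/measurable_EFinP.
- move=> x Ax; rewrite /= lee_fin; apply: le_trans (ler_norm _).
  exact: le_trans (normr_Im_le _) (fg _ Ax).
Qed.

(** The factor 2 comes from estimating the real and the imaginary part separately; later only the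
    finiteness of the bound matters. *)
Lemma normc_Cint_le A f (g : T -> R) : measurable A -> Cintble A f ->
  mu.-integrable A (EFin \o g) -> (forall x, A x -> normc (f x) <= g x) ->
  normc (Cint A f) <= 2 * \int[mu]_(x in A) g x.
Proof.
move=> mA [f1 f2] ig fg; apply: le_trans (normc_le _) _.
rewrite mulr_natl mulr2n; apply: lerD.
- apply: le_trans (le_normr_Rintegral mA f1) _; apply: le_Rintegral => //.
    exact: integrable_norm.
  by move=> x Ax; exact: le_trans (normr_Re_le _) (fg _ Ax).
- apply: le_trans (le_normr_Rintegral mA f2) _; apply: le_Rintegral => //.
    exact: integrable_norm.
  by move=> x Ax; exact: le_trans (normr_Im_le _) (fg _ Ax).
Qed.

End Cint.

(** * Tonelli and Fubini on a product of subsets *)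

Section FubiniOn.
Context d1 d2 (T1 : measurableType d1) (T2 : measurableType d2) (R : realType).
Variables (m1 : {sigma_finite_measure set T1 -> \bar R})
  (m2 : {sigma_finite_measure set T2 -> \bar R}).
Variables (A : set T1) (B : set T2).
Hypotheses (mA : measurable A) (mB : measurable B).

(** Truncating f to the rectangle turns iterated integrals over A and B into iterated integrals over
    the whole spaces. *)
Lemma integral_patchX (f : T1 * T2 -> R) x :
  (\int[m2]_y (EFin \o (f \_ (A `*` B))) (x, y) =
   ((fun x => \int[m2]_(y in B) (f (x, y))%:E) \_ A) x)%E.
Proof.
rewrite [RHS]patchE; case: ifPn => [|] xA.
  rewrite [RHS]integral_mkcond; apply: eq_integral => y _ /=.
  rewrite !patchE in_setX xA/=; by case: ifPn.
rewrite integral0_eq// => y _ /=.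
by rewrite patchE in_setX (negbTE xA).
Qed.

Lemma integral_patchXr (f : T1 * T2 -> R) y :
  (\int[m1]_x (EFin \o (f \_ (A `*` B))) (x, y) =
   ((fun y => \int[m1]_(x in A) (f (x, y))%:E) \_ B) y)%E.
Proof.
rewrite [RHS]patchE; case: ifPn => [|] yB.
  rewrite [RHS]integral_mkcond; apply: eq_integral => x _ /=.
  by rewrite !patchE in_setX yB/= andbT; case: ifPn.
rewrite integral0_eq// => x _ /=.
by rewrite patchE in_setX (negbTE yB) andbF.
Qed.

Lemma tonelli_on (f : T1 * T2 -> R) : measurable_fun setT f ->
  (forall x y, A x -> B y -> 0 <= f (x, y)) ->
  (\int[m1]_(x in A) \int[m2]_(y in B) (f (x, y))%:E =
   \int[m2]_(y in B) \int[m1]_(x in A) (f (x, y))%:E)%E.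
Proof.
move=> mf f0.
have mAB : measurable (A `*` B) by exact: measurableX.
have := @fubini_tonelli _ _ _ _ R m1 m2 (EFin \o (f \_ (A `*` B))).
under [X in _ -> _ -> X = _]eq_integral do rewrite integral_patchX.
under [X in _ -> _ -> _ = X]eq_integral do rewrite integral_patchXr.
rewrite -integral_mkcond -integral_mkcond; apply.
- by apply/measurable_EFinP; apply/(measurable_restrictT f mAB); apply: measurable_funTS.
- move=> [x y]/=; rewrite patchE in_setX; case: ifPn => [|_]; last by rewrite lee_fin.
  by rewrite /= => /andP[/set_mem xA /set_mem yB]; rewrite lee_fin f0.
Qed.

Lemma measurable_integral_on (f : T1 * T2 -> R) : measurable_fun setT f ->
  (forall x y, 0 <= f (x, y)) ->
  measurable_fun setT (fun x => \int[m2]_(y in B) (f (x, y))%:E)%E.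
Proof.
move=> mf f0; have mTB : measurable ([set: T1] `*` B) by exact: measurableX.
under eq_fun do rewrite integral_mkcond.
rewrite (_ : (fun _ => _) = (fun x => \int[m2]_y (EFin \o (f \_ ([set: T1] `*` B))) (x, y)))%E; last first.
  apply/funext => x; apply: eq_integral => y _ /=.
  by rewrite !patchE in_setX in_setT/=; case: ifPn.
apply: measurable_fun_fubini_tonelli_F.
- by apply/measurable_EFinP; apply/(measurable_restrictT f mTB); apply: measurable_funTS.
- by move=> [x y] /=; rewrite patchE; case: ifPn => // _; rewrite lee_fin.
Qed.

(** Sections are assumed integrable at every point of A and B, and not just almost everywhere, so
    that the real-valued inner integrals agree pointwise with the extended ones. *)
Lemma fubini_on (f : T1 * T2 -> R) : measurable_fun setT f ->
  (\int[m1]_(x in A) \int[m2]_(y in B) `|f (x, y)|%:E < +oo)%E ->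
  (forall x, A x -> m2.-integrable B (fun y => (f (x, y))%:E)) ->
  (forall y, B y -> m1.-integrable A (fun x => (f (x, y))%:E)) ->
  m1.-integrable A (fun x => (\int[m2]_(y in B) f (x, y))%:E) /\
  \int[m1]_(x in A) \int[m2]_(y in B) f (x, y) =
    \int[m2]_(y in B) \int[m1]_(x in A) f (x, y).
Proof.
move=> mf fi i2 i1.
have mAB : measurable (A `*` B) by exact: measurableX.
have mF : measurable_fun setT (EFin \o (f \_ (A `*` B))).
  by apply/measurable_EFinP; apply/(measurable_restrictT f mAB); apply: measurable_funTS.
have /(proj2 (@integrable12ltyP _ _ _ _ _ m1 m2 _ mF)) iF :
    (\int[m1]_x \int[m2]_y `|(EFin \o (f \_ (A `*` B))) (x, y)| < +oo)%E.
  move: fi; rewrite [X in (X < _)%E -> _]integral_mkcond; congr (_ < _)%E.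
  apply: eq_integral => x _; rewrite -(integral_patchX (fun p => `|f p|)).
  apply: eq_integral => y _ /=.
  by rewrite !patchE; case: ifPn => // _; rewrite normr0.
have e1 : (fun x => \int[m2]_y (EFin \o (f \_ (A `*` B))) (x, y))%E =
  ((fun x => (\int[m2]_(y in B) f (x, y))%R%:E) \_ A).
  apply/funext => x; rewrite integral_patchX !patchE; case: ifPn => // /set_mem xA.
  by rewrite /Rintegral fineK//; apply: integrable_fin_num => //; exact: i2.
have e2 : (fun y => \int[m1]_x (EFin \o (f \_ (A `*` B))) (x, y))%E =
  ((fun y => (\int[m1]_(x in A) f (x, y))%R%:E) \_ B).
  apply/funext => y; rewrite integral_patchXr !patchE; case: ifPn => // /set_mem yB.
  by rewrite /Rintegral fineK//; apply: integrable_fin_num => //; exact: i1.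
split.
- by apply/integrable_mkcond => //; rewrite -e1; exact: (integrable_fubini_F iF).
- have := Fubini iF; rewrite e1 e2 /Rintegral -integral_mkcond -integral_mkcond.
  by move=> ->.
Qed.

End FubiniOn.

Section CFubini.
Context d1 d2 (T1 : measurableType d1) (T2 : measurableType d2) (R : realType).
Variables (m1 : {sigma_finite_measure set T1 -> \bar R})
  (m2 : {sigma_finite_measure set T2 -> \bar R}).
Variables (A : set T1) (B : set T2).
Hypotheses (mA : measurable A) (mB : measurable B).
Notation Re := complex.Re.
Notation Im := complex.Im.
Notation normc := ComplexField.Normc.normc.

Lemma cfubini_on (f : T1 * T2 -> R[i]) :
  measurable_fun setT (fun p => Re (f p)) -> measurable_fun setT (fun p => Im (f p)) ->
  (\int[m1]_(x in A) \int[m2]_(y in B) (normc (f (x, y)))%:E < +oo)%E ->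
  (forall x, A x -> Cintble m2 B (fun y => f (x, y))) ->
  (forall y, B y -> Cintble m1 A (fun x => f (x, y))) ->
  Cintble m1 A (fun x => Cint m2 B (fun y => f (x, y))) /\
  Cint m1 A (fun x => Cint m2 B (fun y => f (x, y))) =
    Cint m2 B (fun y => Cint m1 A (fun x => f (x, y))).
Proof.
move=> mr mi fi i2 i1.
have mn : measurable_fun setT (fun p => normc (f p)).
  rewrite (_ : (fun _ => _) = (fun p => Num.sqrt (Re (f p) ^+ 2 + Im (f p) ^+ 2))).
    apply: (measurableT_comp (continuous_measurable_fun (@sqrt_continuous R))).
    by apply: measurable_funD; apply: measurable_funX.
  by apply/funext => p; rewrite normc_sqrt.
have dom (g : T1 * T2 -> R) : measurable_fun setT g -> (forall p, `|g p| <= normc (f p)) ->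
  (\int[m1]_(x in A) \int[m2]_(y in B) `|g (x, y)|%:E < +oo)%E.
  move=> mg h; apply: le_lt_trans fi; apply: ge0_le_integral => //=.
  - by move=> x _; exact: integral_ge0.
  - apply: measurable_funTS; apply: (@measurable_integral_on _ _ _ _ _ m2 _ mB (fun p => `|g p|)) => //.
    exact: measurableT_comp.
  - apply: measurable_funTS; apply: (@measurable_integral_on _ _ _ _ _ m2 _ mB (fun p => normc (f p))) => //.
    by move=> x y; exact: normc_ge0.
  - move=> x _; apply: ge0_le_integral => //=.
    + by apply/measurable_EFinP; apply: measurable_funTS; do 2 apply: measurableT_comp => //.
    + by apply/measurable_EFinP; apply: measurable_funTS; apply: (measurableT_comp mn).
    + by move=> y _; rewrite lee_fin h.
have [a1 a3] := fubini_on mA mB mr (dom _ mr (fun p => normr_Re_le (f p)))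
  (fun x Ax => (i2 x Ax).1) (fun y By => (i1 y By).1).
have [b1 b3] := fubini_on mA mB mi (dom _ mi (fun p => normr_Im_le (f p)))
  (fun x Ax => (i2 x Ax).2) (fun y By => (i1 y By).2).
split; first by split.
by rewrite /Cint/= a3 b3.
Qed.

End CFubini.

(** * The Gamma function on the right half-plane *)

Section CGamma.
Context {R : realType}.
Notation mu := (@lebesgue_measure R).
Notation Re := complex.Re.
Notation Im := complex.Im.
Notation normc := ComplexField.Normc.normc.
Notation H := (`]0%R, +oo[%classic : set R).
Implicit Types (x y a b : R) (z w : R[i]).

Lemma cGamma_ReP z : 0 < Re z -> cGamma z = cGamma_integral z.
Proof.
by move=> z0; rewrite /cGamma /cGamma_shift z0/= big_ord0 addr0 divr1.
Qed.

Lemma measurable_halfline : measurable (H : set (measurableTypeR R)).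
Proof. exact: measurable_itv. Qed.

Lemma halflineP (x : R) : H x -> 0 < x.
Proof. by rewrite /= in_itv/= andbT. Qed.

Lemma cGamma_integralE z :
  cGamma_integral z = Cint mu H (fun x => cpow x (z - 1) * (expR (- x))%:C).
Proof. by []. Qed.

Lemma Cint_powsubst0y (c b : R) (f : R -> R[i]) : 0 < c -> 0 < b ->
  {in `]0, +oo[, continuous (fun x => Re (f x))} ->
  {in `]0, +oo[, continuous (fun x => Im (f x))} ->
  Cint mu H f = Cint mu H (fun x => (c * (b * x `^ (b - 1)))%:C * f (c * x `^ b)).
Proof.
move=> c0 b0 cr ci; rewrite /Cint /Rintegral; congr (fine _ +i* fine _).
- rewrite (integral_powsubst0y c0 b0 cr); apply: eq_integral => x _.
  by rewrite ReZ mulrC.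
- rewrite (integral_powsubst0y c0 b0 ci); apply: eq_integral => x _.
  by rewrite ImZ mulrC.
Qed.

Lemma integrable_Gamma_scaled (a c : R) : 0 < a -> 0 < c ->
  mu.-integrable H (fun x => (x `^ (a - 1) * expR (- (c * x)))%:E).
Proof.
move=> a0 c0.
have cG : {in `]0, +oo[, continuous (fun x : R => x `^ (a - 1) * expR (- x))}.
  move=> x; rewrite in_itv/= andbT => x0.
  apply: cvgM; first exact: continuous_powR.
  apply: (@continuous_comp _ _ _ (fun x : R => - x) expR); first by apply: cvgN; exact: cvg_id.
  exact: continuous_expR.
have := integrableZl measurable_halfline (c `^ (- a))
  (integrable_powsubst0y c0 ltr01 cG (integrable_Gamma a0)).
apply: eq_integrable => // x.
rewrite inE => /halflineP x0.
rewrite -EFinM; congr (_ %:E); rewrite powRr1 ?(ltW x0)// subrr powRr0 !mulr1.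
rewrite powRM ?(ltW c0) ?(ltW x0)// powRN powRB ?(gt_eqF c0) ?implybT// powRr1 ?(ltW c0)//.
by field; rewrite !gt_eqF// powR_gt0.
Qed.

Lemma continuous_laplace_Re z (c : R) :
  {in `]0, +oo[, continuous (fun x => Re (cpow x z * (expR (- (c * x)))%:C))}.
Proof.
move=> x x0; rewrite (_ : (fun _ => _) = (fun x => Re (cpow x z) * expR (- (c * x)))); last first.
  by apply/funext => y; rewrite mulrC ReZ mulrC.
apply: cvgM; first exact: continuous_Re_cpow.
apply: (@continuous_comp _ _ _ (fun x : R => - (c * x)) expR); last exact: continuous_expR.
by apply: cvgN; apply: cvgM; [exact: cvg_cst|exact: cvg_id].
Qed.

Lemma continuous_laplace_Im z (c : R) :
  {in `]0, +oo[, continuous (fun x => Im (cpow x z * (expR (- (c * x)))%:C))}.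
Proof.
move=> x x0; rewrite (_ : (fun _ => _) = (fun x => Im (cpow x z) * expR (- (c * x)))); last first.
  by apply/funext => y; rewrite mulrC ImZ mulrC.
apply: cvgM; first exact: continuous_Im_cpow.
apply: (@continuous_comp _ _ _ (fun x : R => - (c * x)) expR); last exact: continuous_expR.
by apply: cvgN; apply: cvgM; [exact: cvg_cst|exact: cvg_id].
Qed.

Lemma Cintble_laplace z (c : R) : 0 < Re z -> 0 < c ->
  Cintble mu H (fun x => cpow x (z - 1) * (expR (- (c * x)))%:C).
Proof.
move=> z0 c0; apply: Cintble_le (integrable_Gamma_scaled z0 c0) _ => //.
- apply: open_continuous_measurable_fun => // x; rewrite inE; exact: continuous_laplace_Re.
- apply: open_continuous_measurable_fun => // x; rewrite inE; exact: continuous_laplace_Im.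
move=> x /halflineP x0.
rewrite ComplexField.Normc.normcM normc_cpow// normc_real ger0_norm ?expR_ge0//.
by rewrite (_ : Re (z - 1) = Re z - 1)//; case: (z).
Qed.

Lemma Cintble_Gamma z : 0 < Re z ->
  Cintble mu H (fun x => cpow x (z - 1) * (expR (- x))%:C).
Proof.
move=> z0; apply: eq_Cintble (Cintble_laplace z0 ltr01) => //.
by move=> x _; rewrite mul1r.
Qed.

Lemma real_complex_neq0 (r : R) : (r%:C != 0 :> R[i]) = (r != 0).
Proof. by rewrite eq_complex/= eqxx andbT. Qed.

Lemma cpow1 (c : R) : 0 < c -> cpow c 1 = c%:C.
Proof. by move=> c0; rewrite -(rmorph1 (real_complex R)) cpow_real// powRr1// ltW. Qed.

Lemma cpowS (c : R) z : 0 < c -> cpow c z = c%:C * cpow c (z - 1).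
Proof. by move=> c0; rewrite -cpow1// -cpowD addrC subrK. Qed.

Lemma Cint_laplace z (c : R) : 0 < Re z -> 0 < c ->
  Cint mu H (fun x => cpow x (z - 1) * (expR (- (c * x)))%:C) = cpow c (- z) * cGamma_integral z.
Proof.
move=> z0 c0; rewrite cGamma_integralE.
under [in RHS]eq_Cint do rewrite -[X in expR (- X)]mul1r.
rewrite [in RHS](Cint_powsubst0y c0 ltr01 (@continuous_laplace_Re _ _) (@continuous_laplace_Im _ _)).
rewrite -CintZ//; last first.
  have := @CintbleZ _ (measurableTypeR R) R lebesgue_measure H _ (cpow c z) measurable_halfline (Cintble_laplace z0 c0).
  apply: eq_Cintble => //.
  move=> x /halflineP x0; rewrite !mul1r powRr1 ?(ltW x0)// subrr powRr0 !mulr1.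
  by rewrite cpowM// (cpowS z c0) !mulrA.
apply: eq_Cint => x /halflineP x0.
rewrite !mul1r powRr1 ?(ltW x0)// subrr powRr0 !mulr1 cpowM//.
have e : cpow c (- z) * (c%:C * cpow c (z - 1)) = 1.
  by rewrite -cpowS// cpowN mulVf// cpow_neq0.
transitivity (cpow c (- z) * (c%:C * cpow c (z - 1)) * (cpow x (z - 1) * (expR (- (c * x)))%:C)).
  by rewrite e mul1r.
by rewrite -!mulrA; reflexivity.
Qed.

Lemma Re_realC (r : R) : Re r%:C = r. Proof. by []. Qed.

Lemma cGamma_integral_real a : cGamma_integral (a%:C : R[i]) = (Gamma a)%:C.
Proof.
have h x : H x -> cpow x (a%:C - 1) * (expR (- x))%:C = (x `^ (a - 1) * expR (- x))%:C.
  by move=> /halflineP x0; rewrite -(rmorph1 (real_complex R)) -rmorphB cpow_real// -rmorphM.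
transitivity (Cint mu H (fun x => (x `^ (a - 1) * expR (- x))%:C)).
  exact: eq_Cint.
by congr (_ +i* _); rewrite /Rintegral integral0.
Qed.

(** If the integral vanished, the positive integrand would be 0 almost everywhere on a set of
    infinite measure. *)
Lemma Gamma_gt0 a : 0 < a -> 0 < Gamma a.
Proof.
move=> a0; have ig := integrable_Gamma a0.
rewrite /Gamma /Rintegral -lte_fin fineK; last exact: integrable_fin_num.
rewrite lt_neqAle integral_ge0 ?andbT//; last first.
  by move=> x; rewrite lee_fin mulr_ge0 ?powR_ge0 ?expR_ge0.
apply/negP => /eqP/esym h.
have : ae_eq mu H (fun x => (x `^ (a - 1) * expR (- x))%:E) (cst 0%E).
  apply/(ae_eq_integral_abs mu measurable_halfline (measurable_int _ ig)).
  rewrite -[RHS]h; apply: eq_integral => x _.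
  by rewrite /= ger0_norm// mulr_ge0 ?powR_ge0 ?expR_ge0.
move=> [N [mN N0 hN]].
have : (mu H <= mu N)%E.
  apply: le_measure; rewrite ?inE//.
  apply: subset_trans hN => x /= Hx; move=> /(_ Hx)/=; rewrite in_itv/= andbT in Hx.
  by move=> [] /eqP; rewrite gt_eqF// mulr_gt0 ?powR_gt0 ?expR_gt0.
by rewrite N0 lebesgue_measure_itv/= ltry.
Qed.

Lemma is_derive_eqE (f g : R -> R) (x : R) l l' : is_derive x 1 f l -> f = g -> l = l' -> is_derive x 1 g l'.
Proof. by move=> h <- <-. Qed.

Lemma is_derive_cpow w x : 0 < x ->
  is_derive x 1 (fun x => Re (cpow x w)) (Re (w * cpow x (w - 1))) /\
  is_derive x 1 (fun x => Im (cpow x w)) (Im (w * cpow x (w - 1))).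
Proof.
move=> x0; case: w => a b.
have dl (c : R) : is_derive x 1 (fun x : R => c * ln x) (c / x).
  by apply: is_derive_eqE (is_deriveZ c (is_derive1_ln x0)) _ _.
have de : is_derive x 1 (expR \o (fun x : R => a * ln x)) (expR (a * ln x) * (a / x)).
  exact: is_derive1_comp.
have dc : is_derive x 1 (cos \o (fun x : R => b * ln x)) (- sin (b * ln x) * (b / x)).
  exact: is_derive1_comp.
have ds : is_derive x 1 (sin \o (fun x : R => b * ln x)) (cos (b * ln x) * (b / x)).
  exact: is_derive1_comp.
have px : expR (a * ln x) = x `^ (a - 1) * x.
  by rewrite -{3}(powRr1 (ltW x0)) -powRD ?(gt_eqF x0) ?implybT// subrK /powR gt_eqF.
rewrite cplx_ReM cplx_ImM Re_cpow// Im_cpow//=; split.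
- apply: (is_derive_eqE (is_deriveM de dc)).
    by apply/funext => y; rewrite /cpow/cexp; simpc => /=; rewrite ?mulr0 ?mul0r ?subr0 ?add0r.
  rewrite /= /GRing.scale/= px subr0; field; exact: lt0r_neq0.
- apply: (is_derive_eqE (is_deriveM de ds)).
    by apply/funext => y; rewrite /cpow/cexp; simpc => /=; rewrite ?mulr0 ?mul0r ?subr0 ?add0r.
  rewrite /= /GRing.scale/= px subr0; field; exact: lt0r_neq0.
Qed.

Lemma Rintegral_laplace a (c : R) : 0 < a -> 0 < c ->
  \int[mu]_(x in H) (x `^ (a - 1) * expR (- (c * x))) = c `^ (- a) * Gamma a.
Proof.
move=> a0 c0; have := @Cint_laplace a%:C c a0 c0.
have -> : - a%:C = (- a)%:C :> R[i] by rewrite rmorphN.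
rewrite cGamma_integral_real cpow_real// -rmorphM => /(congr1 (@complex.Re R)) h.
rewrite -[RHS]Re_realC -h -[RHS]/(\int[mu]_(x in H) Re (cpow x (a%:C - 1) * (expR (- (c * x)))%:C)).
apply: eq_Rintegral => x; rewrite inE => /halflineP x0.
have -> : a%:C - 1 = (a - 1)%:C :> R[i] by rewrite rmorphB rmorph1.
by rewrite cpow_real// -rmorphM.
Qed.

Lemma cvg_expRN_at0 a (G : R -> R) : 0 < a -> (forall x, 0 < x -> `|G x| <= x `^ a) ->
  G x * expR (- x) @[x --> 0^'+] --> 0.
Proof.
move=> a0 Ga; apply/norm_cvg0P; apply: (squeeze_cvgr _ (cvg_cst (0 : R)) (powR_cvg0 a0)).
near=> x; have x0 : 0 < x by near: x; exact: nbhs_right_gt.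
rewrite normr_ge0/= normrM (le_trans _ (Ga _ x0))// ler_piMr//.
by rewrite ger0_norm ?expR_ge0// expR_le1 oppr_le0 ltW.
Unshelve. all: by end_near. Qed.

Lemma cvg_expRN_aty a (G : R -> R) : 0 < a -> (forall x, 0 < x -> `|G x| <= x `^ a) ->
  G x * expR (- x) @[x --> +oo] --> 0.
Proof.
move=> a0 Ga; apply/norm_cvg0P.
have a1 : 1 <= a + 1 by rewrite lerDr ltW.
have h : ((a + 1) `^ (a + 1)) * x^-1 @[x --> +oo] --> (0 : R).
  rewrite -(mulr0 ((a + 1) `^ (a + 1))); apply: cvgM; first exact: cvg_cst.
  by apply/gtr0_cvgV0; [near=> x|exact: cvg_id].
apply: (squeeze_cvgr _ (cvg_cst (0 : R)) h).
near=> x; have x0 : 0 < x by [].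
rewrite normr_ge0/= normrM [X in _ * X]ger0_norm ?expR_ge0// expRN ler_pdivrMr ?expR_gt0//.
apply: le_trans (Ga _ x0) _.
rewrite mulrAC ler_pdivlMr//; apply: le_trans (powR1D_le_expR (ltW x0) a1).
rewrite -{2}(powRr1 (ltW x0)) -powRD; last by rewrite (gt_eqF x0) implybT.
by apply: ge0_ler_powR; rewrite ?nnegrE; lra.
Unshelve. all: by end_near. Qed.

(** Integration by parts: the derivative of x^z e^(-x) integrates to 0, because its modulus x^(Re z)
    e^(-x) vanishes at both ends. [key] does this for a real-valued F, to be the real and then the
    imaginary part of x^z. *)
Lemma cGamma_integralS z : 0 < Re z -> cGamma_integral (z + 1) = z * cGamma_integral z.
Proof.
move=> z0; have z1 : 0 < Re (z + 1) by case: (z) z0 => u v /= u0; lra.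
have i0 := Cintble_Gamma z0; have i1 := Cintble_Gamma z1.
have i2 := @CintbleZ _ (measurableTypeR R) R lebesgue_measure H _ z measurable_halfline i0.
have dexp x : is_derive x 1 (expR \o (-%R : R -> R)) (expR (- x) * (-1)).
  apply: is_derive1_comp.
have Ere x : Re (z * (cpow x (z - 1) * (expR (- x))%:C)) = Re (z * cpow x (z - 1)) * expR (- x).
  by rewrite mulrA mulrC ReZ mulrC.
have Eim x : Im (z * (cpow x (z - 1) * (expR (- x))%:C)) = Im (z * cpow x (z - 1)) * expR (- x).
  by rewrite mulrA mulrC ImZ mulrC.
have Er1 x : Re (cpow x (z + 1 - 1) * (expR (- x))%:C) = Re (cpow x z) * expR (- x).
  by rewrite addrK mulrC ReZ mulrC.
have Ei1 x : Im (cpow x (z + 1 - 1) * (expR (- x))%:C) = Im (cpow x z) * expR (- x).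
  by rewrite addrK mulrC ImZ mulrC.
have cexp (x : R) : {for x, continuous (fun x : R => expR (- x))}.
  apply: (@continuous_comp _ _ _ (fun x : R => - x) expR); first by apply: cvgN; exact: cvg_id.
  exact: continuous_expR.
have cre x : 0 < x -> {for x, continuous (fun x => Re (z * cpow x (z - 1)))}.
  move=> x0; have xi : x \in `]0, +oo[ by rewrite in_itv/= andbT.
  rewrite (_ : (fun _ => _) = (fun x => Re z * Re (cpow x (z - 1)) - Im z * Im (cpow x (z - 1)))).
    apply: cvgB; (apply: cvgM; first exact: cvg_cst).
      exact: continuous_Re_cpow. exact: continuous_Im_cpow.
  by apply/funext => y; rewrite cplx_ReM.
have cim x : 0 < x -> {for x, continuous (fun x => Im (z * cpow x (z - 1)))}.
  move=> x0; have xi : x \in `]0, +oo[ by rewrite in_itv/= andbT.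
  rewrite (_ : (fun _ => _) = (fun x => Re z * Im (cpow x (z - 1)) + Im z * Re (cpow x (z - 1)))).
    apply: cvgD; (apply: cvgM; first exact: cvg_cst).
      exact: continuous_Im_cpow. exact: continuous_Re_cpow.
  by apply/funext => y; rewrite cplx_ImM.
have key (F f : R -> R) : (forall x, 0 < x -> is_derive x 1 F (f x)) ->
    (forall x, 0 < x -> {for x, continuous f}) -> (forall x, 0 < x -> `|F x| <= x `^ (Re z)) ->
    mu.-integrable H (EFin \o (fun x => f x * expR (- x))) ->
    mu.-integrable H (EFin \o (fun x => F x * expR (- x))) ->
    \int[mu]_(x in H) (f x * expR (- x)) = \int[mu]_(x in H) (F x * expR (- x)).
  move=> dF cf bF If IF; apply/eqP; rewrite -subr_eq0 -RintegralB//; apply/eqP.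
  rewrite -[RHS](subr0 0).
  apply: (@Rintegral_FTC0y _ _ (fun x => F x * expR (- x))).
  - move=> x x0; apply: (is_derive_eqE (is_deriveM (dF _ x0) (dexp x))) => //.
    by rewrite /= /GRing.scale/=; ring.
  - move=> x; rewrite in_itv/= andbT => x0; apply: cvgB; apply: cvgM => //; try exact: cexp.
      exact: cf.
    apply: differentiable_continuous; apply/derivable1_diffP.
    by case: (dF x x0).
  - have := integrableB measurable_halfline If IF; apply: eq_integrable => // x _.
  - exact: cvg_expRN_at0 z0 bF.
  - exact: cvg_expRN_aty z0 bF.
rewrite !cGamma_integralE -(@CintZ _ (measurableTypeR R) R lebesgue_measure H _ z measurable_halfline i0).
rewrite /Cint; congr (_ +i* _).
- under eq_Rintegral do rewrite Er1; under [RHS]eq_Rintegral do rewrite Ere.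
  symmetry; apply: key.
  + by move=> x x0; exact: (is_derive_cpow z x0).1.
  + exact: cre.
  + by move=> x x0; rewrite -normc_cpow// normr_Re_le.
  + by move: i2.1; apply: eq_integrable => // x _; exact: (congr1 EFin (Ere x)).
  + by move: i1.1; apply: eq_integrable => // x _; exact: (congr1 EFin (Er1 x)).
- under eq_Rintegral do rewrite Ei1; under [RHS]eq_Rintegral do rewrite Eim.
  symmetry; apply: key.
  + by move=> x x0; exact: (is_derive_cpow z x0).2.
  + exact: cim.
  + by move=> x x0; rewrite -normc_cpow// normr_Im_le.
  + by move: i2.2; apply: eq_integrable => // x _; exact: (congr1 EFin (Eim x)).
  + by move: i1.2; apply: eq_integrable => // x _; exact: (congr1 EFin (Ei1 x)).
Qed.

Lemma GammaS a : 0 < a -> Gamma (a + 1) = a * Gamma a.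
Proof.
move=> a0; have := @cGamma_integralS a%:C a0.
rewrite -(rmorph1 (real_complex R)) -rmorphD !cGamma_integral_real -rmorphM.
by move/(congr1 (@complex.Re R)).
Qed.

End CGamma.

(** * Absence of zeros of Gamma in the right half-plane *)

Section GammaNonzero.
Context {R : realType}.
Notation mu := (@lebesgue_measure R).
Notation Re := complex.Re.
Notation Im := complex.Im.
Notation normc := ComplexField.Normc.normc.
Notation H := (`]0%R, +oo[%classic : set R).
Implicit Types (x y a b : R) (z w : R[i]).

Lemma sin_le_normr y : `|sin y| <= `|y|.
Proof.
wlog y0 : y / 0 <= y.
  move=> h; have [/h//|/ltW y0] := leP 0 y.
  by rewrite -normrN -sinN -[leRHS]normrN h// oppr_ge0.
have [c _ hc] := @MVT_segment R sin cos 0 y y0 (fun x _ => is_derive_sin x)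
  (continuous_subspaceT (@continuous_sin R)).
move: hc; rewrite sin0 !subr0 => ->; rewrite normrM ler_piMl// cos_max//.
Qed.

Lemma cos_ge_1Bsqr y : 1 - y ^+ 2 <= cos y.
Proof.
have -> : cos y = 1 - 2 * sin (y / 2) ^+ 2.
  have {1}-> : y = (y / 2) *+ 2 by rewrite mulr2n; field.
  by rewrite cos_mulr2n cos2sin2 mulr2n; ring.
have h : sin (y / 2) ^+ 2 <= (y / 2) ^+ 2.
  by rewrite -[leLHS]real_normK ?num_real// -[leRHS]real_normK ?num_real// lerXn2r ?nnegrE// sin_le_normr.
nra.
Qed.

(** With s = (ln x) / 2 the right-hand side is 4 (e^s - e^(-s))^2, and |s| <= |e^s - e^(-s)|. A
    bound linear in x and 1/x is wanted because its integral against x^(s-1) e^(-x) is a combination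
    of Gamma values at integer shifts. *)
Lemma sqr_ln_le x : 0 < x -> ln x ^+ 2 <= 4 * (x - 2 + x^-1).
Proof.
move=> x0.
have key (s : R) : 0 <= s -> s <= expR s - expR (- s).
  move=> s0; have h1 := expR_ge1Dx s.
  have h2 : expR (- s) <= (1 + s)^-1 by rewrite expRN lef_pV2 ?posrE ?expR_gt0//; lra.
  have h3 : (1 + s)^-1 <= 1 by rewrite invf_le1; lra.
  lra.
set s := ln x / 2.
have ex : x = expR s ^+ 2.
  by rewrite -expRM_natl mulrC divfK// lnK// posrE.
have exV : x^-1 = expR (- s) ^+ 2 by rewrite {1}ex -exprVn expRN.
have -> : ln x = s * 2 by rewrite divfK.
have e1 : expR s * expR (- s) = 1 by rewrite expRxMexpNx_1.
have h : s ^+ 2 <= (expR s - expR (- s)) ^+ 2.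
  have [s0|/ltW s0] := leP 0 s.
    by rewrite lerXn2r ?nnegrE ?key// (le_trans s0)// key.
  rewrite -sqrrN -[leRHS]sqrrN lerXn2r ?nnegrE ?oppr_ge0//.
    by have := key (- s); rewrite opprK oppr_ge0; lra.
  by have := key (- s); rewrite opprK oppr_ge0; lra.
rewrite exV {1}ex; nra.
Qed.

(* For s large against v^2 the mass x^(s-1) e^(-x) concentrates near x = s, so
   that the real part of s^(-iv) Gamma(s + iv) is positive; the bound uses
   cos y >= 1 - y^2 and a rational upper bound of ln^2. *)
Lemma cGamma_integral_neq0_large (s v : R) : 1 + 4 * v ^+ 2 < s ->
  cGamma_integral (s +i* v) != 0.
Proof.
move=> sv; have s1 : 1 < s by rewrite (le_lt_trans _ sv)// lerDl mulr_ge0// sqr_ge0.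
have s0 : 0 < s by lra.
have s10 : 0 < s - 1 by lra.
apply/eqP => h0.
have iG := @Cintble_Gamma R (s +i* v) s0.
have h1 : Cint lebesgue_measure H (fun x => cpow x (s +i* v - 1) * (expR (- x))%:C) = 0 := h0.
pose f x := cpow s (0 -i* v) * (cpow x (s +i* v - 1) * (expR (- x))%:C).
have h2 : Cint lebesgue_measure H f = 0.
  have h3 := @CintZ _ (measurableTypeR R) R lebesgue_measure H _ (cpow s (0 -i* v)) measurable_halfline iG.
  have := etrans h3 (congr1 (fun t => cpow s (0 -i* v) * t) h1).
  by rewrite mulr0.
have iZ : Cintble lebesgue_measure H f :=
  @CintbleZ _ (measurableTypeR R) R lebesgue_measure H _ (cpow s (0 -i* v)) measurable_halfline iG.
have hint : \int[mu]_(x in H) Re (f x) = 0 := congr1 (@complex.Re R) h2.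
have fE x : 0 < x -> Re (f x) = x `^ (s - 1) * expR (- x) * cos (v * (ln x - ln s)).
  move=> x0; rewrite /f mulrA mulrC ReZ cplx_ReM !Re_cpow// !Im_cpow//=.
  rewrite powRr0 !mul1r mulNr cosN sinN subr0.
  by rewrite [v * (ln x - ln s)]mulrBr cosB; ring.
pose k a x := x `^ (a - 1) * expR (- x).
have ik a : 0 < a -> mu.-integrable H (EFin \o k a) by exact: integrable_Gamma.
have ikc a c : 0 < a -> mu.-integrable H (EFin \o (fun x => c * k a x)).
  by move=> a0; have := integrableZl measurable_halfline c (ik _ a0).
(* The integral of g is Gamma(s - 1) (s - 1 - 4 v^2), which is the origin of the threshold 1 + 4
   v^2. *)
pose g x := (1 + 8 * v ^+ 2) * k s x - (4 * v ^+ 2 / s * k (s + 1) x + 4 * v ^+ 2 * s * k (s - 1) x).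
have s20 : 0 < s + 1 by lra.
have ig2 : mu.-integrable H (EFin \o (fun x => 4 * v ^+ 2 / s * k (s + 1) x + 4 * v ^+ 2 * s * k (s - 1) x)).
  by have := integrableD measurable_halfline (ikc _ (4 * v ^+ 2 / s) s20) (ikc _ (4 * v ^+ 2 * s) s10).
have ig : mu.-integrable H (EFin \o g).
  by have := integrableB measurable_halfline (ikc _ (1 + 8 * v ^+ 2) s0) ig2.
have gf x : H x -> g x <= Re (f x).
  move=> /halflineP x0; rewrite fE//.
  have xs0 : 0 < x / s by rewrite divr_gt0.
  have := cos_ge_1Bsqr (v * (ln x - ln s)).
  have := sqr_ln_le xs0; rewrite ln_div ?posrE// => hl1 hl2.
  have k0 : 0 <= k s x by rewrite mulr_ge0 ?powR_ge0 ?expR_ge0.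
  have e1 : k (s + 1) x = x * k s x.
    rewrite /k mulrA addrK; congr (_ * _).
    by rewrite -mulr_powRB1// ltW.
  have e2 : k (s - 1) x = x^-1 * k s x.
    rewrite /k mulrA; congr (_ * _).
    by rewrite -powR_inv1 ?(ltW x0)// -powRD ?(gt_eqF x0) ?implybT//; congr powR; ring.
  rewrite /g e1 e2 -/(k s x).
  apply: (@le_trans _ _ (k s x * (1 - v ^+ 2 * (4 * (x / s - 2 + (x / s)^-1))))).
    by rewrite invf_div le_eqVlt; apply/orP; left; apply/eqP; field; rewrite !gt_eqF.
  rewrite ler_wpM2l//; apply: le_trans hl2; rewrite lerD2l lerN2 exprMn.
  by apply: ler_wpM2l => //; exact: sqr_ge0.
have := le_Rintegral measurable_halfline ig iZ.1 gf; rewrite hint.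
rewrite RintegralB//; last exact: ikc.
rewrite RintegralD//; try exact: ikc.
rewrite !RintegralZl//; try exact: ik.
rewrite -[\int[mu]_(x in H) k s x]/(Gamma s) -[\int[mu]_(x in H) k (s + 1) x]/(Gamma (s + 1))
  -[\int[mu]_(x in H) k (s - 1) x]/(Gamma (s - 1)).
have G0 := Gamma_gt0 s10.
have GE : Gamma s = (s - 1) * Gamma (s - 1) by have := GammaS s10; rewrite subrK.
rewrite (GammaS s0) GE.
have -> : 4 * v ^+ 2 / s * (s * ((s - 1) * Gamma (s - 1))) = 4 * v ^+ 2 * (s - 1) * Gamma (s - 1).
  by field; rewrite gt_eqF.
apply/negP; rewrite -ltNge.
rewrite (_ : _ - _ = Gamma (s - 1) * (s - 1 - 4 * v ^+ 2)); last by ring.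
by rewrite mulr_gt0// !subr_gt0 ltrBrDl.
Qed.

(** The functional equation propagates a zero from z to all z + n. The imaginary part stays fixed
    while the real part grows, so [cGamma_integral_neq0_large] eventually applies. *)
Lemma cGamma_integral_neq0 z : 0 < Re z -> cGamma_integral z != 0.
Proof.
move=> z0; apply/eqP => h0.
have key n : 0 < Re (z + n%:R) /\ cGamma_integral (z + n%:R) = 0.
  elim: n => [|n [IH1 IH2]]; first by rewrite addr0.
  rewrite -natr1 addrA; split; last by rewrite cGamma_integralS// IH2 mulr0.
  by move: IH1; case: (z + n%:R) => u v /= ; lra.
have [n hn] : exists n : nat, 1 + 4 * Im z ^+ 2 < n%:R.
  by exists (Num.truncn (1 + 4 * Im z ^+ 2)).+1; exact: truncnS_gt.
have [_] := key n; apply/eqP.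
have -> : z + n%:R = (Re z + n%:R) +i* Im z.
  by rewrite -(rmorph_nat (real_complex R)); case: (z) => a b; simpc.
by apply: cGamma_integral_neq0_large; rewrite (lt_trans hn)// ltrDr.
Qed.

End GammaNonzero.

(** * The Mellin transform of a Laplace transform *)

Section MellinLaplace.
Context d (T : measurableType d) (R : realType).
Variable P : {sigma_finite_measure set T -> \bar R}.
Notation mu := (@lebesgue_measure R).
Notation Re := complex.Re.
Notation Im := complex.Im.
Notation normc := ComplexField.Normc.normc.
Notation H := (`]0%R, +oo[%classic : set R).
Variables (A : set T) (mA : measurable A) (V : T -> R).
Hypotheses (mV : measurable_fun setT V) (V0 : forall w, A w -> 0 < V w).

Lemma measurable_prod_expRM : measurable_fun setT (fun p : measurableTypeR R * T => expR (- (p.1 * V p.2))).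
Proof.
apply: measurableT_comp => //; apply: measurableT_comp => //; apply: measurable_funM => //.
by apply: (measurableT_comp mV); exact: measurable_snd.
Qed.

Lemma integral_laplace_pow (a c : R) : 0 < a -> 0 < c ->
  (\int[mu]_(x in H) (x `^ (a - 1) * expR (- (x * c)))%:E = (c `^ (- a) * Gamma a)%:E)%E.
Proof.
move=> a0 c0; rewrite -Rintegral_laplace//.
under eq_integral do rewrite [_ * c]mulrC.
rewrite /Rintegral fineK//; apply: integrable_fin_num => //.
exact: integrable_Gamma_scaled.
Qed.

(** Tonelli and Euler's integral in r. The identity holds in [0, +oo], so finiteness of one side can
    be read off from the other. *)
Lemma ge0_mellin_laplace (k : T -> R) (a : R) : measurable_fun setT k ->
  (forall w, A w -> 0 <= k w) -> 0 < a ->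
  (\int[mu]_(r in H) \int[P]_(w in A) (r `^ (a - 1) * (k w * expR (- (r * V w))))%:E =
   \int[P]_(w in A) (k w * (V w `^ (- a) * Gamma a))%:E)%E.
Proof.
move=> mk k0 a0.
rewrite (@tonelli_on _ _ (measurableTypeR R) T R lebesgue_measure P H A measurable_halfline mA
  (fun p => p.1 `^ (a - 1) * (k p.2 * expR (- (p.1 * V p.2))))); last 2 first.
- apply: measurable_funM.
    by apply: (measurableT_comp (measurable_powR _)); exact: measurable_fst.
  apply: measurable_funM; first by apply: (measurableT_comp mk); exact: measurable_snd.
  exact: measurable_prod_expRM.
- by move=> x y _ Ay; rewrite mulr_ge0 ?powR_ge0// mulr_ge0 ?expR_ge0// k0.
apply: eq_integral => w /[!inE] Aw.
under eq_integral do rewrite /= mulrCA EFinM.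
rewrite ge0_integralZl//=.
- by rewrite integral_laplace_pow// V0.
- apply/measurable_EFinP/measurable_funTS; apply: measurable_funM => //.
  by apply: measurableT_comp => //; apply: measurableT_comp => //; apply: measurable_funM.
- by move=> x _; rewrite lee_fin mulr_ge0 ?powR_ge0 ?expR_ge0.
- by rewrite lee_fin k0.
Qed.

(** The complex version by Fubini; the domination is [ge0_mellin_laplace] applied to the modulus of
    k. It serves twice: for Lebesgue measure with V the identity (the Beta integral) and for P with
    V the increment of D. *)
Lemma mellin_laplace (k : T -> R[i]) (q : R[i]) :
  measurable_fun setT (fun w => Re (k w)) -> measurable_fun setT (fun w => Im (k w)) ->
  0 < Re q ->
  P.-integrable A (fun w => (normc (k w) * V w `^ (- Re q))%:E) ->
  (forall r : R, 0 < r -> P.-integrable A (fun w => (normc (k w) * expR (- (r * V w)))%:E)) ->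
  Cintble mu H (fun r => cpow r (q - 1) * Cint P A (fun w => k w * (expR (- (r * V w)))%:C)) /\
  Cint mu H (fun r => cpow r (q - 1) * Cint P A (fun w => k w * (expR (- (r * V w)))%:C)) =
  cGamma_integral q * Cint P A (fun w => k w * cpow (V w) (- q)).
Proof.
move=> mr mi q0 iV ir.
have mn : measurable_fun setT (fun w => normc (k w)).
  rewrite (_ : (fun _ => _) = (fun p => Num.sqrt (Re (k p) ^+ 2 + Im (k p) ^+ 2))).
    apply: (measurableT_comp (continuous_measurable_fun (@sqrt_continuous R))).
    by apply: measurable_funD; apply: measurable_funX.
  by apply/funext => p; rewrite normc_sqrt.
pose f (p : measurableTypeR R * T) := cpow p.1 (q - 1) * (k p.2 * (expR (- (p.1 * V p.2)))%:C).
have mkE : measurable_fun setT (fun p : measurableTypeR R * T => Re (k p.2)).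
  by apply: (measurableT_comp mr); exact: measurable_snd.
have mkI : measurable_fun setT (fun p : measurableTypeR R * T => Im (k p.2)).
  by apply: (measurableT_comp mi); exact: measurable_snd.
have mcE : measurable_fun setT (fun p : measurableTypeR R * T => Re (cpow p.1 (q - 1))).
  by apply: (measurableT_comp (measurable_Re_cpow _)); exact: measurable_fst.
have mcI : measurable_fun setT (fun p : measurableTypeR R * T => Im (cpow p.1 (q - 1))).
  by apply: (measurableT_comp (measurable_Im_cpow _)); exact: measurable_fst.
have fE p : f p = (expR (- (p.1 * V p.2)))%:C * (cpow p.1 (q - 1) * k p.2).
  by rewrite /f mulrA mulrC.
have mfr : measurable_fun setT (fun p => Re (f p)).
  under eq_fun do rewrite fE ReZ cplx_ReM.
  apply: measurable_funM; first exact: measurable_prod_expRM.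
  by apply: measurable_funB; apply: measurable_funM.
have mfi : measurable_fun setT (fun p => Im (f p)).
  under eq_fun do rewrite fE ImZ cplx_ImM.
  apply: measurable_funM; first exact: measurable_prod_expRM.
  by apply: measurable_funD; apply: measurable_funM.
have nf r w : 0 < r -> normc (f (r, w)) = r `^ (Re q - 1) * (normc (k w) * expR (- (r * V w))).
  move=> r0; rewrite /f ComplexField.Normc.normcM normc_cpow//= ComplexField.Normc.normcM normc_real ger0_norm ?expR_ge0//.
  by congr (_ `^ _ * _); case: (q).
have CA r : H r -> Cintble P A (fun w => k w * (expR (- (r * V w)))%:C).
  move=> /halflineP r0.
  have mE : measurable_fun setT (fun w => expR (- (r * V w))).
    by apply: measurableT_comp => //; apply: measurableT_comp => //; apply: measurable_funM.
  apply: (Cintble_le mA _ _ (ir _ r0)).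
  - under eq_fun do rewrite mulrC ReZ; apply: measurable_funTS; exact: measurable_funM.
  - under eq_fun do rewrite mulrC ImZ; apply: measurable_funTS; exact: measurable_funM.
  - by move=> w Aw; rewrite ComplexField.Normc.normcM normc_real ger0_norm ?expR_ge0.
have CH w : A w -> Cintble lebesgue_measure H (fun r => f (r, w)).
  move=> Aw; have := CintbleZ (k w) measurable_halfline (Cintble_laplace q0 (V0 Aw)).
  by apply: eq_Cintble => // r _; rewrite /f/= mulrCA [V w * r]mulrC.
have [||i1 e1] := @cfubini_on _ _ (measurableTypeR R) T R lebesgue_measure P H A measurable_halfline mA f mfr mfi _ _ CH.
- under eq_integral => r /[!inE] /halflineP r0.
    under eq_integral do rewrite nf//; over.
  rewrite (ge0_mellin_laplace mn _ q0); last by move=> w _; exact: normc_ge0.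
  under eq_integral do rewrite mulrA EFinM.
  have := integrableZr mA (Gamma (Re q)) iV => /integrable_lty; exact.
- by move=> r Hr; exact: (CintbleZ (cpow r (q - 1)) mA (CA _ Hr)).
have eL r : H r -> Cint P A (fun w => f (r, w)) =
    cpow r (q - 1) * Cint P A (fun w => k w * (expR (- (r * V w)))%:C).
  by move=> Hr; rewrite -(CintZ _ mA (CA _ Hr)).
split; first by move: i1; apply: eq_Cintble.
transitivity (Cint lebesgue_measure H (fun r => Cint P A (fun w => f (r, w)))).
  by apply: eq_Cint => r Hr; rewrite eL.
transitivity (Cint P A (fun w => Cint lebesgue_measure H (fun r => f (r, w)))); first exact: e1.
have iVc : Cintble P A (fun w => k w * cpow (V w) (- q)).
  apply: (Cintble_le mA _ _ iV).
  - under eq_fun do rewrite cplx_ReM; apply: measurable_funTS; apply: measurable_funB; apply: measurable_funM => //.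
      exact: (measurableT_comp (measurable_Re_cpow _)).
    exact: (measurableT_comp (measurable_Im_cpow _)).
  - under eq_fun do rewrite cplx_ImM; apply: measurable_funTS; apply: measurable_funD; apply: measurable_funM => //.
      exact: (measurableT_comp (measurable_Im_cpow _)).
    exact: (measurableT_comp (measurable_Re_cpow _)).
  - move=> w Aw; rewrite ComplexField.Normc.normcM normc_cpow ?V0//.
    by rewrite (_ : Re (- q) = - Re q)//; case: (q).
rewrite -(CintZ _ mA iVc); apply: eq_Cint => w Aw.
have := CintZ (k w) measurable_halfline (Cintble_laplace q0 (V0 Aw)).
rewrite (Cint_laplace q0 (V0 Aw)) => h.
transitivity (k w * (cpow (V w) (- q) * cGamma_integral q)); last by rewrite mulrA mulrC.
by rewrite -h; apply: eq_Cint => r _; rewrite /f/= mulrCA [V w * r]mulrC.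
Qed.

End MellinLaplace.

(** * The Beta integral *)

Section Beta.
Context {R : realType}.
Notation mu := (@lebesgue_measure R).
Notation Re := complex.Re.
Notation Im := complex.Im.
Notation normc := ComplexField.Normc.normc.
Notation H := (`]0%R, +oo[%classic : set R).
Implicit Types (z : R[i]) (a dl : R).

Lemma Re_addr z a : Re (z + a%:C) = Re z + a.
Proof. by case: z. Qed.

(** Take k(x) = x^(z+dl-1) e^(-x) in [mellin_laplace]: its Laplace transform at r is (1 +
    r)^(-(z+dl)) Gamma(z + dl), and k(x) x^(-dl) is the integrand of Gamma(z). *)
Lemma cGamma_beta z dl : 0 < Re z -> 0 < dl ->
  let f (r : R) := cpow r (dl%:C - 1) * (cpow (1 + r) (- (z + dl%:C)) * cGamma_integral (z + dl%:C)) in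
  Cintble mu H f /\ Cint mu H f = cGamma_integral dl%:C * cGamma_integral z.
Proof.
move=> z0 d0 f.
have zd0 : 0 < Re (z + dl%:C) by rewrite Re_addr addr_gt0.
pose k (x : measurableTypeR R) := cpow x (z + dl%:C - 1) * (expR (- x))%:C.
have kE x : k x = (expR (- x))%:C * cpow x (z + dl%:C - 1) by rewrite mulrC.
have nk x : 0 < x -> normc (k x) = x `^ (Re z + dl - 1) * expR (- x).
  move=> x0; rewrite /k ComplexField.Normc.normcM normc_cpow// normc_real ger0_norm ?expR_ge0//.
  by congr (_ `^ _ * _); case: (z).
have mE : measurable_fun setT (fun x : measurableTypeR R => expR (- x)).
  by apply: measurableT_comp => //; apply: measurableT_comp.
have [|||||||i e] := @mellin_laplace _ (measurableTypeR R) R lebesgue_measure H measurable_halfline id _ _ k dl%:C.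
- exact: measurable_id.
- by move=> w /halflineP.
- under eq_fun do rewrite kE ReZ; apply: measurable_funM => //; exact: measurable_Re_cpow.
- under eq_fun do rewrite kE ImZ; apply: measurable_funM => //; exact: measurable_Im_cpow.
- by [].
- have := integrable_Gamma z0; apply: eq_integrable => // x /[!inE] /halflineP x0.
  rewrite nk//= mulrAC -powRD; last by rewrite (gt_eqF x0) implybT.
  by congr (_ `^ _ * _)%:E; ring.
- move=> r r0; have := integrable_Gamma_scaled zd0 (addr_gt0 ltr01 r0).
  apply: eq_integrable => // x /[!inE] /halflineP x0.
  by rewrite nk// -mulrA -expRD Re_addr; congr (_ * expR _)%:E; ring.
have eL (r : R) : H r -> cpow r (dl%:C - 1) * Cint lebesgue_measure H (fun x : measurableTypeR R => k x * (expR (- (r * x)))%:C) = f r.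
  move=> /halflineP r0; rewrite /f; congr (_ * _).
  apply: (etrans _ (Cint_laplace zd0 (addr_gt0 ltr01 r0))); apply: eq_Cint => x _.
  rewrite /k -mulrA -rmorphM -expRD; congr (_ * (expR _)%:C); ring.
split; first by move: i; apply: eq_Cintble.
transitivity (Cint lebesgue_measure H (fun r => cpow r (dl%:C - 1) * Cint lebesgue_measure H (fun x : measurableTypeR R => k x * (expR (- (r * x)))%:C))).
  by apply: eq_Cint => r Hr; rewrite eL.
rewrite e; congr (_ * _); rewrite cGamma_integralE; apply: eq_Cint => x _.
rewrite kE -mulrA -cpowD mulrC; congr (cpow _ _ * _); ring.
Qed.

Lemma integrable_beta a dl : 0 < a -> 0 < dl ->
  mu.-integrable H (fun r : R => (r `^ (dl - 1) * (1 + r) `^ (- (a + dl)))%:E).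
Proof.
move=> a0 d0; have ad0 : 0 < a + dl by rewrite addr_gt0.
have [[i _] _] := @cGamma_beta a%:C dl a0 d0.
have := integrableZl measurable_halfline (Gamma (a + dl))^-1 i; apply: eq_integrable => // r /[!inE] /halflineP r0.
have -> : a%:C + dl%:C = (a + dl)%:C :> R[i] by rewrite rmorphD.
have -> : dl%:C - 1 = (dl - 1)%:C :> R[i] by rewrite rmorphB rmorph1.
have -> : - (a + dl)%:C = (- (a + dl))%:C :> R[i] by rewrite rmorphN.
rewrite /comp cGamma_integral_real !cpow_real ?addr_gt0// !ReZ Re_realC -EFinM; congr EFin.
by field; rewrite gt_eqF// Gamma_gt0.
Qed.

(* Gamma(z) Gamma(dl) = Gamma(z + dl) B(z, dl), with B bounded on vertical lines. *)
Lemma cGamma_le_shift a dl : 0 < a -> 0 < dl -> exists2 C, 0 <= C &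
  forall z, Re z = a -> normc (cGamma_integral z) <= C * normc (cGamma_integral (z + dl%:C)).
Proof.
move=> a0 d0; pose g (r : R) := r `^ (dl - 1) * (1 + r) `^ (- (a + dl)).
have ig : mu.-integrable H (EFin \o g) by exact: integrable_beta.
exists (2 * (\int[mu]_(r in H) g r) / Gamma dl).
  rewrite divr_ge0 ?(ltW (Gamma_gt0 d0))// mulr_ge0// Rintegral_ge0// => r _.
  by rewrite mulr_ge0 ?powR_ge0.
move=> z za; have z0 : 0 < Re z by rewrite za.
have [i e] := @cGamma_beta z dl z0 d0.
set N := normc (cGamma_integral (z + dl%:C)).
have igN : mu.-integrable H (EFin \o (fun r => g r * N)).
  by have := integrableZr measurable_halfline N ig.
have := normc_Cint_le measurable_halfline i igN; rewrite e ComplexField.Normc.normcM cGamma_integral_real normc_real.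
rewrite ger0_norm ?(ltW (Gamma_gt0 d0))// RintegralZr// => h.
rewrite mulrAC ler_pdivlMr ?Gamma_gt0// mulrC -mulrA; apply: h => r /halflineP r0.
rewrite ComplexField.Normc.normcM normc_cpow// ComplexField.Normc.normcM normc_cpow ?addr_gt0//.
rewrite mulrA -/N; apply: ler_wpM2r; first exact: normc_ge0.
rewrite /g le_eqVlt; apply/orP; left; apply/eqP; congr (_ `^ _ * _ `^ _).
by move: za; case: (z) => u v /= ->.
Qed.

End Beta.

(** * The marginals of the stable subordinator *)

Section LevyExponent.
Context {R : realType}.
Notation mu := (@lebesgue_measure R).
Notation H := (`]0%R, +oo[%classic : set R).

(** Integration by parts: F vanishes at 0 and at +oo and has derivative k - beta h, so beta times
    the integral of h is the integral of k, which is s^beta Gamma(1 - beta). The normalisation of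
    the Lévy density cancels the Gamma factor. *)
Lemma integral_stable_levy_density (beta s : R) : 0 < beta -> beta < 1 -> 0 < s ->
  (\int[mu]_(x in H) ((1 - expR (- (s * x))) * stable_levy_density beta x)%:E = (s `^ beta)%:E)%E.
Proof.
move=> b0 b1 s0.
have b1' : 0 < 1 - beta by rewrite subr_gt0.
have G0 := Gamma_gt0 b1'.
pose h x := (1 - expR (- (s * x))) * x `^ (- (1 + beta)).
pose k x := s * (x `^ ((1 - beta) - 1) * expR (- (s * x))).
pose F x := (1 - expR (- (s * x))) * x `^ (- beta).
have e1 x : 0 < x -> 1 - expR (- (s * x)) <= s * x.
  by move=> x0; have := expR_ge1Dx (- (s * x)); lra.
have e2 x : 0 < x -> 0 <= 1 - expR (- (s * x)).
  by move=> x0; rewrite subr_ge0 expR_le1 oppr_le0 mulr_ge0// ltW.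
have cE (x : R) : {for x, continuous (fun x : R => expR (- (s * x)))}.
  apply: (@continuous_comp _ _ _ (fun x : R => - (s * x)) expR); last exact: continuous_expR.
  by apply: cvgN; apply: cvgM; [exact: cvg_cst|exact: cvg_id].
have ch : {in `]0, +oo[, continuous h}.
  move=> x; rewrite in_itv/= andbT => x0; apply: cvgM; last exact: continuous_powR.
  by apply: cvgB; [exact: cvg_cst|exact: cE].
have ck : {in `]0, +oo[, continuous k}.
  move=> x; rewrite in_itv/= andbT => x0; apply: cvgM; first exact: cvg_cst.
  by apply: cvgM; [exact: continuous_powR|exact: cE].
have ik : mu.-integrable H (EFin \o k).
  by have := integrableZl measurable_halfline s (integrable_Gamma_scaled b1' s0).
(* The bounds 1 - e^(-sx) <= 1 and 1 - e^(-sx) <= s x combine into (1 + s) x / (1 + x), which makes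
   h comparable to the Beta integrand with parameters beta and 1 - beta. *)
have ih : mu.-integrable H (EFin \o h).
  apply: (le_integrable _ _ _ (integrableZl measurable_halfline (1 + s) (integrable_beta b0 b1'))) => //.
    by apply/measurable_EFinP; apply: open_continuous_measurable_fun => // x; rewrite inE => /ch.
  move=> x /halflineP x0; rewrite /= lee_fin; apply: le_trans (ler_norm _).
  rewrite ger0_norm ?mulr_ge0 ?powR_ge0 ?e2//.
  rewrite [beta + _]addrC subrK powRN powRr1 ?addr_ge0 ?(ltW x0)//.
  rewrite /h (_ : 1 - beta - 1 = 1 - (1 + beta)); last by ring.
  rewrite [in leRHS]powRD; last by rewrite (gt_eqF x0) implybT.
  rewrite powRr1 ?(ltW x0)// (_ : (1 + s) * (x * _ / _) = (1 + s) * x / (1 + x) * x `^ (- (1 + beta))); last by ring.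
  rewrite ler_wpM2r ?powR_ge0//.
  rewrite ler_pdivlMr ?addr_gt0//.
  have := e1 _ x0; have := e2 _ x0; have := expR_ge0 (- (s * x)); nra.
have dF (x : R) : 0 < x -> is_derive x 1 F (k x - beta * h x).
  move=> x0.
  have d1 : is_derive x 1 (expR \o (fun x : R => - (s * x))) (expR (- (s * x)) * - (s * 1)).
    apply: is_derive1_comp; apply: is_deriveN.
  have d2 : is_derive x 1 (cst 1 - (expR \o (fun x : R => - (s * x)))) (0 - (expR (- (s * x)) * - (s * 1))).
    exact: is_deriveB.
  apply: (is_derive_eqE (is_deriveM d2 (is_derive_powR (- beta) x0))) => //.
  rewrite /k /h /= /GRing.scale/=.
  rewrite (_ : 1 - beta - 1 = - beta); last by ring.
  rewrite (_ : - beta - 1 = - (1 + beta)); last by ring.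
  by rewrite -[(cst 1 - _) x]/(1 - expR (- (s * x))); ring.
have F0 : F x @[x --> 0^'+] --> 0.
  have hs : s * x `^ (1 - beta) @[x --> 0^'+] --> s * 0.
    by apply: cvgM; [exact: cvg_cst|exact: (powR_cvg0 b1')].
  rewrite mulr0 in hs; apply: (squeeze_cvgr _ (cvg_cst (0 : R)) hs).
  near=> x; have x0 : 0 < x by near: x; exact: nbhs_right_gt.
  rewrite /F mulr_ge0 ?powR_ge0 ?e2//=.
  rewrite [in leRHS]powRD; last by rewrite (gt_eqF x0) implybT.
  by rewrite powRr1 ?(ltW x0)// mulrA ler_wpM2r ?powR_ge0 ?e1.
have F1 : F x @[x --> +oo] --> 0.
  apply: (squeeze_cvgr _ (cvg_cst (0 : R))); last first.
    have : x `^ beta @[x --> +oo] --> +oo.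
      apply/cvgryPge => M; near=> x.
      have hx : (Num.max M 1) `^ beta^-1 <= x by near: x; exact: nbhs_pinfty_ge.
      have m1 : 1 <= Num.max M 1 by rewrite le_max lexx orbT.
      apply: (@le_trans _ _ (Num.max M 1)); first by rewrite le_max lexx.
      have -> : Num.max M 1 = ((Num.max M 1) `^ beta^-1) `^ beta.
        by rewrite -powRrM mulVf ?gt_eqF// powRr1// (le_trans ler01).
      by apply: ge0_ler_powR; rewrite ?nnegrE ?powR_ge0 ?(ltW b0)// (le_trans _ hx) ?powR_ge0.
    move=> /gtr0_cvgV0; apply.
    by near=> x; rewrite powR_gt0//; near: x; exact: nbhs_pinfty_gt.
  near=> x; have x0 : 0 < x by near: x; exact: nbhs_pinfty_gt.
  rewrite /F mulr_ge0 ?powR_ge0 ?e2//= powRN ler_piMl ?invr_ge0 ?powR_ge0//.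
have ibh : mu.-integrable H (EFin \o (fun x => beta * h x)).
  by have := integrableZl measurable_halfline beta ih.
have := @Rintegral_FTC0y R _ F 0 0 dF _ _ F0 F1.
rewrite RintegralB// RintegralZl// subrr => hh.
have eh : beta * \int[mu]_(x in H) h x = Gamma (1 - beta) * s `^ beta.
  rewrite /k RintegralZl// in hh; last exact: integrable_Gamma_scaled.
  rewrite Rintegral_laplace// in hh.
  apply/eqP; rewrite eq_sym -subr_eq0; apply/eqP; rewrite -[RHS]hh; last 2 first.
  - move=> x x0; apply: cvgB; first exact: ck.
    by apply: cvgM; [exact: cvg_cst|exact: ch].
  - by have := integrableB measurable_halfline ik ibh.
  have es : s `^ beta = s * s `^ (- (1 - beta)).
    rewrite -{2}(powRr1 (ltW s0)) -powRD; last by rewrite (gt_eqF s0) implybT.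
    by congr powR; ring.
  by congr (_ - _); rewrite es; ring.
transitivity (\int[mu]_(x in H) ((beta / Gamma (1 - beta))%:E * (h x)%:E))%E.
  apply: eq_integral => x _; rewrite -EFinM; congr EFin.
  by rewrite /stable_levy_density /h powRN invfM; ring.
rewrite integralZl// -[X in (_ * X)%E]fineK; last exact: integrable_fin_num.
rewrite -EFinM; congr EFin.
apply: (mulfI (lt0r_neq0 G0)); rewrite -eh /Rintegral; field.
exact: lt0r_neq0.
Unshelve. all: by end_near. Qed.

End LevyExponent.

(** * Laplace transforms determine tail probabilities *)

Section LaplaceUnique.
Context d (T : measurableType d) (R : realType) (P : probability T R).
Variables (X Y : T -> R).
Hypotheses (mX : measurable_fun setT X) (mY : measurable_fun setT Y)
  (X0 : forall w, 0 <= X w) (Y0 : forall w, 0 <= Y w).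
Hypothesis XY : forall s : R, 0 < s ->
  \int[P]_w expR (- (s * X w)) = \int[P]_w expR (- (s * Y w)).

Lemma bounded_integrable (f : T -> R) M : measurable_fun setT f -> (forall w, `|f w| <= M) ->
  P.-integrable setT (EFin \o f).
Proof.
move=> mf fM; apply: (@le_integrable _ _ _ P setT measurableT _ (EFin \o cst M)).
- exact/measurable_EFinP.
- by move=> w _; rewrite /= lee_fin (le_trans (fM w))// ler_norm.
- exact: finite_measure_integrable_cst.
Qed.

(* Kuhn's functions: polynomials in expR (- (s * x)), hence with integrals
   determined by the Laplace transform, and converging to step functions. *)
Definition kuhn (s : R) (N k : nat) (x : R) := (1 - expR (- (s * x))) ^+ N * expR (- (s * x)) ^+ k.

Lemma kuhn_itv s N k x : 0 < s -> 0 <= x -> 0 <= kuhn s N k x <= 1.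
Proof.
move=> s0 x0.
have e0 := expR_ge0 (- (s * x)).
have e1 : expR (- (s * x)) <= 1 by rewrite expR_le1 oppr_le0 mulr_ge0// ltW.
rewrite /kuhn mulr_ge0 ?exprn_ge0 ?subr_ge0//=.
by rewrite mulr_ile1 ?exprn_ge0 ?exprn_ile1 ?subr_ge0// lerBlDr lerDl.
Qed.

Lemma measurable_kuhn s N k (Z : T -> R) : measurable_fun setT Z -> measurable_fun setT (fun w => kuhn s N k (Z w)).
Proof.
move=> mZ.
have mE : measurable_fun setT (fun w => expR (- (s * Z w))).
  by apply: measurableT_comp => //; apply: measurableT_comp => //; apply: measurable_funM.
apply: measurable_funM; apply: measurable_funX => //.
exact: measurable_funB.
Qed.

Lemma integrable_kuhn s N k (Z : T -> R) : 0 < s -> measurable_fun setT Z -> (forall w, 0 <= Z w) ->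
  P.-integrable setT (EFin \o (fun w => kuhn s N k (Z w))).
Proof.
move=> s0 mZ Z0; apply: (@bounded_integrable _ 1); first exact: measurable_kuhn.
by move=> w; have /andP[h1 h2] := kuhn_itv N k s0 (Z0 w); rewrite ger0_norm.
Qed.

(** Induction on N through (1 - u)^(N+1) u^k = (1 - u)^N u^k - (1 - u)^N u^(k+1); for N = 0 the
    integral is the Laplace transform at k s, or that of the constant 1 when k = 0. *)
Lemma integral_kuhn_eq s N k : 0 < s ->
  \int[P]_w kuhn s N k (X w) = \int[P]_w kuhn s N k (Y w).
Proof.
move=> s0; elim: N k => [|N IH] k.
  have [->|k0] := posnP k.
    by apply: eq_Rintegral => w _; rewrite /kuhn !expr0.
  have e (Z : T -> R) : \int[P]_w kuhn s 0 k (Z w) = \int[P]_w expR (- (k%:R * s * Z w)).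
    apply: eq_Rintegral => w _; rewrite /kuhn expr0 mul1r -expRM_natl.
    by congr expR; ring.
  by rewrite !e XY// mulr_gt0// ltr0n.
have e (Z : T -> R) : measurable_fun setT Z -> (forall w, 0 <= Z w) ->
    \int[P]_w kuhn s N.+1 k (Z w) = \int[P]_w kuhn s N k (Z w) - \int[P]_w kuhn s N k.+1 (Z w).
  move=> mZ Z0; rewrite -RintegralB//; try exact: integrable_kuhn.
  by apply: eq_Rintegral => w _; rewrite /kuhn !exprS; ring.
by rewrite (e _ mX X0) (e _ mY Y0) !IH.
Qed.

Lemma eq_fine (a b : \bar R) : a \is a fin_num -> b \is a fin_num -> fine a = fine b -> a = b.
Proof. by case: a b => [a| |] [b| |] //= _ _ ->. Qed.

Lemma eintegral_kuhn_eq s N k : 0 < s ->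
  (\int[P]_w (kuhn s N k (X w))%:E = \int[P]_w (kuhn s N k (Y w))%:E)%E.
Proof.
move=> s0; have := integral_kuhn_eq N k s0; rewrite /Rintegral.
have iX := integrable_fin_num measurableT (integrable_kuhn N k s0 mX X0).
have iY := integrable_fin_num measurableT (integrable_kuhn N k s0 mY Y0).
move=> h; apply: eq_fine; [exact: iX|exact: iY|exact: h].
Qed.

Lemma bernoulli_ge (x : R) n : 0 <= x -> 1 + n%:R * x <= (1 + x) ^+ n.
Proof.
move=> x0; elim: n => [|n IH]; first by rewrite mul0r addr0 expr0.
rewrite exprS -natr1; have : 0 <= n%:R :> R by [].
have : 0 <= n%:R * x ^+ 2 by rewrite mulr_ge0// sqr_ge0.
nra.
Qed.

Lemma bernoulli_le (x : R) n : 0 <= x <= 1 -> 1 - n%:R * x <= (1 - x) ^+ n.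
Proof.
move=> /andP[x0 x1]; elim: n => [|n IH]; first by rewrite mul0r subr0 expr0.
rewrite exprS -natr1; have : 0 <= n%:R * x ^+ 2 by rewrite mulr_ge0// sqr_ge0.
have : (1 - x) * (1 - n%:R * x) <= (1 - x) * (1 - x) ^+ n by rewrite ler_wpM2l// subr_ge0.
nra.
Qed.

(** With r the square root of q, n q^n is (n r^n) r^n, where n r^n stays bounded by Bernoulli's
    inequality for 1/r. *)
Lemma cvg_natr_expr (q : R) : 0 <= q -> q < 1 -> n%:R * q ^+ n @[n --> \oo] --> (0 : R).
Proof.
move=> q0 q1; have [->|q0'] := eqVneq q 0.
  apply: cvg_near_cst; near=> n.
  by rewrite expr0n gtn_eqF ?mulr0//; near: n; exact: nbhs_infty_gt.
have {q0 q0'}q0 : 0 < q by rewrite lt_neqAle eq_sym q0' q0.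
pose r := Num.sqrt q.
have r0 : 0 < r by rewrite sqrtr_gt0.
have r1 : r < 1 by rewrite -sqrtr1 ltr_sqrt.
have rq : q = r ^+ 2 by rewrite sqr_sqrtr// ltW.
have V1 : 0 < r^-1 - 1 by rewrite subr_gt0 invf_gt1.
have h n : n%:R * r ^+ n <= (r^-1 - 1)^-1.
  have := @bernoulli_ge (r^-1 - 1) n (ltW V1); rewrite [1 + (_ - 1)]addrC subrK exprVn => hb.
  have rn : 0 < r ^+ n by rewrite exprn_gt0.
  rewrite -[leRHS]mul1r ler_pdivlMr// mulrAC -ler_pdivlMr// div1r; lra.
apply: (squeeze_cvgr _ (cvg_cst (0 : R))); last first.
  rewrite -(mulr0 (r^-1 - 1)^-1); apply: cvgM; first exact: cvg_cst.
  by apply: (@cvg_expr R r); rewrite ger0_norm// ltW.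
near=> n; rewrite mulr_ge0 ?exprn_ge0 ?(ltW q0)//= rq -exprM mulnC exprM expr2 mulrA.
by rewrite ler_wpM2r// exprn_ge0// ltW.
Unshelve. all: by end_near. Qed.

(* (1 - u^n)^(n 2^n) tends to 1 if u < 1/2 and to 0 if u >= 1/2 *)
Lemma cvg_kuhn (t x : R) : 0 < t -> 0 <= x ->
  kuhn (n%:R * (ln 2 / t)) (n * 2 ^ n) 0 x @[n --> \oo] --> ((t < x)%R%:R : R).
Proof.
move=> t0 x0; set s := ln 2 / t.
have l2 : 0 < ln 2 :> R by rewrite ln_gt0// ltr1n.
have s0 : 0 < s by rewrite divr_gt0.
set u := expR (- (s * x)).
have u0 : 0 < u by exact: expR_gt0.
have u1 : u <= 1 by rewrite expR_le1 oppr_le0 mulr_ge0// ltW.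
have kE n : kuhn (n%:R * s) (n * 2 ^ n) 0 x = (1 - u ^+ n) ^+ (n * 2 ^ n).
  by rewrite /kuhn expr0 mulr1 /u -expRM_natl; congr ((1 - expR _) ^+ _); ring.
have un n : 0 <= u ^+ n <= 1 by rewrite exprn_ge0 ?(ltW u0)//= exprn_ile1// ltW.
under eq_fun do rewrite kE.
(* The scale ln 2 / t makes u = 2^(-x/t), so that the threshold 1/2 for u is the threshold t for
   x. *)
have uE : (u < 2^-1) = (t < x).
  rewrite -[X in u < X](@lnK R) ?posrE// ltr_expR lnV ?posrE// ltrN2.
  by rewrite /s mulrAC ltr_pdivlMr// ltr_pM2l.
have [tx|xt] := ltP t x.
  (* Bernoulli gives the lower bound 1 - n (2 u)^n, and 2 u < 1. *)
  have uh : u < 2^-1 by rewrite uE.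
  apply: (squeeze_cvgr _ _ (cvg_cst (1 : R))); last first.
    have := @cvg_natr_expr (2 * u); rewrite mulr_ge0 ?(ltW u0)// => /(_ isT).
    move=> /(_ _)/(cvgB (cvg_cst (1 : R))); rewrite subr0; apply; lra.
  near=> n; apply/andP; split; last by case/andP: (un n) => ? ?; rewrite exprn_ile1 ?subr_ge0// lerBlDr lerDl.
  apply: le_trans (bernoulli_le (n * 2 ^ n) (un n)).
  by rewrite -[leLHS]/(1 - n%:R * (2 * u) ^+ n) natrM natrX exprMn !mulrA.
have uh : 2^-1 <= u by rewrite leNgt uE -leNgt.
apply: (squeeze_cvgr _ (cvg_cst (0 : R)) (@cvg_harmonic R)).
near=> n; case/andP: (un n) => un0 un1.
rewrite exprn_ge0 ?subr_ge0//=.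
(* As 2 u >= 1, Bernoulli gives (1 + u^n)^(n 2^n) >= 1 + n (2 u)^n >= n + 1, and (1 - v)(1 + v) <= 1
   turns this into an upper bound for the power of 1 - u^n. *)
have h1 : n.+1%:R <= (1 + u ^+ n) ^+ (n * 2 ^ n).
  apply: le_trans (bernoulli_ge (n * 2 ^ n) un0).
  rewrite -natr1 addrC lerD2l natrM natrX -mulrA ler_peMr//.
  rewrite -exprMn exprn_ege1//; lra.
have h0 : 0 < (1 + u ^+ n) ^+ (n * 2 ^ n) by rewrite exprn_gt0//; lra.
apply: (@le_trans _ _ ((1 + u ^+ n) ^+ (n * 2 ^ n))^-1); last by rewrite lef_pV2 ?posrE.
rewrite -[leRHS]mul1r ler_pdivlMr// -exprMn.
rewrite exprn_ile1//; nra.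
Unshelve. all: by end_near. Qed.

(** The sequence starts at n + 1 because the domination by 1 from [kuhn_itv] asks for a positive
    scale. *)
Lemma cvg_integral_kuhn (Z : T -> R) (t : R) : measurable_fun setT Z -> (forall w, 0 <= Z w) -> 0 < t ->
  (\int[P]_w (kuhn (n.+1%:R * (ln 2 / t)) (n.+1 * 2 ^ n.+1) 0 (Z w))%:E)%E @[n --> \oo] --> P [set w | t < Z w].
Proof.
move=> mZ Z0 t0.
have s0 : 0 < ln 2 / t by rewrite divr_gt0// ln_gt0// ltr1n.
have mA : measurable [set w | t < Z w].
  by have := mZ measurableT _ (measurable_itv `]t, +oo[); rewrite setTI; congr measurable;
     apply/seteqP; split=> w /=; rewrite in_itv/= andbT.
have -> : P [set w | t < Z w] = (\int[P]_w ((t < Z w)%R%:R)%:E)%E.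
  rewrite -(setIT [set w | t < Z w]) -integral_indic//.
  by apply: eq_integral => w _; rewrite indicE; congr (_%:R%:E); rewrite mem_setE.
apply: (and3_rec (fun _ _ h => h) (@dominated_convergence _ _ _ P setT measurableT _ _ (EFin \o cst 1) _ _ _ _ _)).
- by move=> n; apply/measurable_EFinP; exact: measurable_kuhn.
- apply/measurable_EFinP; rewrite (_ : (fun _ => _) = \1_[set w | t < Z w]); first exact: measurable_indic.
  by apply/funext => w; rewrite indicE mem_setE.
- apply: aeW => w _; apply: cvg_EFin; first by near=> n.
  by have := @cvg_kuhn t (Z w) t0 (Z0 w); rewrite -cvg_shiftS.
- exact: finite_measure_integrable_cst.
- apply: aeW => w n _.
  have /andP[h1 h2] := kuhn_itv (n.+1 * 2 ^ n.+1) 0 (mulr_gt0 (ltr0Sn R n) s0) (Z0 w).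
  by rewrite /= ger0_norm.
Unshelve. all: by end_near. Qed.

Lemma laplace_unique (t : R) : 0 < t -> P [set w | t < X w] = P [set w | t < Y w].
Proof.
move=> t0.
have s0 : 0 < ln 2 / t by rewrite divr_gt0// ln_gt0// ltr1n.
apply: (cvg_unique _ (cvg_integral_kuhn mX X0 t0)) => //.
have := cvg_integral_kuhn mY Y0 t0; apply: cvg_trans; apply: near_eq_cvg; near=> n.
by rewrite -(eintegral_kuhn_eq _ _ (mulr_gt0 (ltr0Sn R n) s0)).
Unshelve. all: by end_near. Qed.

End LaplaceUnique.

(** * Self-similarity, positivity and the differentiated Laplace transform *)

Section StableMarginals.
Context {d : measure_display} {T : measurableType d} {R : realType}.
Variables (P : probability T R) (beta : R) (D : R -> {RV P >-> R}).
Hypotheses (b0 : 0 < beta) (b1 : beta < 1) (hD : stable_subordinator beta D).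
Notation mu := (@lebesgue_measure R).
Notation H := (`]0%R, +oo[%classic : set R).
Notation Re := complex.Re.
Notation Im := complex.Im.
Notation normc := ComplexField.Normc.normc.

(** [D 0] is zero only almost surely; by monotone paths the increment is non-negative at every w,
    and it has the same law as [D t]. *)
Definition incr0 (t : R) (w : T) : R := D t w - D 0 w.

Lemma measurable_incr0 t : measurable_fun setT (incr0 t).
Proof. by apply: measurable_funB; exact: measurable_funP. Qed.

Lemma incr0_ge0 t w : 0 <= t -> 0 <= incr0 t w.
Proof. by move=> t0; case: hD => _ h _; rewrite subr_ge0 h. Qed.

Lemma incr0_ae t : {ae P, forall w, incr0 t w = D t w}.
Proof.
by case: hD => -[h _ _ _] _ _; apply: filterS h => w h; rewrite /incr0 h subr0.
Qed.

Lemma laplace_incr0 s t : 0 < s -> 0 <= t ->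
  \int[P]_w expR (- (s * incr0 t w)) = expR (- (t * s `^ beta)).
Proof.
move=> s0 t0; case: hD => _ _ /(_ s t s0 t0).
rewrite integral_stable_levy_density// mul0r add0e -EFinM -EFinN /= => h.
rewrite unlock in h.
rewrite /Rintegral -[RHS]/(fine (expR (- (t * s `^ beta)))%:E) -h; congr fine.
apply: ae_eq_integral => //.
- apply/measurable_EFinP; apply: measurableT_comp => //; apply: measurableT_comp => //.
  by apply: measurable_funM => //; exact: measurable_incr0.
- by apply/measurable_EFinP; apply: measurableT_comp => //; apply: measurableT_comp => //; apply: measurable_funM.
- by apply: filterS (incr0_ae t) => w -> _.
Qed.

Lemma measurable_gt (Z : T -> R) (t : R) : measurable_fun setT Z -> measurable [set w | t < Z w].
Proof.
move=> mZ; have := mZ measurableT _ (measurable_itv `]t, +oo[); rewrite setTI; congr measurable.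
by apply/seteqP; split=> w /=; rewrite in_itv/= andbT.
Qed.

Lemma prob_gt_incr0 (t s : R) : P [set w | t < D s w] = P [set w | t < incr0 s w].
Proof.
have h (Z : T -> R) : measurable_fun setT Z -> P [set w | t < Z w] = (\int[P]_w (\1_[set w | t < Z w] w)%:E)%E.
  by move=> mZ; rewrite integral_indic// ?setIT//; exact: measurable_gt.
rewrite (h _ (measurable_incr0 s)) h//; apply: ae_eq_integral => //.
- by apply/measurable_EFinP; apply: measurable_indic; exact: measurable_gt.
- by apply/measurable_EFinP; apply: measurable_indic; apply: measurable_gt; exact: measurable_incr0.
- by apply: filterS (incr0_ae s) => w e _; rewrite !indicE; congr ((nat_of_bool _)%:R%:E); apply/idP/idP; rewrite !inE /= e.
Qed.

(** Both variables have the Laplace transform exp(-x s^beta). *)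
Lemma self_similar (x t : R) : 0 < x -> 0 < t ->
  P [set w | t < incr0 x w] = P [set w | t < x `^ beta^-1 * incr0 1 w].
Proof.
move=> x0 t0; have xb0 : 0 < x `^ beta^-1 by rewrite powR_gt0.
apply: (laplace_unique _ _ _ _ _ t0).
- exact: measurable_incr0.
- by apply: measurable_funM => //; exact: measurable_incr0.
- by move=> w; rewrite incr0_ge0// ltW.
- by move=> w; rewrite mulr_ge0 ?(ltW xb0)// incr0_ge0.
move=> s s0; rewrite laplace_incr0 ?(ltW x0)//.
under [RHS]eq_Rintegral do rewrite mulrA.
rewrite (laplace_incr0 (mulr_gt0 s0 xb0) ler01) mul1r (powRM beta (ltW s0) (ltW xb0)).
congr (expR (- _)); rewrite mulrC; congr (_ * _).
by rewrite -powRrM mulVf ?(gt_eqF b0)// (powRr1 (ltW x0)).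
Qed.

Definition incr_pos : set T := [set w | 0 < incr0 1 w].

Lemma measurable_incr_pos : measurable incr_pos.
Proof. exact/measurable_gt/measurable_incr0. Qed.

(** On the complement the increment is 0, so its probability is at most E exp(-s X) = exp(-s^beta)
    for every s > 0, which is arbitrarily small. *)
Lemma prob_incr_pos : P (~` incr_pos) = 0%E.
Proof.
have mC : measurable (~` incr_pos) by apply: measurableC; exact: measurable_incr_pos.
have h (s : R) : 0 < s -> (P (~` incr_pos) <= (expR (- s `^ beta))%:E)%E.
  move=> s0; have := laplace_incr0 s0 (@ler01 R); rewrite mul1r => <-.
  have mE : measurable_fun setT (fun w => expR (- (s * incr0 1 w))).
    apply: measurableT_comp => //; apply: measurableT_comp => //.
    by apply: measurable_funM => //; exact: measurable_incr0.
  have iE : P.-integrable setT (EFin \o (fun w => expR (- (s * incr0 1 w)))).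
    apply: (@bounded_integrable _ _ _ _ _ 1) => // w.
    by rewrite ger0_norm ?expR_ge0// expR_le1 oppr_le0 mulr_ge0 ?(ltW s0)// incr0_ge0.
  rewrite /Rintegral fineK; last exact: integrable_fin_num.
  rewrite -(setIT (~` incr_pos)) -integral_indic//.
  apply: ge0_le_integral => //.
  - by apply/measurable_EFinP; exact: measurable_indic.
  - exact/measurable_EFinP.
  - move=> w _; rewrite lee_fin indicE; case: (boolP (w \in _)) => [|_]; last by rewrite expR_ge0.
    rewrite inE /incr_pos/= => /negP; rewrite -leNgt => w0.
    have -> : incr0 1 w = 0 by apply/eqP; rewrite eq_le w0 incr0_ge0.
    by rewrite mulr0 oppr0 expR0.
apply/eqP; rewrite eq_le measure_ge0 andbT; apply/lee_addgt0Pr => e e0; rewrite add0e.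
(* Chosen so that s^beta >= - ln e; the maximum with 1 keeps s positive. *)
pose s := (Num.max 1 (- ln e)) `^ beta^-1.
have m1 : 1 <= Num.max 1 (- ln e) by rewrite le_max lexx.
have s0 : 0 < s by rewrite powR_gt0// (lt_le_trans ltr01).
apply: le_trans (h s s0) _; rewrite lee_fin /s -powRrM mulVf ?gt_eqF// powRr1 ?(le_trans ler01)//.
by rewrite -[leRHS](@lnK R) ?posrE// ler_expR lerNl le_max lexx orbT.
Qed.

(** Differentiate E exp(-s X) = exp(-s^beta) under the integral sign. For x between s/2 and 2 s the
    derivative is dominated by the constant 2/s, since X exp(-x X) <= 1/x. *)
Lemma laplace_deriv_incr0 (s : R) : 0 < s ->
  \int[P]_w (incr0 1 w * expR (- (s * incr0 1 w))) = beta * s `^ (beta - 1) * expR (- s `^ beta).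
Proof.
move=> s0; set X := incr0 1.
have X0 w : 0 <= X w by exact: incr0_ge0.
pose f (x : R) (w : T) := expR (- (x * X w)).
have df (x : R) w : is_derive x 1 (fun x => f x w) (- (X w * f x w)).
  have d1 : is_derive x 1 (fun x : R => - (x * X w)) (- X w).
    have -> : (fun x : R => - (x * X w)) = (fun x => - X w *: x) by apply/funext => y; rewrite /GRing.scale/=; ring.
    by apply: is_derive_eqE (is_deriveZ _ (is_derive_id _ _)) _ _ => //; rewrite /GRing.scale/= mulr1.
  by apply: is_derive_eqE (is_derive1_comp (is_derive_expR _) d1) _ _ => //; rewrite /f; ring.
have df1 x w : partial1of2 f x w = - (X w * f x w).
  by rewrite partial1of2E; case: (df x w).
have s2 : 0 < s / 2 by lra.
have mf x : measurable_fun setT (f x).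
  apply: measurableT_comp => //; apply: measurableT_comp => //; apply: measurable_funM => //; exact: measurable_incr0.
have xef x w : 0 < x -> X w * f x w <= x^-1.
  move=> x0; rewrite /f expRN ler_pdivrMr ?expR_gt0// -ler_pdivrMl ?invr_gt0// invrK.
  by apply: le_trans (expR_ge1Dx _); lra.
have dF : is_derive s 1 (fun x => \int[P]_w f x w) (- \int[P]_w (X w * f s w)).
  have Is : `](s / 2), (s * 2)[%classic s by rewrite /= in_itv/=; apply/andP; split; lra.
  have h1 x : `](s / 2), (s * 2)[%classic x -> P.-integrable setT (EFin \o f x).
    rewrite /= in_itv/= => /andP[x1 _]; apply: (@bounded_integrable _ _ _ _ _ 1) => // w.
    by rewrite ger0_norm ?expR_ge0// expR_le1 oppr_le0 mulr_ge0// ltW// (lt_trans s2).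
  have h2 x w : `](s / 2), (s * 2)[%classic x -> setT w -> derivable (f ^~ w) x 1.
    by move=> _ _; case: (df x w).
  have h3 : P.-integrable setT (EFin \o (fun _ : T => (s / 2)^-1)) by exact: finite_measure_integrable_cst.
  have h4 x w : `](s / 2), (s * 2)[%classic x -> setT w -> `|partial1of2 f x w| <= (s / 2)^-1.
    rewrite /= in_itv/= => /andP[x1 _] _; have x0 := lt_trans s2 x1.
    rewrite df1 normrN ger0_norm ?mulr_ge0 ?expR_ge0//; apply: le_trans (xef _ _ x0) _.
    by rewrite lef_pV2 ?posrE// ltW.
  have g0 (y : T) : 0 <= (s / 2)^-1 by rewrite invr_ge0 ltW.
  apply: DeriveDef.
    exact: (derivable_under_integral measurableT Is h1 h2 g0 h3 h4).
  rewrite -derive1E (differentiation_under_integral measurableT Is h1 h2 g0 h3 h4).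
  rewrite -[RHS]mulN1r -RintegralZl//.
    by apply: eq_Rintegral => w _; rewrite df1 mulN1r.
  apply: (@bounded_integrable _ _ _ _ _ s^-1) => [|w].
    by apply: measurable_funM => //; exact: measurable_incr0.
  by rewrite ger0_norm ?mulr_ge0 ?expR_ge0//; exact: xef.
have dG : is_derive s 1 (fun x => expR (- x `^ beta)) (expR (- s `^ beta) * - (beta * s `^ (beta - 1))).
  have d1 : is_derive s 1 (fun x : R => - x `^ beta) (- (beta * s `^ (beta - 1))).
    exact: (is_deriveN (is_derive_powR beta s0)).
  exact: (is_derive1_comp (is_derive_expR _) d1).
have : (fun x => \int[P]_w f x w)^`()%classic s = (fun x => expR (- x `^ beta))^`()%classic s.
  rewrite !derive1E; apply: near_eq_derive => //.
  near=> x; have x0 : 0 < x by near: x; exact: lt_nbhsr.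
  by rewrite /f laplace_incr0// mul1r.
rewrite !derive1E; case: dF => _ ->; case: dG => _ -> h.
by apply: oppr_inj; rewrite h; ring.
Unshelve. all: by end_near. Qed.

End StableMarginals.

(** * The Mellin transform of D(1) *)

Section MellinIdentity.
Context {d : measure_display} {T : measurableType d} {R : realType}.
Variables (P : probability T R) (beta : R) (D : R -> {RV P >-> R}).
Hypotheses (b0 : 0 < beta) (b1 : beta < 1) (hD : stable_subordinator beta D).
Notation mu := (@lebesgue_measure R).
Notation H := (`]0%R, +oo[%classic : set R).
Notation Re := complex.Re.
Notation Im := complex.Im.
Notation normc := ComplexField.Normc.normc.
Notation X := (incr0 D 1).
Notation A := (incr_pos D).

Lemma integral_incr_pos (f : T -> \bar R) : (forall w, X w = 0 -> f w = 0%E) ->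
  (\int[P]_(w in A) f w = \int[P]_w f w)%E.
Proof.
move=> f0; rewrite integral_mkcond; apply: eq_integral => w _.
rewrite patchE; case: ifPn => // /negP hw; rewrite f0//.
have := incr0_ge0 hD w (@ler01 R); rewrite le_eqVlt => /orP[/eqP <-//|h].
by exfalso; apply: hw; rewrite inE.
Qed.

Let mA : measurable A := measurable_incr_pos D.
Let mX : measurable_fun setT X := measurable_incr0 D 1.
Let X0 (w : T) : 0 <= X w := incr0_ge0 hD w (@ler01 R).

Lemma integrable_mul_laplace (r : R) : 0 < r ->
  P.-integrable setT (fun w => (X w * expR (- (r * X w)))%:E).
Proof.
move=> r0; apply: (@bounded_integrable _ _ _ _ _ r^-1) => [|w].
  apply: measurable_funM => //; apply: measurableT_comp => //; apply: measurableT_comp => //.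
  exact: measurable_funM.
rewrite ger0_norm ?mulr_ge0 ?expR_ge0//.
rewrite expRN ler_pdivrMr ?expR_gt0// -ler_pdivrMl ?invr_gt0// invrK.
by apply: le_trans (expR_ge1Dx _); rewrite lerDr.
Qed.

Lemma Rintegral_incr_pos_laplace (r : R) : 0 < r ->
  \int[P]_(w in A) (X w * expR (- (r * X w))) = beta * r `^ (beta - 1) * expR (- r `^ beta).
Proof.
move=> r0; rewrite -(laplace_deriv_incr0 b0 b1 hD r0) /Rintegral integral_incr_pos//.
by move=> w ->; rewrite mul0r.
Qed.

Lemma integral_incr_pos_laplace (r : R) : 0 < r ->
  (\int[P]_(w in A) (X w * expR (- (r * X w)))%:E)%E = (beta * r `^ (beta - 1) * expR (- r `^ beta))%:E.
Proof.
move=> r0; rewrite -Rintegral_incr_pos_laplace// /Rintegral fineK//.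
apply: integrable_fin_num => //.
exact: integrableS (integrable_mul_laplace r0).
Qed.

(** Tonelli first gives the moment identity in [0, +oo]; as Gamma(a) is finite and Gamma(q)
    positive, the moment cannot be infinite. All orders below beta are covered, positive ones
    included. *)
Lemma integrable_moment (a : R) : 0 < a ->
  P.-integrable A (fun w => (X w `^ (beta * (1 - a)))%:E).
Proof.
move=> a0; pose q := 1 - beta + beta * a.
have q0 : 0 < q by rewrite addr_gt0 ?subr_gt0// mulr_gt0.
have hk (w : T) : A w -> 0 <= X w by move=> _.
have := ge0_mellin_laplace P mA mX (fun w (Aw : A w) => Aw) mX hk q0.
have -> : (\int[mu]_(r in H) \int[P]_(w in A) (r `^ (q - 1) * (X w * expR (- (r * X w))))%:E = (Gamma a)%:E)%E.
  transitivity (\int[mu]_(r in H) (r `^ (q - 1) * (beta * r `^ (beta - 1) * expR (- r `^ beta)))%:E)%E.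
    apply: eq_integral => r /[!inE] /halflineP r0.
    under eq_integral do rewrite EFinM.
    rewrite integralZl//; last exact: integrableS (integrable_mul_laplace r0).
    by rewrite integral_incr_pos_laplace.
  have cG : {in `]0, +oo[, continuous (fun x : R => x `^ (a - 1) * expR (- x))}.
    move=> x; rewrite in_itv/= andbT => x0.
    apply: cvgM; first exact: continuous_powR.
    apply: (@continuous_comp _ _ _ (fun x : R => - x) expR); first by apply: cvgN; exact: cvg_id.
    exact: continuous_expR.
  rewrite /Gamma /Rintegral fineK; last by apply: integrable_fin_num => //; exact: integrable_Gamma.
  (* The substitution x = r^beta in Gamma(a): its Jacobian beta r^(beta-1) is the factor that
     differentiating the Laplace transform produced. *)
  rewrite (integral_powsubst0y ltr01 b0 cG); apply: eq_integral => r /[!inE] /halflineP r0.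
  rewrite !mul1r -powRrM (_ : beta * (a - 1) = q - 1); last by rewrite /q; ring.
  by congr EFin; ring.
move=> h; have G0 := Gamma_gt0 q0.
have mXp : measurable_fun A (fun w => X w `^ (beta * (1 - a))).
  by apply: measurable_funTS; exact: (measurableT_comp (measurable_powR _) mX).
apply/integrableP; split; first exact/measurable_EFinP.
under eq_integral do rewrite /= ger0_norm ?powR_ge0//.
have e : (\int[P]_(w in A) (X w * (X w `^ (- q) * Gamma q))%:E =
    (Gamma q)%:E * \int[P]_(w in A) (X w `^ (beta * (1 - a)))%:E)%E.
  rewrite -ge0_integralZl//=.
  - apply: eq_integral => w /[!inE] Aw; rewrite -EFinM mulrA mulrC; congr (_ * _)%:E.
    rewrite -{1}(powRr1 (X0 w)) -powRD; last by rewrite (gt_eqF Aw) implybT.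
    by congr powR; rewrite /q; ring.
  - exact/measurable_EFinP.
  - by move=> w _; rewrite lee_fin powR_ge0.
  - by rewrite lee_fin ltW.
rewrite e in h; rewrite ltey; apply/negP => /eqP hy; move: h.
by rewrite hy gt0_muley ?lte_fin.
Qed.

Lemma mellin_identity (s : R[i]) : 0 < Re s ->
  Cintble P A (fun w => cpow (X w) (beta%:C * (1 - s))) /\
  cGamma_integral ((1 - beta)%:C + beta%:C * s) * Cint P A (fun w => cpow (X w) (beta%:C * (1 - s))) =
  cGamma_integral s.
Proof.
move=> s0; set q := (1 - beta)%:C + beta%:C * s.
have Rq : Re q = 1 - beta + beta * Re s by rewrite /q; case: (s) => u v; simpc.
have q0 : 0 < Re q by rewrite Rq addr_gt0 ?subr_gt0// mulr_gt0.
have eC w : A w -> (X w)%:C * cpow (X w) (- q) = cpow (X w) (beta%:C * (1 - s)).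
  move=> Aw; rewrite -[X in X * _]cpow1// -cpowD; congr cpow.
  by rewrite /q rmorphB rmorph1; ring.
have iC : Cintble P A (fun w => cpow (X w) (beta%:C * (1 - s))).
  apply: (Cintble_le mA _ _ (integrable_moment s0)).
  - by apply: measurable_funTS; apply: (measurableT_comp (measurable_Re_cpow _)).
  - by apply: measurable_funTS; apply: (measurableT_comp (measurable_Im_cpow _)).
  - by move=> w Aw; rewrite normc_cpow// ReZ; case: (s).
split => //.
have [||||||i e] := @mellin_laplace _ _ _ P A mA X mX _ (fun w => (X w)%:C) q.
- by [].
- exact: mX.
- exact: measurable_cst.
- exact: q0.
- have := integrable_moment s0; apply: eq_integrable => // w /[!inE] Aw.
  rewrite normc_real ger0_norm//; congr EFin.
  rewrite -{2}(powRr1 (X0 w)) -powRD; last by rewrite (gt_eqF Aw) implybT.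
  by congr powR; rewrite Rq; ring.
- move=> r r0; have := integrable_mul_laplace r0.
  move/(integrableS measurableT mA); move=> /(_ (fun _ _ => I)); apply: eq_integrable => // w _.
  by rewrite normc_real ger0_norm.
transitivity (cGamma_integral q * Cint P A (fun w => (X w)%:C * cpow (X w) (- q))).
  by congr (_ * _); apply: eq_Cint => w Aw; rewrite eC.
rewrite -e cGamma_integralE.
rewrite [RHS](Cint_powsubst0y ltr01 b0); last 2 first.
- move=> x x0; have := @continuous_laplace_Re R (s - 1) 1 x x0.
  by under eq_fun do rewrite mul1r.
- move=> x x0; have := @continuous_laplace_Im R (s - 1) 1 x x0.
  by under eq_fun do rewrite mul1r.
apply: eq_Cint => r /halflineP r0.
have -> : Cint P A (fun w => (X w)%:C * (expR (- (r * X w)))%:C) =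
    (beta * r `^ (beta - 1) * expR (- r `^ beta))%:C.
  rewrite -Rintegral_incr_pos_laplace// /Cint.
  transitivity ((\int[P]_(w in A) (X w * expR (- (r * X w)))) +i* (\int[P]_(w in A) 0)).
    by congr (_ +i* _); apply: eq_Rintegral => w _; rewrite -rmorphM.
  by rewrite Rintegral_cst// mul0r.
rewrite !mul1r cpow_powR (_ : q - 1 = beta%:C * (s - 1)); last first.
  by rewrite /q rmorphB rmorph1; ring.
by rewrite mulrCA -rmorphM; congr (_ * _); rewrite -rmorphM.
Qed.

End MellinIdentity.

(** * The law of the inverse subordinator *)

Section DensityMeasure.
Context d (T : measurableType d) (R : realType) (mu : {measure set T -> \bar R}).
Variables (f : T -> \bar R) (f0 : forall x, (0 <= f x)%E) (mf : measurable_fun setT f).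

(* The two proofs are kept as arguments so that the measure structure can be
   inferred from the term. *)
Definition density_measure of (forall x, (0 <= f x)%E) & measurable_fun setT f :=
  fun A : set T => (\int[mu]_(x in A) f x)%E.

Local Notation dm := (density_measure f0 mf).

Let density0 : dm set0 = 0%E.
Proof. exact: integral_set0. Qed.

Let density_ge0 A : (0 <= dm A)%E.
Proof. exact: integral_ge0. Qed.

Let density_sigma_additive : semi_sigma_additive dm.
Proof.
move=> /= F mF tF mUF; rewrite /density_measure; apply: cvg_toP.
  apply: ereal_nondecreasing_is_cvgn => m n mn.
  by apply: lee_sum_nneg_natr => // k _ _; exact: integral_ge0.
by rewrite ge0_integral_bigcup//=; exact: measurable_funTS.
Qed.

HB.instance Definition _ := isMeasure.Build _ _ _ dm density0 density_ge0 density_sigma_additive.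

End DensityMeasure.

(** * Uniqueness of measures on the line and integration against a density *)

Section RayUnique.
Context (R : realType).
Notation mu := (@lebesgue_measure R).

(** The open left rays generate the Borel sets, are stable under intersection and exhaust the
    line. *)
Lemma measure_unique_ray (m1 m2 : {measure set (measurableTypeR R) -> \bar R}) :
  (forall x, m1 `]-oo, x[%classic = m2 `]-oo, x[%classic) ->
  (forall x, (m1 `]-oo, x[%classic < +oo)%E) ->
  forall B, measurable B -> m1 B = m2 B.
Proof.
move=> h hfin; apply: (@measure_unique _ R (measurableTypeR R) (@RGenInftyO.G R) (fun n => `]-oo, n%:R[%classic)).
- exact: RGenInftyO.measurableE.
- move=> _ _ [x ->] [y ->]; exists (Num.min x y).
  apply/seteqP; split => z /=; rewrite !in_itv/= lt_min; first by move=> [-> ->].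
  by move=> /andP[].
- by move=> n; exists n%:R.
- apply/seteqP; split => // x _; exists (Num.truncn x).+1 => //=.
  by rewrite in_itv/= truncnS_gt.
- by move=> _ [x ->].
- by move=> n; exact: hfin.
Qed.

(** The measure nu is absolutely continuous, and its Radon-Nikodym derivative has the same integrals
    as g over measurable sets, hence equals g almost everywhere. *)
Lemma ge0_integral_density (nu : {finite_measure set (measurableTypeR R) -> \bar R})
    (g : R -> \bar R) (phi : R -> \bar R) :
  (forall x, (0 <= g x)%E) -> measurable_fun setT g ->
  (forall B, measurable B -> nu B = (\int[mu]_(x in B) g x)%E) ->
  (forall x, (0 <= phi x)%E) -> measurable_fun setT phi ->
  (\int[nu]_x phi x = \int[mu]_x (phi x * g x))%E.
Proof.
move=> g0 mg nug phi0 mphi.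
have numu : nu `<< lebesgue_measure.
  apply/null_content_dominatesP => B mB B0; rewrite nug//.
  by apply: null_set_integral => //; exact: measurable_funTS.
rewrite -(Radon_Nikodym_SigmaFinite.change_of_variables numu)//.
have iF := Radon_Nikodym_SigmaFinite.f_integrable numu.
apply: ge0_ae_eq_integral => //.
- by apply: emeasurable_funM => //; exact: measurable_int iF.
- exact: emeasurable_funM.
- by move=> x _; rewrite mule_ge0// Radon_Nikodym_SigmaFinite.f_ge0.
- by move=> x _; rewrite mule_ge0.
have := @integral_ae_eq _ _ _ lebesgue_measure setT measurableT g _ iF mg.
move=> /(_ _)/wrap[|]; first by move=> E _ mE; rewrite -Radon_Nikodym_SigmaFinite.f_integral// nug.
by apply: filterS => x h _; rewrite h.
Qed.

End RayUnique.

Section Law.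
Context {d : measure_display} {T : measurableType d} {R : realType}.
Variables (P : probability T R) (beta : R) (D : R -> {RV P >-> R}).
Hypotheses (b0 : 0 < beta) (b1 : beta < 1) (hD : stable_subordinator beta D).
Variables (t : R) (t0 : 0 < t) (g : R -> R).
Hypothesis hg : density_on_pos P (inverse_subordinator D t) g.
Notation mu := (@lebesgue_measure R).
Notation H := (`]0%R, +oo[%classic : set R).
Notation X := (incr0 D 1).
Notation A := (incr_pos D).

(* A random variable with the law of the inverse subordinator at time t. *)
Definition inv_rv (w : T) : R := (t / X w) `^ beta.

Lemma measurable_inv_rv : measurable_fun setT inv_rv.
Proof.
apply: (measurableT_comp (measurable_powR _)); apply: measurable_funM => //.
have -> : (fun w => (X w)^-1) = (fun w => X w `^ (-1)).
  by apply/funext => w; rewrite (powR_inv1 (incr0_ge0 hD w (@ler01 R))).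
exact: (measurableT_comp (measurable_powR _) (measurable_incr0 D 1)).
Qed.

Lemma inv_rv_gt0 w : A w -> 0 < inv_rv w.
Proof. by move=> Aw; rewrite powR_gt0// divr_gt0. Qed.

Lemma inv_rv_lt (x : R) w : 0 < x -> A w -> (inv_rv w < x) = (t < x `^ beta^-1 * X w).
Proof.
move=> x0 Aw.
set y := x `^ beta^-1.
have {1}-> : x = y `^ beta by rewrite -powRrM mulVf ?gt_eqF// powRr1// ltW.
have h1 : t / X w \is Num.nneg by rewrite nnegrE divr_ge0 ?ltW.
have h2 : y \is Num.nneg by rewrite nnegrE powR_ge0.
rewrite -ltr_pdivrMr// /inv_rv; apply/idP/idP; last by move=> h; exact: gt0_ltr_powR.
by apply: contraTT; rewrite -!leNgt => h; apply: ge0_ler_powR => //; exact: ltW.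
Qed.

(* As D is only known to be non-decreasing, E < x means t < D y for some
   y < x, whence the limit along xn < x. *)
Lemma prob_inverse_lt (x : R) : 0 < x ->
  P (inverse_subordinator D t @^-1` (EFin @` `]-oo, x[%classic)) = P (A `&` [set w | inv_rv w < x]).
Proof.
move=> x0.
pose xn (n : nat) : R := x * (1 - n.+2%:R^-1).
have n2 (n : nat) : 0 < n.+2%:R^-1 :> R /\ n.+2%:R^-1 < 1 :> R.
  by rewrite invr_gt0 invf_lt1// ltr1n.
have xn0 n : 0 < xn n by rewrite mulr_gt0// subr_gt0; exact: (n2 n).2.
have xnx n : xn n < x by rewrite /xn gtr_pMr// gtrBl; exact: (n2 n).1.
have xnd m n : (m <= n)%N -> xn m <= xn n.
  by move=> mn; rewrite ler_pM2l// lerD2l lerN2 lef_pV2 ?posrE// ler_nat.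
have xnc y : y < x -> exists n, y < xn n.
  move=> yx; exists (Num.truncn (x / (x - y))).
  have := truncnS_gt (x / (x - y)); set N := Num.truncn _ => hN.
  have hN2 : x / (x - y) < N.+2%:R by rewrite (lt_trans hN)// ltr_nat.
  rewrite ltr_pdivrMr ?subr_gt0// in hN2.
  rewrite /xn mulrBr mulr1 ltrBrDl -ltrBrDr ltr_pdivrMr//.
  by rewrite mulrC.
pose S n := [set w | t < D (xn n) w].
pose S' n := [set w | t < xn n `^ beta^-1 * X w].
have mS n : measurable (S n) by apply: measurable_gt; exact: measurable_funP.
have mX := measurable_incr0 D 1.
have mS' n : measurable (S' n) by apply: measurable_gt; exact: measurable_funM.
(* The events differ, only their probabilities agree. Both sequences increase with n, so continuity
   from below carries the equality over to the unions. *)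
have SS' n : P (S n) = P (S' n).
  by rewrite /S (prob_gt_incr0 hD) (self_similar b0 b1 hD (xn0 n) t0).
have nS : nondecreasing_seq S.
  move=> m n mn; rewrite subsetEset => w; rewrite /S/= => /lt_le_trans; apply.
  by case: hD => _ h _; apply: h; rewrite ?xnd// ltW.
have nS' : nondecreasing_seq S'.
  move=> m n mn; rewrite subsetEset => w; rewrite /S'/= => /lt_le_trans; apply.
  apply: ler_wpM2r; first exact: (incr0_ge0 hD w (@ler01 R)).
  by apply: ge0_ler_powR; rewrite ?nnegrE ?xnd ?invr_ge0 ?ltW.
have US : \bigcup_n S n = inverse_subordinator D t @^-1` (EFin @` `]-oo, x[%classic).
  apply/seteqP; split => w /=.
  - move=> [n _ Snw].
    pose Q := [set y%:E | y in [set y : R | 0 < y /\ t < D y w]].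
    have Qge0 : (0 <= ereal_inf Q)%E.
      by apply: le_ereal_inf_tmp => _ [y [y0 _] <-]; rewrite lee_fin ltW.
    have Qle : (ereal_inf Q <= (xn n)%:E)%E.
      by apply: ereal_inf_lbound; exists (xn n).
    rewrite /inverse_subordinator -/Q.
    (* The event consists of finite values only, so the infimum has to be shown finite before it can
       serve as a real witness. *)
    have hf : ereal_inf Q \is a fin_num.
      by rewrite ge0_fin_numE// (le_lt_trans Qle)// ltry.
    exists (fine (ereal_inf Q)); last by rewrite fineK.
    by rewrite in_itv/= -lte_fin fineK// (le_lt_trans Qle)// lte_fin.
  - move=> [y]; rewrite in_itv/= => yx hy.
    have : (inverse_subordinator D t w < x%:E)%E by rewrite -hy lte_fin.
    move=> /ereal_inf_lt[_ [z [z0 tz] <-]]; rewrite lte_fin => zx.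
    have [n hn] := xnc _ zx; exists n => //; rewrite /S/=.
    apply: (lt_le_trans tz); case: hD => _ h _; apply: h; exact: ltW.
have US' : \bigcup_n S' n = A `&` [set w | inv_rv w < x].
  have SA n w : S' n w -> A w.
    rewrite /S'/= => h; rewrite /incr_pos/=; have := lt_trans t0 h.
    by rewrite pmulr_rgt0// powR_gt0.
  apply/seteqP; split => w /=.
  - move=> [n _ h]; split; first exact: SA h.
    by apply: (lt_trans _ (xnx n)); rewrite inv_rv_lt//; exact: SA h.
  - move=> [Aw /xnc[n hn]]; exists n => //.
    by move: hn; rewrite inv_rv_lt.
have mU : measurable (\bigcup_n S n) by exact: bigcupT_measurable.
have mU' : measurable (\bigcup_n S' n) by exact: bigcupT_measurable.
rewrite -US -US'.
apply: (cvg_unique _ (nondecreasing_cvg_mu mS mU nS)) => //.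
have -> : P \o S = P \o S' by apply/funext => n; exact: SS'.
exact: nondecreasing_cvg_mu.
Qed.

(** Nothing is known of g off (0, +oo); cutting it off gives a non-negative measurable density on
    the whole line. *)
Let g1 (y : R) : \bar R := ((fun y => (g y)%:E) \_ H) y.

(** The law of [inv_rv] and the measure with density [g1] agree on left rays, by [prob_inverse_lt]
    for a positive endpoint and because both vanish otherwise; hence they are equal. The complement
    of A is a null set. *)
Lemma ge0_integral_inv_rv (phi : R -> \bar R) :
  (forall y, (0 <= phi y)%E) -> measurable_fun setT phi ->
  (\int[P]_(w in A) phi (inv_rv w) = \int[mu]_(y in H) (phi y * (g y)%:E))%E.
Proof.
move=> phi0 mphi; case: hg => mg g0 hlaw.
have g1_ge0 y : (0 <= g1 y)%E.
  by apply: erestrict_ge0 => z /halflineP z0; rewrite lee_fin g0.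
have mg1 : measurable_fun setT g1.
  by apply/(measurable_restrictT _ measurable_halfline); exact/measurable_EFinP.
have mA : measurable A := measurable_incr_pos D.
have mY := measurable_inv_rv.
have mlt (x : R) : measurable [set w | inv_rv w < x].
  have := mY measurableT _ (measurable_itv `]-oo, x[); rewrite setTI; congr measurable.
have mY' : @measurable_fun _ _ T (measurableTypeR R) setT inv_rv by [].
pose Yf : {mfun T >-> measurableTypeR R} := @mfun_Sub _ _ T (measurableTypeR R) inv_rv (mem_set mY').
pose nu : {finite_measure set (measurableTypeR R) -> \bar R} := @distribution _ _ T (measurableTypeR R) R P Yf.
pose dm : {measure set (measurableTypeR R) -> \bar R} := density_measure lebesgue_measure g1_ge0 mg1.
have nuE (x : R) : nu `]-oo, x[%classic = P (A `&` [set w | inv_rv w < x]).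
  rewrite /nu/= /distribution /pushforward.
  have -> : Yf @^-1` `]-oo, x[%classic = [set w | inv_rv w < x].
    by apply/seteqP; split => w /=; rewrite in_itv.
  rewrite -[in LHS](setIT [set w | inv_rv w < x]) -(setUv A) setIUr measureU//; last 3 first.
  - exact: measurableI.
  - by apply: measurableI => //; exact: measurableC.
  - by rewrite setIACA setICr setI0.
  rewrite setIC [X in (_ + X)%E](_ : _ = 0%E) ?adde0//.
  apply/eqP; rewrite eq_le measure_ge0 andbT -(prob_incr_pos b0 b1 hD).
  apply: le_measure; rewrite ?inE//; last exact: measurableC.
  by apply: measurableI => //; exact: measurableC.
have dmE (x : R) : dm `]-oo, x[%classic = P (A `&` [set w | inv_rv w < x]).
  have [x0|x0] := ltP 0 x.
    rewrite -prob_inverse_lt// hlaw//.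
    by rewrite /dm/= /density_measure integral_mkcondr.
  have -> : A `&` [set w | inv_rv w < x] = set0.
    apply/seteqP; split => w //= [Aw wx]; have := inv_rv_gt0 Aw.
    by rewrite ltNge (le_trans (ltW wx) x0).
  rewrite measure0 /dm/= /density_measure integral0_eq// => y /=; rewrite in_itv/= => yx.
  rewrite /g1 patchE memNset//= in_itv/= andbT => y0.
  by have := lt_le_trans yx x0; rewrite ltNge (ltW y0).
have nudm B : measurable B -> nu B = dm B.
  move=> mB; apply: measure_unique_ray => // x; first exact: (etrans (nuE x) (esym (dmE x))).
  rewrite [X in (X < _)%E](nuE x).
  by rewrite -ge0_fin_numE// fin_num_measure//; exact: measurableI.
transitivity (\int[P]_w phi (inv_rv w))%E.
  have mC : measurable (~` A) by exact: measurableC.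
  rewrite [RHS](ge0_negligible_integral mC)//; last first.
  - exact: (prob_incr_pos b0 b1 hD).
  - exact: (measurableT_comp mphi mY).
  by rewrite setTD setCK.
transitivity (\int[nu]_y phi y)%E.
  by rewrite /nu/= ge0_integral_distribution.
rewrite (ge0_integral_density g1_ge0 mg1 nudm phi0 mphi) [RHS]integral_mkcond.
apply: eq_integral => y _; rewrite /g1 !patchE; case: ifPn => // _.
by rewrite mule0.
Qed.

End Law.

(** * Decay on vertical lines *)

Section GammaShift.
Context {R : realType}.
Notation Re := complex.Re.
Notation Im := complex.Im.
Notation normc := ComplexField.Normc.normc.

Lemma cGamma_integral_addn (z : R[i]) n : 0 < Re z ->
  cGamma_integral (z + n%:R) = \prod_(k < n) (z + k%:R) * cGamma_integral z.
Proof.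
move=> z0; elim: n => [|n IHn]; first by rewrite addr0 big_ord0 mul1r.
have zn0 : 0 < Re (z + n%:R).
  by rewrite -(rmorph_nat (real_complex R)) Re_addr ltr_wpDr.
rewrite -natr1 addrA cGamma_integralS// IHn big_ord_recr/= mulrA.
by congr (_ * _); rewrite mulrC.
Qed.

Lemma normc_prod (I : finType) (F : I -> R[i]) :
  normc (\prod_i F i) = \prod_i normc (F i).
Proof.
apply: (big_ind2 (fun (z : R[i]) (r : R) => normc z = r)) => //.
- by rewrite normc_sqrt/= expr1n expr0n/= addr0 sqrtr1.
- by move=> x _ y _ <- <-; exact: ComplexField.Normc.normcM.
Qed.

Lemma normc_add_nat_ge (z : R[i]) k : 0 < Re z -> normc z <= normc (z + k%:R).
Proof.
move=> z0; rewrite -(rmorph_nat (real_complex R)) !normc_sqrt Re_addr.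
have -> : Im (z + k%:R%:C) = Im z by case: (z) => a b /=; rewrite addr0.
rewrite ler_sqrt ?addr_ge0 ?sqr_ge0// lerD2r ler_sqr ?nnegrE ?lerDl//; first exact: ltW.
by rewrite addr_ge0// ltW.
Qed.

Lemma prod_normc_add_nat_ge (z : R[i]) n : 0 < Re z ->
  normc z ^+ n <= normc (\prod_(k < n) (z + k%:R)).
Proof.
move=> z0; rewrite normc_prod -{1}(card_ord n) -prodr_const.
by apply: ler_prod => k _; rewrite normc_ge0 normc_add_nat_ge.
Qed.

End GammaShift.

(** * Quadratic decay of the moments *)

Section ChiBound.
Context {d : measure_display} {T : measurableType d} {R : realType}.
Variables (P : probability T R) (beta : R) (D : R -> {RV P >-> R}).
Hypotheses (b0 : 0 < beta) (b1 : beta < 1) (hD : stable_subordinator beta D).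
Notation Re := complex.Re.
Notation Im := complex.Im.
Notation normc := ComplexField.Normc.normc.
Notation X := (incr0 D 1).
Notation A := (incr_pos D).

Definition moment (s : R[i]) : R[i] := Cint P A (fun w => cpow (X w) (beta%:C * (1 - s))).

Lemma normc_moment_le (c : R) : 0 < c ->
  exists2 C, 0 <= C & forall s, Re s = c -> normc (moment s) <= C.
Proof.
move=> c0; have mA : measurable A := measurable_incr_pos D.
exists (2 * \int[P]_(w in A) (X w `^ (beta * (1 - c)))).
  by rewrite mulr_ge0//; apply: Rintegral_ge0 => w _; exact: powR_ge0.
move=> s sc; have s0 : 0 < Re s by rewrite sc.
apply: (normc_Cint_le mA (proj1 (mellin_identity b0 b1 hD s0)) (integrable_moment b0 b1 hD c0)).
by move=> w Aw; rewrite normc_cpow// ReZ -sc; case: (s).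
Qed.

(** The Mellin identity at s and at s + N + 2 shows that moment(s) Gamma(w) times the product of s +
    k, k < N + 2, is moment(s + N + 2) Gamma(v), v = w + beta (N + 2). By [cGamma_le_shift],
    |Gamma(v)| is at most a constant times |Gamma(w + N)|, which is |Gamma(w)| times the product of
    |w + k|, k < N. Cancel Gamma(w): on the left there are N + 2 factors of modulus at least |s|, on
    the right N factors of modulus at most K |s|. *)
Lemma moment_decay (c : R) : 0 < c ->
  exists2 C, 0 <= C & forall s, Re s = c -> normc (moment s) * normc s ^+ 2 <= C.
Proof.
move=> c0.
(* This N satisfies N (1 - beta) > 2 beta, which says [dl] > 0. *)
pose N := (Num.truncn (2 * beta / (1 - beta))).+1.
have b1' : 0 < 1 - beta by rewrite subr_gt0.
have hN : 2 * beta < N%:R * (1 - beta) by rewrite -ltr_pdivrMr// truncnS_gt.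
pose dl := N%:R - beta * (N.+2)%:R.
have dl0 : 0 < dl by rewrite /dl -addn2 natrD; lra.
have cN0 : 0 < c + (N.+2)%:R by rewrite addr_gt0.
have [C1 C10 h1] := normc_moment_le cN0.
pose a := 1 - beta + beta * (c + N.+2%:R).
have a0 : 0 < a by rewrite addr_gt0// mulr_gt0.
have [C2 C20 h2] := cGamma_le_shift a0 dl0.
(* On the line |s| >= c, so |w + k| <= (1 + N) + beta |s| <= K |s|. *)
pose K := (1 + N%:R) / c + 1.
have K0 : 0 <= K by rewrite addr_ge0// divr_ge0 ?addr_ge0// ltW.
exists (C1 * C2 * K ^+ N); first by rewrite !mulr_ge0// exprn_ge0.
move=> s sc; have s0 : 0 < Re s by rewrite sc.
pose w := (1 - beta)%:C + beta%:C * s.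
have Rw : Re w = 1 - beta + beta * c by rewrite -sc /w; case: (s) => u v; simpc.
have w0 : 0 < Re w by rewrite Rw addr_gt0// mulr_gt0.
have G0 := cGamma_integral_neq0 w0.
have ns : c <= normc s by rewrite -sc; apply: le_trans (normr_Re_le _); rewrite ler_norm.
have ns0 : 0 < normc s by exact: lt_le_trans ns.
have eM : normc (moment s) * normc (cGamma_integral w) = normc (cGamma_integral s).
  have := proj2 (mellin_identity b0 b1 hD s0); rewrite -/w -/(moment s) => <-.
  by rewrite ComplexField.Normc.normcM mulrC.
have hs : normc (cGamma_integral (s + N.+2%:R)) <= C1 * C2 * normc (cGamma_integral (w + N%:R)).
  have sN : Re (s + N.+2%:R) = c + N.+2%:R.
    by rewrite -(rmorph_nat (real_complex R)) Re_addr sc.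
  have sN0 : 0 < Re (s + N.+2%:R) by rewrite sN.
  have := proj2 (mellin_identity b0 b1 hD sN0).
  rewrite -/(moment _) => <-; set v := (1 - beta)%:C + _.
  have vE : v + dl%:C = w + N%:R.
    have -> : dl%:C = N%:R - beta%:C * N.+2%:R by rewrite /dl rmorphB rmorphM !rmorph_nat.
    by rewrite /v /w mulrDr; ring.
  have Rv : Re v = a.
    rewrite /v /a -sN; move: (s + N.+2%:R) => z; case: z => p q; simpc.
    by [].
  rewrite ComplexField.Normc.normcM -vE [C1 * C2]mulrC mulrAC.
  by apply: ler_pM; rewrite ?normc_ge0 ?h2// h1.
rewrite !cGamma_integral_addn// !ComplexField.Normc.normcM -eM in hs.
have hw : normc (\prod_(k < N) (w + k%:R)) <= (K * normc s) ^+ N.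
  rewrite normc_prod (_ : (K * normc s) ^+ N = \prod_(k < N) (K * normc s)); last by rewrite prodr_const card_ord.
  apply: ler_prod => k _; rewrite normc_ge0/=.
  have -> : w + k%:R = (1 - beta + k%:R)%:C + beta%:C * s.
    by rewrite rmorphD rmorph_nat /w addrAC.
  apply: le_trans (le_normcD _ _) _.
  rewrite ComplexField.Normc.normcM !normc_real.
  have kN : k%:R <= N%:R :> R by rewrite ler_nat ltnW.
  have h4 : 0 <= 1 - beta + k%:R by rewrite addr_ge0// ltW.
  have h3 : `|1 - beta + k%:R| <= 1 + N%:R.
    by rewrite (ger0_norm h4); apply: lerD => //; rewrite gerBl ltW.
  rewrite (gtr0_norm b0) /K mulrDl mul1r; apply: lerD.
    apply: le_trans h3 _; rewrite mulrAC ler_pdivlMr//.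
    by rewrite ler_wpM2l// addr_ge0.
  by rewrite ler_piMl ?normc_ge0// ltW.
have hz := prod_normc_add_nat_ge N.+2 s0.
have nG : 0 < normc (cGamma_integral w) by rewrite normc_gt0.
rewrite -(ler_pM2r (exprn_gt0 N ns0)) -(ler_pM2r nG).
apply: le_trans (_ : normc (\prod_(k < N.+2) (s + k%:R)) * (normc (moment s) * normc (cGamma_integral w)) <= _).
  rewrite (_ : _ * _ * _ * _ = normc s ^+ N.+2 * (normc (moment s) * normc (cGamma_integral w))).
    by apply: ler_wpM2r => //; rewrite mulr_ge0 ?normc_ge0.
  by rewrite !exprS; ring.
apply: le_trans hs _; rewrite mulrA; apply: ler_wpM2r; first exact: normc_ge0.
by rewrite -[leRHS]mulrA -exprMn; apply: ler_wpM2l => //; rewrite mulr_ge0.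
Qed.

End ChiBound.

(** * Fourier inversion *)

Section LogKernel.
Context {R : realType}.
Notation mu := (@lebesgue_measure R).
Notation H := (`]0%R, +oo[%classic : set R).

Lemma cvgNy_atan : (@atan R) z @[z --> -oo] --> - (pi / 2).
Proof.
apply/cvgNy_compNP; rewrite (_ : _ \o _ = (fun z => - atan z)).
  by apply: cvgN; exact: cvgy_atan.
by apply/funext => z /=; rewrite atanN.
Qed.

(* The derivative in y of atan (ln (y / x) / e). *)
Definition log_kernel (x e y : R) : R := y^-1 * (e / (e ^+ 2 + ln (y / x) ^+ 2)).

Variables (x e : R) (x0 : 0 < x) (e0 : 0 < e).
Let F (y : R) := atan (ln (y / x) / e).

Lemma log_kernel_ge0 (y : R) : 0 < y -> 0 <= log_kernel x e y.
Proof.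
by move=> y0; rewrite mulr_ge0 ?invr_ge0 ?divr_ge0 ?addr_ge0 ?sqr_ge0// ltW.
Qed.

Let is_derive_F (y : R) : 0 < y -> is_derive y 1 F (log_kernel x e y).
Proof.
move=> y0; have yx0 : 0 < y / x by rewrite divr_gt0.
have h1 : is_derive y 1 (fun y : R => y / x) x^-1.
  apply: (@is_derive_eqE _ (x^-1 \*: id) _ y (x^-1 *: 1)).
  - by apply/funext => z /=; rewrite mulrC.
  - exact: mulr1.
have h2 := is_derive1_ln yx0.
have h3 := @is_derive1_comp R (@ln R) (fun y : R => y / x) y _ _ h2 h1.
have h4 := is_derive1_atan (ln (y / x) / e).
have h5 : is_derive y 1 (fun y : R => ln (y / x) / e) ((y / x)^-1 * x^-1 / e).
  apply: (@is_derive_eqE _ (e^-1 \*: (@ln R \o (fun y : R => y / x))) _ y (e^-1 *: ((y / x)^-1 * x^-1))).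
  - by apply/funext => z; exact: mulrC.
  - exact: mulrC.
have h6 := @is_derive1_comp R atan (fun y : R => ln (y / x) / e) y _ _ h4 h5.
apply: (is_derive_eqE h6) => //; rewrite /log_kernel; set l := ln _.
have xn := lt0r_neq0 x0; have en := lt0r_neq0 e0; have yn := lt0r_neq0 y0.
field; rewrite ?xn ?en ?yn/=.
by rewrite gt_eqF// ltr_wpDr ?sqr_ge0// exprn_gt0.
Qed.

Let cvgF0 : F y @[y --> 0^'+] --> - (pi / 2).
Proof.
apply: (cvg_comp _ _ _ cvgNy_atan); apply/cvgrNyPle => M; near=> y.
have y0 : 0 < y by near: y; exact: nbhs_right_gt.
rewrite ler_pdivrMr// -ler_expR lnK ?posrE ?divr_gt0// ler_pdivrMr//.
by near: y; apply: nbhs_right_le; rewrite mulr_gt0 ?expR_gt0.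
Unshelve. all: by end_near. Qed.

Let cvgFy : F y @[y --> +oo] --> pi / 2.
Proof.
apply: (cvg_comp _ _ _ (@cvgy_atan R)); apply/cvgryPge => M; near=> y.
have y0 : 0 < y by [].
by rewrite ler_pdivlMr// -ler_expR lnK ?posrE ?divr_gt0// ler_pdivlMr.
Unshelve. all: by end_near. Qed.

Let cont : {in `]0, +oo[, continuous (log_kernel x e)}.
Proof.
move=> y; rewrite in_itv/= andbT => y0.
have hq : e ^+ 2 + ln (y / x) ^+ 2 != 0.
  by rewrite gt_eqF// ltr_wpDr ?sqr_ge0// exprn_gt0.
have cln : ln (z / x) @[z --> y] --> ln (y / x).
  apply: (@continuous_comp _ _ _ (fun y : R => y / x) (@ln R)).
    by apply: cvgM; [exact: cvg_id|exact: cvg_cst].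
  by apply: continuous_ln; rewrite divr_gt0.
apply: cvgM; first by apply: cvgV; [rewrite gt_eqF|exact: cvg_id].
apply: cvgM; first exact: cvg_cst.
apply: cvgV => //; apply: cvgD; first exact: cvg_cst.
exact: (cvg_comp _ _ cln (@exprn_continuous R 2 _)).
Qed.

Lemma integrable_log_kernel : mu.-integrable H (EFin \o log_kernel x e).
Proof. exact: (ge0_integrable_FTC0y log_kernel_ge0 is_derive_F cont cvgF0 cvgFy). Qed.

Lemma Rintegral_log_kernel : \int[mu]_(y in H) log_kernel x e y = pi.
Proof.
rewrite (Rintegral_FTC0y is_derive_F cont integrable_log_kernel cvgF0 cvgFy).
by rewrite opprK -splitr.
Qed.

End LogKernel.

(** * The Poisson kernel on the logarithmic scale as an approximate identity *)

Section ApproxIdentity.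
Context {R : realType}.
Notation mu := (@lebesgue_measure R).
Notation H := (`]0%R, +oo[%classic : set R).

(* Where [|ln (y / x)| >= dl] the kernel at [e] is at most [e (1 + dl^-2)]
   times both [y^-1] and the kernel at [1]. *)
Lemma log_kernel_far (x e y dl : R) : 0 < e -> 0 < y -> 0 < dl -> dl <= `|ln (y / x)| ->
  log_kernel x e y <= e * (1 + dl^-2) * y^-1 /\
  log_kernel x e y <= e * (1 + dl^-2) * log_kernel x 1 y.
Proof.
move=> e0 y0 d0 dl_le; set L := ln (y / x).
have L2 : dl ^+ 2 <= L ^+ 2.
  by rewrite -(real_normK (num_real L)) ler_sqr ?nnegrE// ltW.
have d2 : 0 < dl ^+ 2 by rewrite exprn_gt0.
have L20 : 0 < L ^+ 2 by exact: lt_le_trans L2.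
have e2 : 0 <= e ^+ 2 := sqr_ge0 e.
have q0 : 0 < e ^+ 2 + L ^+ 2 by lra.
have k : (e ^+ 2 + L ^+ 2)^-1 <= (1 + dl^-2) / (1 + L ^+ 2).
  apply: le_trans (_ : (L ^+ 2)^-1 <= _).
    by rewrite lef_pV2 ?posrE//; lra.
  rewrite ler_pdivlMr; last by lra.
  rewrite mulrDr mulr1 mulVf ?gt_eqF// addrC lerD2l.
  by rewrite lef_pV2 ?posrE.
have k1 : (1 + dl^-2) / (1 + L ^+ 2) <= 1 + dl^-2.
  by rewrite ler_pdivrMr ?ler_peMr//; rewrite ?addr_ge0 ?invr_ge0//; lra.
rewrite /log_kernel -/L expr1n; split.
- rewrite [leRHS]mulrC ler_pM2l ?invr_gt0//.
  by rewrite ler_pM2l// (le_trans k).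
- rewrite [leRHS](_ : _ = y^-1 * (e * ((1 + dl^-2) / (1 + L ^+ 2)))); last by ring.
  by rewrite ler_pM2l ?invr_gt0// ler_pM2l.
Qed.

Variables (x : R) (x0 : 0 < x) (h : R -> R).
Hypotheses (mh : measurable_fun H h) (h0 : forall y, 0 < y -> 0 <= h y).
Hypotheses (ch : {for x, continuous h}).
Hypotheses (ih : mu.-integrable H (fun y => (y^-1 * h y)%:E)).

Lemma integrable_log_kernelM (e : R) : 0 < e ->
  mu.-integrable H (fun y => (log_kernel x e y * h y)%:E).
Proof.
move=> e0; have := integrableZl measurable_halfline e^-1 ih; apply: le_integrable => //.
- apply/measurable_EFinP; apply: measurable_funM => //.
  by apply/measurable_EFinP; exact: measurable_int (integrable_log_kernel x0 e0).
- move=> y /halflineP y0; rewrite /= lee_fin.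
  have hy := h0 y0; have ky := log_kernel_ge0 x e0 y0.
  rewrite !ger0_norm ?mulr_ge0 ?invr_ge0//; try exact: ltW.
  rewrite mulrA ler_wpM2r// /log_kernel mulrC ler_pM2r ?invr_gt0//.
  rewrite ler_pdivrMr ?ltr_wpDr ?sqr_ge0 ?exprn_gt0// mulrDr expr2 mulrA mulVf ?gt_eqF// mul1r.
    by rewrite lerDl mulr_ge0 ?sqr_ge0// invr_ge0 ltW.
  by rewrite addr_ge0 ?sqr_ge0.
Qed.

(** The kernel has mass pi, so the error is the integral of kernel times h(y) - h(x). Near x, in the
    distance |ln (y / x)|, continuity bounds the difference by a = eta / (2 pi) and contributes eta
    / 2; far from x the kernel is of order e, and the contribution is at most e K. *)
Lemma approx_log_kernel :
  (fun n : nat => \int[mu]_(y in H) (log_kernel x n.+1%:R^-1 y * h y)) @ \oo --> pi * h x.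
Proof.
apply/cvgrPdist_le => eta eta0.
pose I0 := \int[mu]_(y in H) (y^-1 * h y).
have hx0 := h0 x0.
have p0 : 0 < pi :> R := pi_gt0 R.
pose a := eta / (2 * pi).
have a0 : 0 < a by rewrite divr_gt0 ?mulr_gt0.
have [dl dl0 hdl] : exists2 dl : R, 0 < dl &
    forall y, 0 < y -> `|ln (y / x)| < dl -> `|h y - h x| <= a.
  have cexp : {for 0, continuous (fun v : R => h (x * expR v))}.
    apply: (@continuous_comp _ _ _ (fun v : R => x * expR v) h).
      by apply: cvgM; [exact: cvg_cst|exact: continuous_expR].
    by rewrite /= expR0 mulr1.
  have /cvgrPdist_le/(_ a a0) := cexp.
  rewrite expR0 mulr1 => /nbhs_ballP[dl /= dl0 hb]; exists dl => // y y0 hy.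
  have := hb (ln (y / x)); rewrite /ball/= sub0r normrN => /(_ hy).
  by rewrite lnK ?posrE ?divr_gt0// mulrCA mulfV ?gt_eqF// mulr1 distrC.
pose C := 1 + dl^-2.
have C0 : 0 < C by rewrite ltr_pwDl// invr_ge0 sqr_ge0.
pose K := C * (I0 + h x * pi).
have I00 : 0 <= I0.
  by apply: Rintegral_ge0 => y /halflineP y0; rewrite mulr_ge0 ?h0// invr_ge0 ltW.
have K0 : 0 <= K by apply: mulr_ge0; [exact: ltW|apply: addr_ge0 => //; apply: mulr_ge0 => //; exact: ltW].
near=> n; set e : R := n.+1%:R^-1.
have e0 : 0 < e by rewrite invr_gt0.
have eK : e * K <= eta / 2.
  rewrite /e mulrC ler_pdivrMr// -ler_pdivrMl ?divr_gt0//.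
  apply: le_trans (_ : n%:R <= _); last by rewrite ler_nat.
  by near: n; exact: nbhs_infty_ger.
have i1 := integrable_log_kernelM e0.
have i2 := integrable_log_kernel x0 e0.
have i3 := integrable_log_kernel x0 (@ltr01 R).
have i2h : mu.-integrable H (fun y => (h x * log_kernel x e y)%:E).
  by have := integrableZl measurable_halfline (h x) i2.
(* The first summand covers the near region, the second the far one. There h(y) is paired with the
   bound in 1/y, integrable by [ih], and the constant h(x) with the kernel at 1, which has finite
   mass. *)
pose B (y : R) := a * log_kernel x e y + e * C * (y^-1 * h y + h x * log_kernel x 1 y).
have ib1 : mu.-integrable H (fun y => (a * log_kernel x e y)%:E).
  by have := integrableZl measurable_halfline a i2.
have ib2 : mu.-integrable H (fun y => (h x * log_kernel x 1 y)%:E).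
  by have := integrableZl measurable_halfline (h x) i3.
have ib3 : mu.-integrable H (fun y => (y^-1 * h y + h x * log_kernel x 1 y)%:E).
  by have := integrableD measurable_halfline ih ib2.
have ib4 : mu.-integrable H (fun y => (e * C * (y^-1 * h y + h x * log_kernel x 1 y))%:E).
  by have := integrableZl measurable_halfline (e * C) ib3.
have ib : mu.-integrable H (EFin \o B) by have := integrableD measurable_halfline ib1 ib4.
have BE : \int[mu]_(y in H) B y = a * pi + e * C * (I0 + h x * pi).
  rewrite /B RintegralD//; congr (_ + _).
    by rewrite RintegralZl// Rintegral_log_kernel.
  rewrite RintegralZl//; congr (_ * _); rewrite RintegralD//; congr (_ + _).
  by rewrite RintegralZl// Rintegral_log_kernel.
rewrite distrC mulrC -(Rintegral_log_kernel x0 e0) -RintegralZl// -RintegralB//.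
have ii : mu.-integrable H (EFin \o (fun y => log_kernel x e y * h y - h x * log_kernel x e y)).
  by have := integrableB measurable_halfline i1 i2h.
apply: le_trans (le_normr_Rintegral measurable_halfline ii) _.
apply: le_trans (_ : \int[mu]_(y in H) B y <= _); last first.
  rewrite BE -mulrA -/K [leRHS]splitr; apply: lerD => //.
  by rewrite /a invfM mulrA mulfVK// gt_eqF.
apply: le_Rintegral => //; first exact: integrable_norm.
move=> y /halflineP y0; have hy := h0 y0.
have ke := log_kernel_ge0 x e0 y0; have k1 := log_kernel_ge0 x (@ltr01 R) y0.
rewrite [h x * _]mulrC -mulrBr normrM (ger0_norm ke) /B.
have [near_x|far] := ltP `|ln (y / x)| dl.
  apply: le_trans (_ : a * log_kernel x e y <= _).
    by rewrite mulrC ler_wpM2r// hdl.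
  rewrite lerDl; apply: mulr_ge0; first by apply: mulr_ge0; exact: ltW.
  by apply: addr_ge0; apply: mulr_ge0 => //; rewrite invr_ge0 ltW.
have [f1 f2] := log_kernel_far e0 y0 dl0 far.
rewrite -/C in f1 f2.
apply: le_trans (_ : e * C * (y^-1 * h y + h x * log_kernel x 1 y) <= _); last first.
  by rewrite lerDr mulr_ge0// ltW.
apply: le_trans (_ : log_kernel x e y * (h y + h x) <= _).
  by rewrite ler_wpM2l// (le_trans (ler_normB _ _))// !ger0_norm.
rewrite [leLHS](mulrDr _ (h y)) [leRHS](mulrDr _ (y^-1 * h y)); apply: lerD.
  by rewrite [leRHS](mulrA _ y^-1); apply: ler_wpM2r.
by rewrite [leRHS](_ : _ = e * C * log_kernel x 1 y * h x); [apply: ler_wpM2r|ring].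
Unshelve. all: by end_near. Qed.

End ApproxIdentity.

(** * The Laplace transform of the cosine *)

Section CosLaplace.
Context {R : realType}.
Notation mu := (@lebesgue_measure R).
Notation H := (`]0%R, +oo[%classic : set R).
Variables (e b : R) (e0 : 0 < e).

Lemma is_derive_linear (k u : R) : is_derive u 1 (fun u : R => k * u) k.
Proof.
apply: (@is_derive_eqE _ (k \*: id) _ u (k *: 1)) => //; last exact: mulr1.
Qed.

Lemma measurable_expRN : measurable_fun setT (fun u : R => expR (- (e * u))).
Proof.
by apply: measurableT_comp => //; apply: measurableT_comp => //; exact: measurable_funM.
Qed.

Lemma integrable_expRN : mu.-integrable H (fun u => (expR (- (e * u)))%:E).
Proof.
have := integrable_Gamma_scaled (@ltr01 R) e0; apply: eq_integrable => // u _.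
by rewrite subrr powRr0 mul1r.
Qed.

Lemma continuous_mulr_comp (f : R -> R) (k : R) : continuous f -> continuous (fun u => f (k * u)).
Proof.
move=> cf u; apply: (@continuous_comp _ _ _ (fun u : R => k * u) f); last exact: cf.
by apply: cvgM; [exact: cvg_cst|exact: cvg_id].
Qed.

Lemma continuous_expRN : continuous (fun u : R => expR (- (e * u))).
Proof.
rewrite (_ : (fun _ => _) = (fun u => expR ((- e) * u))); last by apply/funext => u; rewrite mulNr.
by apply: continuous_mulr_comp; exact: continuous_expR.
Qed.

Lemma integrable_expRN_cos :
  mu.-integrable H (fun u => (expR (- (e * u)) * cos (u * b))%:E).
Proof.
apply: le_integrable integrable_expRN => //.
- apply/measurable_EFinP; apply: measurable_funTS; apply: measurable_funM.
    exact: measurable_expRN.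
  apply: (measurableT_comp (continuous_measurable_fun (@continuous_cos R))).
  exact: measurable_funM.
- move=> u _; rewrite /= lee_fin normrM ler_piMr//.
  by rewrite ler_norml cos_geN1 cos_le1.
Qed.

Lemma Rintegral_expRN_cos :
  \int[mu]_(u in H) (expR (- (e * u)) * cos (u * b)) = e / (e ^+ 2 + b ^+ 2).
Proof.
pose q := e ^+ 2 + b ^+ 2.
have q0 : 0 < q by rewrite ltr_wpDr ?sqr_ge0// exprn_gt0.
(* The real part of e^((-e + ib) u) / (-e + ib). *)
pose F (u : R) := expR (- (e * u)) * ((b * sin (b * u) - e * cos (b * u)) / q).
have cG : continuous (fun u => (b * sin (b * u) - e * cos (b * u)) / q).
  move=> u; apply: cvgM; last exact: cvg_cst.
  apply: cvgB; (apply: cvgM; first exact: cvg_cst).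
    exact: continuous_mulr_comp (@continuous_sin R) u.
  exact: continuous_mulr_comp (@continuous_cos R) u.
have cF : continuous F by move=> u; apply: cvgM; [exact: continuous_expRN|exact: cG].
have dF (u : R) : is_derive u 1 F (expR (- (e * u)) * cos (u * b)).
  have de : is_derive u 1 (expR \o (fun u : R => (- e) * u)) (expR ((- e) * u) * (- e)).
    by apply: is_derive1_comp; exact: is_derive_linear.
  have ds : is_derive u 1 (sin \o (fun u : R => b * u)) (cos (b * u) * b).
    by apply: is_derive1_comp; exact: is_derive_linear.
  have dc : is_derive u 1 (cos \o (fun u : R => b * u)) (- sin (b * u) * b).
    by apply: is_derive1_comp; exact: is_derive_linear.
  have h := is_deriveM de (is_deriveZ q^-1 (is_deriveB (is_deriveZ b ds) (is_deriveZ e dc))).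
  apply: (is_derive_eqE h).
    apply/funext => v.
    transitivity (expR (- e * v) * (q^-1 * (b * sin (b * v) - e * cos (b * v)))) => //.
    by rewrite /F mulNr; congr (_ * _); exact: mulrC.
  transitivity (expR (- (e * u)) * (q^-1 * (b * (cos (b * u) * b) - e * (- sin (b * u) * b))) +
    (q^-1 * (b * sin (b * u) - e * cos (b * u))) * (expR (- (e * u)) * - e)).
    by rewrite -(mulNr e u).
  by rewrite [u * b]mulrC /q; field; rewrite gt_eqF.
rewrite (@Rintegral_FTC0y _ _ F (- (e / q)) 0) ?sub0r ?opprK//.
- move=> u _; apply: cvgM; first exact: continuous_expRN.
  rewrite (_ : (fun _ => _) = (fun u => cos (b * u))); last by apply/funext => v; rewrite mulrC.
  by rewrite mulrC; exact: continuous_mulr_comp (@continuous_cos R) u.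
- exact: integrable_expRN_cos.
- apply: cvg_at_right_filter; have := cF 0.
  have <- : F 0 = - (e / q) by rewrite /F !mulr0 oppr0 expR0 mul1r sin0 cos0 mulr0 mulr1 sub0r mulNr.
  exact.
- apply/norm_cvg0P.
  have hC (u : R) : `|F u| <= (`|b| + e) / q * expR (- (e * u)).
    rewrite /F normrM mulrC (ger0_norm (expR_ge0 _)) ler_wpM2r ?expR_ge0//.
    rewrite normrM [X in _ * X]ger0_norm ?invr_ge0 ?(ltW q0)// ler_wpM2r ?invr_ge0 ?(ltW q0)//.
    apply: le_trans (ler_normB _ _) _; rewrite !normrM (gtr0_norm e0); apply: lerD.
      by rewrite ler_piMr// ler_norml sin_geN1 sin_le1.
    by rewrite ler_piMr ?(ltW e0)// ler_norml cos_geN1 cos_le1.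
  have h : (`|b| + e) / q * expR (- (e * u)) @[u --> +oo] --> (0 : R).
    rewrite -[X in _ --> X](mulr0 ((`|b| + e) / q)); apply: cvgM; first exact: cvg_cst.
    apply: (cvg_comp (fun u : R => e * u) _ _ (@cvgr_expR R)).
    by apply/cvgryPge => M; near=> u; rewrite -ler_pdivrMl.
  apply: (squeeze_cvgr _ (cvg_cst (0 : R)) h).
  by near=> u; rewrite normr_ge0/= hC.
Unshelve. all: by end_near. Qed.

End CosLaplace.

(** * Even and odd integrands on the line *)

Section Reflect.
Context {R : realType}.
Notation mu := (@lebesgue_measure R).
Notation H := (`]0%R, +oo[%classic : set R).

Lemma integral_reflect (f : R -> \bar R) : measurable_fun setT f ->
  (\int[mu]_(r in `[0%R, +oo[) f r = \int[mu]_(r in `]-oo, 0%R]) f (- r)%R)%E.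
Proof.
move=> mf; rewrite [LHS]integralE [RHS]integralE.
rewrite !ge0_integration_by_substitution0//=.
- by congr (_ - _)%E; apply: eq_integral => r _; rewrite !unlock.
- exact: measurable_funeneg.
- exact: measurable_funepos.
Qed.

Lemma Rintegral_setT_fold (f : R -> R) : mu.-integrable setT (EFin \o f) ->
  \int[mu]_u f u = \int[mu]_(u in H) f u + \int[mu]_(u in H) f (- u).
Proof.
move=> fi; have mf : measurable_fun setT f by apply/measurable_EFinP; exact: measurable_int fi.
have mN : measurable (`]-oo, 0%R]%classic : set R) by exact: measurable_itv.
have E : H `|` `]-oo, 0%R] = [set: R] by rewrite -[H]setCitvl setvU.
rewrite -E Rintegral_setU//; last 2 first.
- by rewrite E.
- apply/disj_setPS => u [] /=; rewrite !in_itv/= andbT.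
  by move=> u0 u0'; have := lt_le_trans u0 u0'; rewrite ltxx.
congr (_ + _); rewrite /Rintegral.
have mf' : measurable_fun setT (fun u : R => (f (- u))%:E).
  by apply/measurable_EFinP; apply: (measurableT_comp mf).
rewrite (integral_itv_obnd_cbnd (f := fun u => (f (- u))%:E)); last exact: measurable_funTS.
rewrite (integral_reflect mf').
by congr fine; apply: eq_integral => u _; rewrite opprK.
Qed.

Lemma Rintegral_even (f : R -> R) : mu.-integrable setT (EFin \o f) ->
  (forall u, f (- u) = f u) -> \int[mu]_u f u = 2 * \int[mu]_(u in H) f u.
Proof.
move=> fi fE; rewrite Rintegral_setT_fold// mulr_natl mulr2n; congr (_ + _).
by apply: eq_Rintegral => u _; rewrite fE.
Qed.

Lemma Rintegral_odd (f : R -> R) : mu.-integrable setT (EFin \o f) ->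
  (forall u, f (- u) = - f u) -> \int[mu]_u f u = 0.
Proof.
move=> fi fE; rewrite Rintegral_setT_fold//.
under [X in _ + X]eq_Rintegral do rewrite fE.
have -> : \int[mu]_(u in H) (- f u) = - \int[mu]_(u in H) f u; last exact: subrr.
under eq_Rintegral do rewrite -mulN1r.
by rewrite RintegralZl ?mulN1r//; apply: integrableS fi.
Qed.

Lemma integrable_invDsqr : mu.-integrable setT (fun u => ((1 + u ^+ 2)^-1)%:E).
Proof.
have m : measurable_fun setT (fun u : R => (1 + u ^+ 2)^-1).
  exact: continuous_measurable_fun (@continuous_oneDsqrV R).
have p (u : R) : 0 <= (1 + u ^+ 2)^-1 by rewrite invr_ge0 addr_ge0 ?sqr_ge0.
apply/integrableP; split; first exact/measurable_EFinP.
under eq_integral do rewrite /= ger0_norm//.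
rewrite ge0_symfun_integralT//; last 2 first.
- exact: (@continuous_oneDsqrV R).
- by move=> u /=; rewrite sqrrN.
by rewrite -set_itvcy integral0y_oneDsqr -EFinM ltry.
Qed.

End Reflect.

(** * Abel summation of the cosine transform *)

Section CosInversion.
Context d (T : measurableType d) (R : realType).
Variable P : {sigma_finite_measure set T -> \bar R}.
Notation mu := (@lebesgue_measure R).
Notation H := (`]0%R, +oo[%classic : set R).
Variables (A : set T) (mA : measurable A) (a B : T -> R).
Hypotheses (ma : measurable_fun setT a) (mB : measurable_fun setT B).
Hypotheses (a0 : forall w, 0 <= a w) (ia : P.-integrable A (EFin \o a)).

(** Adding a to f makes the integrand non-negative, so that measurability follows from Tonelli; the
    finite integral of a is subtracted afterwards. *)
Lemma measurable_Rintegral_le (f : measurableTypeR R * T -> R) : measurable_fun setT f ->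
  (forall p, `|f p| <= a p.2) ->
  measurable_fun setT (fun u : R => \int[P]_(w in A) f (u, w)).
Proof.
move=> mf fa.
have ma2 : measurable_fun setT (fun p : measurableTypeR R * T => a p.2).
  by apply: (measurableT_comp ma); exact: measurable_snd.
have fi u : P.-integrable A (fun w => (f (u, w))%:E).
  apply: le_integrable ia => //.
  - by apply/measurable_EFinP; apply: measurable_funTS; apply: measurableT_comp.
  - by move=> w _; rewrite /= lee_fin (le_trans (fa _))//= ler_norm.
have h := @measurable_integral_on _ _ (measurableTypeR R) T R P A mA
  (fun p => f p + a p.2) (measurable_funD mf ma2).
have {}h : measurable_fun setT (fun u : measurableTypeR R => \int[P]_(w in A) (f (u, w) + a w)%:E)%E.
  apply: h => u w /=; have := fa (u, w); rewrite ler_norml => /andP[+ _].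
  by rewrite -subr_ge0 opprK.
rewrite (_ : (fun _ => _) = (fun u => fine (\int[P]_(w in A) (f (u, w) + a w)%:E)%E - \int[P]_(w in A) a w)).
  by apply: measurable_funB => //; apply: measurableT_comp.
apply/funext => u.
rewrite -[X in _ = X - _]/(\int[P]_(w in A) (f (u, w) + a w)) RintegralD ?addrK//.
exact: fi.
Qed.

(** With [sin_transform], the real and imaginary parts of the Fourier transform of the image under B
    of the finite measure a dP on A. *)
Definition cos_transform (u : R) : R := \int[P]_(w in A) (a w * cos (u * B w)).
Definition sin_transform (u : R) : R := \int[P]_(w in A) (a w * sin (u * B w)).

Lemma measurable_cos_arg : measurable_fun setT
  (fun p : measurableTypeR R * T => a p.2 * cos (p.1 * B p.2)).
Proof.
apply: measurable_funM; first by apply: (measurableT_comp ma); exact: measurable_snd.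
apply: (measurableT_comp (continuous_measurable_fun (@continuous_cos R))).
by apply: measurable_funM => //; apply: (measurableT_comp mB); exact: measurable_snd.
Qed.

Lemma measurable_sin_arg : measurable_fun setT
  (fun p : measurableTypeR R * T => a p.2 * sin (p.1 * B p.2)).
Proof.
apply: measurable_funM; first by apply: (measurableT_comp ma); exact: measurable_snd.
apply: (measurableT_comp (continuous_measurable_fun (@continuous_sin R))).
by apply: measurable_funM => //; apply: (measurableT_comp mB); exact: measurable_snd.
Qed.

Lemma cos_arg_le (u : R) w : `|a w * cos (u * B w)| <= a w.
Proof. by rewrite normrM (ger0_norm (a0 w)) ler_piMr// ler_norml cos_geN1 cos_le1. Qed.

Lemma sin_arg_le (u : R) w : `|a w * sin (u * B w)| <= a w.
Proof. by rewrite normrM (ger0_norm (a0 w)) ler_piMr// ler_norml sin_geN1 sin_le1. Qed.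

Lemma measurable_cos_transform : measurable_fun setT cos_transform.
Proof.
exact: (measurable_Rintegral_le measurable_cos_arg (fun p => cos_arg_le p.1 p.2)).
Qed.

Lemma measurable_sin_transform : measurable_fun setT sin_transform.
Proof.
exact: (measurable_Rintegral_le measurable_sin_arg (fun p => sin_arg_le p.1 p.2)).
Qed.

Lemma integrable_cos_arg (u : R) : P.-integrable A (fun w => (a w * cos (u * B w))%:E).
Proof.
apply: le_integrable ia => //.
- apply/measurable_EFinP; apply: measurable_funTS; apply: measurable_funM => //.
  apply: (measurableT_comp (continuous_measurable_fun (@continuous_cos R))).
  exact: measurable_funM.
- by move=> w _; rewrite /= lee_fin (le_trans (cos_arg_le _ _))// ler_norm.
Qed.

Lemma integrable_sin_arg (u : R) : P.-integrable A (fun w => (a w * sin (u * B w))%:E).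
Proof.
apply: le_integrable ia => //.
- apply/measurable_EFinP; apply: measurable_funTS; apply: measurable_funM => //.
  apply: (measurableT_comp (continuous_measurable_fun (@continuous_sin R))).
  exact: measurable_funM.
- by move=> w _; rewrite /= lee_fin (le_trans (sin_arg_le _ _))// ler_norm.
Qed.

(** Fubini is legitimate because the damped integrand is bounded by e^(-e u) a(w), integrable on the
    product; without damping there is in general no integrability in u. *)
Lemma laplace_cos_transform (e : R) : 0 < e ->
  \int[mu]_(u in H) (expR (- (e * u)) * cos_transform u) =
  \int[P]_(w in A) (a w * (e / (e ^+ 2 + B w ^+ 2))).
Proof.
move=> e0.
pose f (p : measurableTypeR R * T) := expR (- (e * p.1)) * (a p.2 * cos (p.1 * B p.2)).
have mexp : measurable_fun setT (fun p : measurableTypeR R * T => expR (- (e * p.1))).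
  apply: measurableT_comp => //; apply: measurableT_comp => //; exact: measurable_funM.
have mf : measurable_fun setT f by apply: measurable_funM => //; exact: measurable_cos_arg.
have i2 u : H u -> P.-integrable A (fun w => (f (u, w))%:E).
  by move=> _; have := integrableZl mA (expR (- (e * u))) (integrable_cos_arg u).
have i1 w : A w -> lebesgue_measure.-integrable (H : set (measurableTypeR R)) (fun u => (f (u, w))%:E).
  move=> _; have := integrableZl measurable_halfline (a w) (integrable_expRN_cos (B w) e0).
  by apply: eq_integrable; [exact: measurable_halfline|move=> u _; rewrite -EFinM mulrCA].
have fin : (\int[lebesgue_measure]_(u in (H : set (measurableTypeR R))) \int[P]_(w in A) `|f (u, w)|%:E < +oo)%E.
  apply: le_lt_trans (_ : (\int[lebesgue_measure]_(u in (H : set (measurableTypeR R))) (expR (- (e * u)) * \int[P]_(w in A) a w)%:E < +oo)%E).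
    apply: ge0_le_integral => //.
    - by move=> u _; exact: integral_ge0.
    - apply: measurable_funTS.
      apply: (@measurable_integral_on _ _ (measurableTypeR R) T R P A mA (fun p => `|f p|)) => //.
      exact: measurableT_comp.
    - apply/measurable_EFinP; apply: measurable_funTS; apply: measurable_funM => //.
      exact: measurable_expRN.
    move=> u _; rewrite EFinM /Rintegral fineK; last exact: integrable_fin_num.
    rewrite -ge0_integralZl ?lee_fin ?expR_ge0//; last 2 first.
    - exact: measurable_int ia.
    - by move=> w _; rewrite lee_fin.
    apply: ge0_le_integral => //.
    - apply/measurable_EFinP; apply: measurable_funTS; apply: measurableT_comp => //.
      exact: (measurableT_comp mf).
    - by apply: measurable_funeM; exact: measurable_int ia.
    move=> w _; rewrite -EFinM lee_fin /f normrM ger0_norm ?expR_ge0// ler_wpM2l ?expR_ge0//.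
    exact: cos_arg_le.
  have := integrableZr measurable_halfline (\int[P]_(w in A) a w) (integrable_expRN e0).
  move=> /integrableP[_]; apply: le_lt_trans; apply: ge0_le_integral => //.
  - by move=> u _; rewrite lee_fin mulr_ge0 ?expR_ge0//; apply: Rintegral_ge0 => w _; exact: a0.
  - apply/measurable_EFinP; apply: measurable_funTS; apply: measurable_funM => //.
    exact: measurable_expRN.
  - apply/measurable_EFinP; apply: measurable_funTS; apply: measurableT_comp => //.
    apply: measurable_funM => //.
    exact: measurable_expRN.
  - by move=> u _; rewrite -EFinM lee_fin ler_norm.
have [_ h] := @fubini_on _ _ (measurableTypeR R) T R lebesgue_measure P H A measurable_halfline mA f mf fin i2 i1.
transitivity (\int[mu]_(u in H) \int[P]_(w in A) f (u, w)).
  by apply: eq_Rintegral => u _; rewrite /f/= RintegralZl//; exact: integrable_cos_arg.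
rewrite [LHS]h; apply: eq_Rintegral => w _.
rewrite -(Rintegral_expRN_cos (B w) e0) -RintegralZl//; last exact: integrable_expRN_cos.
by apply: eq_Rintegral => u _; rewrite /f/= mulrCA.
Qed.

(** The transform itself is integrable and dominates its damped versions, so the damping 1/(n + 1)
    can be sent to 0 under the integral. *)
Lemma cos_inversion (L : R) : mu.-integrable H (EFin \o cos_transform) ->
  (fun n : nat => \int[P]_(w in A) (a w * (n.+1%:R^-1 / (n.+1%:R^-1 ^+ 2 + B w ^+ 2)))) @ \oo --> L ->
  \int[mu]_(u in H) cos_transform u = L.
Proof.
move=> iJ cL.
pose F (n : nat) (u : R) := (expR (- (n.+1%:R^-1 * u)) * cos_transform u)%:E.
have e0 (n : nat) : 0 < n.+1%:R^-1 :> R by rewrite invr_gt0.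
have mJ := measurable_cos_transform.
have mF n : measurable_fun H (F n).
  apply/measurable_EFinP; apply: measurable_funTS; apply: measurable_funM => //.
  exact: measurable_expRN.
have cF : {ae mu, forall u, H u -> F n u @[n --> \oo] --> (cos_transform u)%:E}.
  apply: aeW => u _; apply: cvg_EFin; first by near=> n.
  rewrite -[X in _ --> X]mul1r; apply: cvgM; last exact: cvg_cst.
  have c0 : - (n.+1%:R^-1 * u) @[n --> \oo] --> (- (0 * u) : R).
    by apply: cvgN; apply: cvgM; [exact: cvg_harmonic|exact: cvg_cst].
  rewrite mul0r oppr0 in c0.
  by have := cvg_comp _ _ c0 (@continuous_expR R 0); rewrite expR0.
have bF : {ae mu, forall u n, H u -> (`|F n u| <= `|(cos_transform u)%:E|)%E}.
  apply: aeW => u n /halflineP u0; rewrite lee_fin normrM ler_piMl//.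
  by rewrite ger0_norm ?expR_ge0// -expR0 ler_expR oppr_le0 mulr_ge0// ltW.
have /(and3_rec (fun _ _ h => h)) h := dominated_convergence measurable_halfline mF
  (measurable_int _ iJ) cF (integrable_abse iJ) bF.
have fJ := integrable_fin_num measurable_halfline iJ.
rewrite -(fineK fJ) in h; have {}h := fine_cvg h.
suff cJ : (fun n : nat => \int[P]_(w in A) (a w * (n.+1%:R^-1 / (n.+1%:R^-1 ^+ 2 + B w ^+ 2)))) @ \oo -->
  \int[mu]_(u in H) cos_transform u by exact: (cvg_unique _ cJ cL).
rewrite (_ : (fun _ => _) = fine \o (fun n => \int[mu]_(u in H) F n u)%E); first exact: h.
by apply/funext => n; rewrite -(laplace_cos_transform (e0 n)).
Unshelve. all: by end_near. Qed.

End CosInversion.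

(** * The Fox H-function *)

Section Contour.
Context {R : realType}.
Notation Re := complex.Re.
Variable beta : R.

(** The poles of Gamma(s) are 0, -1, -2, ...; as n = 0, nothing bounds the line on the right. *)
Lemma foxH_contourP (c : R) :
  foxH_contour 1 0 [tuple ((1 - beta)%:C, beta)] [tuple (0, 1)] c <-> 0 < c.
Proof.
have e (s : R[i]) : 0 + 1%:C * s = s by rewrite add0r rmorph1 mul1r.
split=> [[h _]|c0].
  have := h (0, 1) 0; rewrite inE eqxx e => /(_ isT); apply.
  by exists 0%N; rewrite oppr0.
split=> [b s|a s]; last by rewrite take0.
rewrite inE => /eqP ->; rewrite e => -[k ->]; apply: le_lt_trans c0.
by rewrite -(rmorph_nat (real_complex R)) -rmorphN Re_realC oppr_le0.
Qed.

Lemma foxH_chiE (s : R[i]) : 0 < beta -> beta < 1 -> 0 < Re s ->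
  foxH_chi 1 0 [tuple ((1 - beta)%:C, beta)] [tuple (0, 1)] s =
  cGamma_integral s / cGamma_integral ((1 - beta)%:C + beta%:C * s).
Proof.
move=> b0 b1 s0; rewrite /foxH_chi take0 drop0.
have -> : take 1 [tuple (0 : R[i], 1 : R)] = [:: (0, 1)] by [].
have -> : drop 1 [tuple (0 : R[i], 1 : R)] = [::] by [].
rewrite !big_nil !big_seq1 mul1r mulr1 add0r rmorph1 mul1r !cGamma_ReP//.
have -> : Re ((1 - beta)%:C + beta%:C * s) = 1 - beta + beta * Re s.
  by case: (s) => u v; simpc.
by rewrite addr_gt0 ?subr_gt0// mulr_gt0.
Qed.

End Contour.

(** * Evaluation of the line integral *)

Section Inversion.
Context {d : measure_display} {T : measurableType d} {R : realType}.
Variables (P : probability T R) (beta : R) (D : R -> {RV P >-> R}).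
Hypotheses (b0 : 0 < beta) (b1 : beta < 1) (hD : stable_subordinator beta D).
Variables (t : R) (t0 : 0 < t) (g : R -> R).
Hypothesis hg : density_on_pos P (inverse_subordinator D t) g.
Hypothesis hgc : {in `]0, +oo[, continuous g}.
Variables (x : R) (x0 : 0 < x) (c : R) (c0 : 0 < c).
Notation mu := (@lebesgue_measure R).
Notation H := (`]0%R, +oo[%classic : set R).
Notation Re := complex.Re.
Notation Im := complex.Im.
Notation normc := ComplexField.Normc.normc.
Notation X := (incr0 D 1).
Notation A := (incr_pos D).
Notation Y := (inv_rv beta D t).
Notation z := (x / t `^ beta).
Let mA : measurable A := measurable_incr_pos D.

(* The integrand of the line integral at c + iu is t^beta times the expectation
   of tilt * exp(i u log_ratio). *)
Definition tilt (w : T) : R := Y w `^ (- 1) * (Y w / x) `^ c.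
Definition log_ratio (w : T) : R := ln (Y w / x).

Let tb0 : 0 < t `^ beta. Proof. exact: powR_gt0. Qed.
Let z0 : 0 < z. Proof. exact: divr_gt0. Qed.

(** Since Y = t^beta X^(-beta) and z = x / t^beta, one has Y / x = X^(-beta) / z and X^beta = t^beta
    / Y. *)
Lemma cpow_inv_rv (s : R[i]) w : A w ->
  cpow z (- s) * cpow (X w) (beta%:C * (1 - s)) =
  (t `^ beta)%:C * ((Y w `^ (- 1))%:C * cpow (Y w / x) s).
Proof.
move=> Aw; have X0 : 0 < X w := Aw; have Y0 := inv_rv_gt0 beta t0 Aw.
have Xb0 : 0 < X w `^ (- beta) by exact: powR_gt0.
have YE : Y w = t `^ beta * X w `^ (- beta).
  by rewrite /inv_rv powRM ?invr_ge0 ?ltW// powRN -(powR_inv1 (ltW X0)) -!powRrM mulN1r powRN.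
have zV : z^-1 = z `^ (-1) by rewrite powR_inv1 ?ltW.
have -> : Y w / x = X w `^ (- beta) * z^-1.
  by rewrite YE invf_div; ring.
rewrite (@cpowM _ (X w `^ (- beta)) z^-1)%R ?invr_gt0// cpow_powR zV cpow_powR.
have -> : (-1)%:C * s = - s :> R[i] by rewrite rmorphN rmorph1 mulN1r.
have -> : (t `^ beta)%:C * ((Y w `^ (- 1))%:C * (cpow (X w) ((- beta)%:C * s) * cpow z (- s))) =
    cpow z (- s) * ((t `^ beta * Y w `^ (-1))%:C * cpow (X w) ((- beta)%:C * s)).
  by rewrite rmorphM; ring.
congr (_ * _).
have -> : t `^ beta * Y w `^ (-1) = X w `^ beta.
  by rewrite powR_inv1 ?ltW// YE powRN; field; rewrite !gt_eqF// powR_gt0.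
rewrite -cpow_real// -cpowD; congr cpow.
by rewrite rmorphN mulrBr mulr1 mulNr.
Qed.

Lemma tilt_ge0 w : 0 <= tilt w.
Proof. by rewrite mulr_ge0 ?powR_ge0. Qed.

Lemma measurable_tilt : measurable_fun setT tilt.
Proof.
have mY := measurable_inv_rv hD t.
apply: measurable_funM; first exact: (measurableT_comp (measurable_powR _)).
by apply: (measurableT_comp (measurable_powR _)); exact: measurable_funM.
Qed.

Lemma measurable_log_ratio : measurable_fun setT log_ratio.
Proof.
have mY := measurable_inv_rv hD t.
by apply: (measurableT_comp (@measurable_ln R)); exact: measurable_funM.
Qed.

(** Moduli in [cpow_inv_rv] at the real point s = c show that the tilt is a constant multiple of
    X^(beta (1 - c)). *)
Lemma integrable_tilt : P.-integrable A (EFin \o tilt).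
Proof.
have := integrableZl mA (z `^ (- c) / t `^ beta) (integrable_moment b0 b1 hD c0).
apply: eq_integrable => // w /set_mem Aw; rewrite /= -EFinM; congr EFin.
have := congr1 (@ComplexField.Normc.normc R) (cpow_inv_rv c%:C Aw).
rewrite ComplexField.Normc.normcM !normc_cpow// ReZ.
have -> : Re (1 - c%:C) = 1 - c by rewrite -(rmorph1 (real_complex R)) -rmorphB.
have Yx0 : 0 < Y w / x by rewrite divr_gt0// inv_rv_gt0.
rewrite 2!normcZ !ger0_norm ?powR_ge0// normc_cpow//.
rewrite -rmorphN !Re_realC => h.
by rewrite mulrAC h mulrC mulKf// gt_eqF.
Qed.

Notation J := (cos_transform P A tilt log_ratio).
Notation S := (sin_transform P A tilt log_ratio).

(** The Mellin identity is solved for the moment; this is where the non-vanishing of Gamma is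
    used. *)
Lemma foxH_chi_moment (s : R[i]) : 0 < Re s ->
  foxH_chi 1 0 [tuple ((1 - beta)%:C, beta)] [tuple (0, 1)] s = moment beta D s.
Proof.
move=> s0; have [_ mE] := mellin_identity b0 b1 hD s0.
have q0 : 0 < Re ((1 - beta)%:C + beta%:C * s).
  have -> : Re ((1 - beta)%:C + beta%:C * s) = 1 - beta + beta * Re s by case: (s) => u v; simpc.
  by rewrite addr_gt0 ?subr_gt0// mulr_gt0.
rewrite foxH_chiE// -mE -/(moment beta D s).
by rewrite [X in X / _]mulrC mulfK// cGamma_integral_neq0.
Qed.

Lemma foxH_integrandE (u : R) :
  foxH_integrand 1 0 [tuple ((1 - beta)%:C, beta)] [tuple (0, 1)] z (c +i* u) =
  (t `^ beta)%:C * (J u +i* S u).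
Proof.
have s0 : 0 < Re (c +i* u) by [].
have [iC mE] := mellin_identity b0 b1 hD s0.
rewrite /foxH_integrand (foxH_chi_moment s0) (mulrC (moment _ _ _)).
rewrite -[LHS](CintZ (cpow z (- (c +i* u))) mA iC).
transitivity (Cint P A (fun w => (t `^ beta)%:C * ((Y w `^ (- 1))%:C * cpow (Y w / x) (c +i* u)))).
  by apply: eq_Cint => w Aw; exact: cpow_inv_rv.
rewrite [RHS](_ : _ = (t `^ beta * J u) +i* (t `^ beta * S u)); last by simpc.
congr (_ +i* _).
- rewrite -RintegralZl//; last by apply: integrable_cos_arg; [exact: mA|exact: measurable_tilt|exact: measurable_log_ratio|exact: tilt_ge0|exact: integrable_tilt].
  apply: eq_Rintegral => w /set_mem Aw.
  rewrite 2!ReZ Re_cpow; last by rewrite divr_gt0// inv_rv_gt0.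
  by rewrite /tilt /log_ratio -mulrA.
- rewrite -RintegralZl//; last by apply: integrable_sin_arg; [exact: mA|exact: measurable_tilt|exact: measurable_log_ratio|exact: tilt_ge0|exact: integrable_tilt].
  apply: eq_Rintegral => w /set_mem Aw.
  rewrite 2!ImZ Im_cpow; last by rewrite divr_gt0// inv_rv_gt0.
  by rewrite /tilt /log_ratio -mulrA.
Qed.

Lemma transform_bound : exists C : R, forall u,
  `|J u| <= C * (1 + u ^+ 2)^-1 /\ `|S u| <= C * (1 + u ^+ 2)^-1.
Proof.
have [C C_ge0 hC] := moment_decay b0 b1 hD c0.
(* The first factor passes from chi to the transforms; the last comes from 1 + u^2 <= (1 + c^(-2))
   (c^2 + u^2), where c^2 + u^2 is |s|^2. *)
exists (z `^ (- c) / t `^ beta * C * (1 + c^-2)) => u.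
have s0 : 0 < Re (c +i* u) by [].
have hn : normc (J u +i* S u) <= z `^ (- c) / t `^ beta * C * (1 + c^-2) * (1 + u ^+ 2)^-1.
  have := congr1 (@ComplexField.Normc.normc R) (foxH_integrandE u).
  rewrite normcZ ger0_norm ?(ltW tb0)// => /esym h.
  rewrite -[leLHS](mulKf (lt0r_neq0 tb0)) h.
  have -> : normc (foxH_integrand 1 0 [tuple ((1 - beta)%:C, beta)] [tuple (0, 1)] z (c +i* u)) =
      normc (moment beta D (c +i* u)) * z `^ (- c).
    by rewrite /foxH_integrand foxH_chi_moment// ComplexField.Normc.normcM normc_cpow.
  have := hC (c +i* u) erefl.
  have -> : normc (c +i* u) ^+ 2 = c ^+ 2 + u ^+ 2.
    by rewrite normc_sqrt sqr_sqrtr// addr_ge0 ?sqr_ge0.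
  move=> h2.
  have cu0 : 0 < c ^+ 2 + u ^+ 2 by rewrite ltr_wpDr ?sqr_ge0// exprn_gt0.
  have u1 : 0 < 1 + u ^+ 2 by rewrite ltr_wpDr ?sqr_ge0.
  have h3 : normc (moment beta D (c +i* u)) <= C * (1 + c^-2) * (1 + u ^+ 2)^-1.
    apply: le_trans (_ : C / (c ^+ 2 + u ^+ 2) <= _); first by rewrite ler_pdivlMr.
    rewrite -mulrA ler_wpM2l// ler_pdivlMr// mulrC ler_pdivrMr//.
    rewrite mulrDl mul1r mulrDr mulVf ?expf_neq0 ?gt_eqF//.
    have : 0 <= c^-2 * u ^+ 2 by rewrite mulr_ge0 ?sqr_ge0// invr_ge0 sqr_ge0.
    have := sqr_ge0 c; lra.
  rewrite [leLHS](_ : _ = z `^ (- c) / t `^ beta * normc (moment beta D (c +i* u))); last first.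
    by rewrite mulrC [X in X / _]mulrC mulrAC.
  have k0 : 0 <= z `^ (- c) / t `^ beta by rewrite divr_ge0 ?powR_ge0.
  by apply: le_trans (ler_wpM2l k0 h3) _; rewrite !mulrA.
split; apply: le_trans hn; [exact: (normr_Re_le (_ +i* _))|exact: (normr_Im_le (_ +i* _))].
Qed.

Lemma integrable_transform : mu.-integrable setT (EFin \o J) /\ mu.-integrable setT (EFin \o S).
Proof.
have [C hC] := transform_bound.
have iC : mu.-integrable setT (fun u : R => (C * (1 + u ^+ 2)^-1)%:E).
  by have := integrableZl measurableT C (@integrable_invDsqr R).
split; apply: le_integrable iC => //.
- apply/measurable_EFinP; exact: (measurable_cos_transform mA measurable_tilt measurable_log_ratio tilt_ge0 integrable_tilt).
- by move=> u _; rewrite /= lee_fin (le_trans (hC u).1)// ler_norm.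
- apply/measurable_EFinP; exact: (measurable_sin_transform mA measurable_tilt measurable_log_ratio tilt_ge0 integrable_tilt).
- by move=> u _; rewrite /= lee_fin (le_trans (hC u).2)// ler_norm.
Qed.

Let h (y : R) : R := (y / x) `^ c * g y.

Lemma integral_tilt (phi : R -> R) : measurable_fun setT phi -> (forall y, 0 <= phi y) ->
  (\int[P]_(w in A) (tilt w * phi (Y w))%:E =
   \int[mu]_(y in H) (y^-1 * h y * phi y)%:E)%E.
Proof.
move=> mphi phi0.
have := ge0_integral_inv_rv b0 b1 hD t0 hg (phi := fun y => (y `^ (-1) * (y / x) `^ c * phi y)%:E).
move=> ->.
- apply: eq_integral => y /set_mem/halflineP y0.
  rewrite -EFinM; congr EFin; rewrite powR_inv1 ?ltW// /h; ring.
- by move=> y; rewrite lee_fin !mulr_ge0 ?powR_ge0.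
- apply/measurable_EFinP; apply: measurable_funM => //; apply: measurable_funM => //.
  by apply: (measurableT_comp (measurable_powR _)); exact: measurable_funM.
Qed.

Let mh : measurable_fun H h.
Proof.
case: hg => mg _ _; apply: measurable_funM => //; apply: measurable_funTS.
by apply: (measurableT_comp (measurable_powR _)); exact: measurable_funM.
Qed.

Let h_ge0 y : 0 < y -> 0 <= h y.
Proof. by case: hg => _ g0 _ y0; rewrite mulr_ge0 ?powR_ge0 ?g0. Qed.

(** By [integral_tilt] with phi = 1, the integral is the expectation of the tilt over A. *)
Let integrable_h : mu.-integrable H (fun y => (y^-1 * h y)%:E).
Proof.
apply/integrableP; split.
  apply/measurable_EFinP; apply: measurable_funM => //.
  apply: open_continuous_measurable_fun => //.
  move=> y /set_mem/halflineP y0; apply: cvgV; [by rewrite gt_eqF|exact: cvg_id].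
have m1 : measurable_fun setT (cst 1 : R -> R) by exact: measurable_cst.
have := integral_tilt m1 (fun y => ler01).
under [X in X = _ -> _]eq_integral do rewrite mulr1.
under [X in _ = X -> _]eq_integral do rewrite mulr1.
move=> e; under eq_integral => y /set_mem/halflineP y0.
  rewrite /= ger0_norm; last by rewrite mulr_ge0 ?h_ge0// invr_ge0 ltW.
  over.
rewrite -e; have /integrableP[_] := integrable_tilt.
by under [X in (X < _)%E -> _]eq_integral => w _ do rewrite /= ger0_norm ?tilt_ge0//.
Qed.

(** The factor (y / x)^c in h equals 1 at y = x, so the limit pi h(x) depends on c no longer.
    Continuity of g at x enters here. *)
Lemma Rintegral_cos_transform : \int[mu]_(u in H) J u = pi * g x.
Proof.
have hx : h x = g x by rewrite /h divff ?gt_eqF// powR1 mul1r.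
have ch : {for x, continuous h}.
  apply: cvgM; last by apply: hgc; rewrite in_itv/= x0.
  apply: (@continuous_comp _ _ _ (fun y : R => y / x) (fun y => y `^ c)).
    by apply: cvgM; [exact: cvg_id|exact: cvg_cst].
  by apply: continuous_powR; rewrite divr_gt0.
rewrite -hx.
apply: (cos_inversion mA measurable_tilt measurable_log_ratio tilt_ge0 integrable_tilt).
  by apply: integrableS integrable_transform.1.
have := approx_log_kernel x0 mh h_ge0 ch integrable_h.
apply: cvg_trans; apply: near_eq_cvg; near=> n.
pose e : R := n.+1%:R^-1; have e0 : 0 < e by rewrite invr_gt0.
have q0 (y : R) : 0 < e ^+ 2 + y ^+ 2 by rewrite ltr_wpDr ?sqr_ge0// exprn_gt0.
have mphi : measurable_fun setT (fun y : R => e / (e ^+ 2 + ln (y / x) ^+ 2)).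
  apply: measurable_funM => //.
  have mi : measurable_fun setT (fun v : R => (e ^+ 2 + v ^+ 2)^-1).
    apply: continuous_measurable_fun => v; apply: cvgV; first by rewrite gt_eqF.
    apply: cvgD; [exact: cvg_cst|exact: exprn_continuous].
  have ml : measurable_fun setT (fun y : R => ln (y / x)).
    by apply: (measurableT_comp (@measurable_ln R)); exact: measurable_funM.
  exact: (measurableT_comp mi ml).
(* With this phi, the product y^(-1) phi(y) is [log_kernel x e y]. *)
have := integral_tilt mphi (fun y => divr_ge0 (ltW e0) (ltW (q0 _))).
rewrite /Rintegral -/e => ->; congr fine; apply: eq_integral => y _.
by rewrite /log_kernel; congr EFin; ring.
Unshelve. all: by end_near. Qed.

(** The cosine transform is even and the sine transform odd in u, so the integral over the line is
    twice that over u > 0, namely 2 pi g(x), and the prefactor 1 / (2 pi i) cancels against ds = i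
    du. *)
Lemma foxH_line_integralE :
  Cintegrable setT (fun u => foxH_integrand 1 0 [tuple ((1 - beta)%:C, beta)] [tuple (0, 1)] z (c +i* u)) /\
  foxH_line_integral 1 0 [tuple ((1 - beta)%:C, beta)] [tuple (0, 1)] c z = (t `^ beta * g x)%:C.
Proof.
have [iJ iS] := integrable_transform.
pose F (u : R) : R[i] := J u +i* S u.
have iF : Cintble mu setT F by [].
have eF : (fun u => foxH_integrand 1 0 [tuple ((1 - beta)%:C, beta)] [tuple (0, 1)] z (c +i* u)) =
  (fun u => (t `^ beta)%:C * F u).
  by apply/funext => u; exact: foxH_integrandE.
rewrite eF; split; first exact: (@CintbleZ _ (measurableTypeR R) R lebesgue_measure setT F _ measurableT iF).
rewrite /foxH_line_integral.
have -> : (fun u => foxH_integrand 1 0 [tuple ((1 - beta)%:C, beta)] [tuple (0, 1)] z (c +i* u) * (0 +i* 1)) =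
  (fun u => ((0 +i* 1) * (t `^ beta)%:C) * F u).
  by apply/funext => u; rewrite foxH_integrandE mulrC mulrA.
have -> : Cintegral setT (fun u => ((0 +i* 1) * (t `^ beta)%:C) * F u) =
  ((0 +i* 1) * (t `^ beta)%:C) * Cint mu setT F.
  exact: (@CintZ _ (measurableTypeR R) R lebesgue_measure setT F _ measurableT iF).
have -> : Cint mu setT F = (2 * pi * g x)%:C.
  rewrite /Cint /F/=; congr (_ +i* _).
    rewrite (Rintegral_even iJ); last first.
      by move=> u; apply: eq_Rintegral => w _; rewrite mulNr cosN.
    by rewrite Rintegral_cos_transform mulrA.
  apply: (Rintegral_odd iS) => u; rewrite /sin_transform.
  under eq_Rintegral do rewrite mulNr sinN mulrN -mulN1r.
  rewrite RintegralZl ?mulN1r//.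
  by apply: integrable_sin_arg; [exact: mA|exact: measurable_tilt|exact: measurable_log_ratio|exact: tilt_ge0|exact: integrable_tilt].
have i0 : (0 +i* 1 : R[i]) != 0 by rewrite eq_complex/= oner_eq0 andbF.
have p0 : (pi%:C : R[i]) != 0 by rewrite real_complex_neq0 gt_eqF ?pi_gt0.
have two0 : (2 : R[i]) != 0 by rewrite -(rmorph_nat (real_complex R)) real_complex_neq0.
rewrite !rmorphM rmorph_nat.
rewrite [X in _ * X](_ : _ = (2 * pi%:C * (0 +i* 1)) * ((t `^ beta)%:C * (g x)%:C)); last by ring.
by rewrite mulKf// !mulf_neq0.
Qed.

End Inversion.

Theorem theorem4p1 (R : realType) (d : measure_display) (T : measurableType d)
  (P : probability T R) (beta : R) (hbeta0 : 0 < beta) (hbeta1 : beta < 1)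
  (D : R -> {RV P >-> R}) (hD : stable_subordinator beta D)
  (t : R) (ht : 0 < t)
  (g : R -> R) (hg : density_on_pos P (inverse_subordinator D t) g)
  (hgc : {in `]0, +oo[, continuous g}) :
  forall x : R, 0 < x ->
    exists2 h : R[i],
      is_foxH 1 0 [tuple ((1 - beta)%:C, beta)] [tuple (0, 1)]
        (x / t `^ beta) h
      & (g x)%:C = (1 / t `^ beta)%:C * h.
Proof.
move=> x x0; have tb0 : 0 < t `^ beta by exact: powR_gt0.
exists (t `^ beta * g x)%:C; last first.
  by rewrite -rmorphM; congr (_%:C); rewrite div1r mulKf// gt_eqF.
split => //.
- by split=> [a|b]; rewrite inE => /eqP ->.
- exact: divr_gt0.
- by exists 1; apply/foxH_contourP.
- move=> c /foxH_contourP c0.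
  exact: (foxH_line_integralE hbeta0 hbeta1 hD ht hg hgc x0 c0).
Qed.
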